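(* Let $B_0\colon\mathfrak{u}_1\ni z\mapsto B^z_0:=d(\mathrm{grad}\,\mathcal{B}_0)|_z\in\mathcal{L}(\mathfrak{h}_1,\mathfrak{h}_0)$ be the field of Hessian operators of the regularized Lagrangian action functional $\mathcal{B}_0$ in the Kepler case (no magnetic term), as defined in the context. Then the following holds. (i) $B_0$ defines a weak Hessian field along the set $\mathfrak{u}_1$. (ii) The weak Hessian field $B_0$ almost extends.
   Context: **Conventions.** $\mathbb{C}\simeq\mathbb{R}^2$; $\mathbb{S}^1=\mathbb{R}/\mathbb{Z}$; $\langle\cdot,\cdot\rangle$ and $\|\cdot\|$ are the real $L^2(\mathbb{S}^1,\mathbb{C})$ inner product and norm, with $\langle z,w\rangle=\int_0^1\mathrm{Re}(\bar z w)d\tau$; $'=\frac{d}{d\tau}$. $\mathcal{L}(X,Y)$ denotes bounded linear operators, $\mathcal{L}(X)=\mathcal{L}(X,X)$. **Spaces.** $Z\subset\mathbb{C}$ is open with $0\in Z$. $(\mathfrak{h}_0,\mathfrak{h}_1,\mathfrak{h}_2)=(L^2(\mathbb{S}^1,\mathbb{C}),W^{2,2}(\mathbb{S}^1,\mathbb{C}),W^{4,2}(\mathbb{S}^1,\mathbb{C}))$, $\mathfrak{h}_r=W^{2r,2}(\mathbb{S}^1,\mathbb{C})$ for real $r\in[0,1)$, $\mathfrak{u}_1=\{z\in\mathfrak{h}_1\mid z\not\equiv0,\ z(\tau)\in Z\ \forall\tau\}$, $\mathfrak{u}_2=\mathfrak{u}_1\cap\mathfrak{h}_2$. **Functional.**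 $\mathcal{B}_0\colon\mathfrak{u}_1\to\mathbb{R}$, $\mathcal{B}_0(z)=2\|z\|^2\|z'\|^2+\frac{1}{\|z\|^2}$. Its $L^2$-gradient is $\mathrm{grad}\,\mathcal{B}_0\colon\mathfrak{u}_1\to\mathfrak{h}_0$, $\mathrm{grad}\,\mathcal{B}_0|_z=4\|z'\|^2z-4\|z\|^2z''-\frac{2z}{\|z\|^4}$. **Weak Hessian field.** For a Hilbert space triple $(H_0,H_1,H_2)$, $U_1\subset H_1$ open and $U_2=U_1\cap H_2$, a weak Hessian field on $U_1$ is a map $u\mapsto A^u$ in $C^0(U_1,\mathcal{L}(H_1,H_0))\cap C^0(U_2,\mathcal{L}(H_2,H_1))$ (the second meaning: for $u\in U_2$ the restriction $A^u_2=A^u|_{H_2}$ maps $H_2$ to $H_1$, continuously in $u$) such that (Symmetry) $\langle A^ux,y\rangle_{H_0}=\langle x,A^uy\rangle_{H_0}$ for all $u\in U_1$, $x,y\in H_1$; (Fredholm) $A^u\colon H_1\to H_0$ is Fredholm of index zero for all $u\in U_1$ and $A^u_2\colon H_2\to H_1$ is Fredholm of index zero for all $u\in U_2$. **Almost extends.** A weak Hessian field $A$ on $U_1$ almost extends if there is a decomposition $A=F+C$ with $F\in C^0(U_1,\mathcal{L}(H_1,H_0)\cap\mathcal{L}(H_2,H_1))$ and, for some $r\in[0,1)$, $C\in C^0(U_1,\mathcal{L}(H_r,H_0))\cap C^0(U_2,\mathcal{L}(H_1,H_1))$ such that: (F) for every $u\in U_1$, $F^u|_{H_2}\colon H_2\to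 H_1$ is Fredholm of index zero; (C) every $u\in U_1$ has an $H_1$-open neighborhood $V_u$ and a constant $\kappa$ such that for all $v,w\in V_u\cap H_2$ $$\|C^v-C^w\|_{\mathcal{L}(H_1)}\le\kappa\bigl(|v-w|_{H_2}+\min\{|v|_{H_2},|w|_{H_2}\}\,|v-w|_{H_1}\bigr).$$ These are applied with $H_\bullet=\mathfrak{h}_\bullet$, $U_k=\mathfrak{u}_k$. *)

(* Defs.v *)
From HB Require Import structures.
From mathcomp Require Import all_boot all_order all_algebra.
From mathcomp Require Import all_classical all_reals all_analysis.

Set Implicit Arguments.
Unset Strict Implicit.
Unset Printing Implicit Defensive.

Import Order.TTheory GRing.Theory Num.Theory.
Import numFieldNormedType.Exports.

Local Open Scope classical_set_scope.
Local Open Scope ring_scope.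

(* All spaces of a Hilbert space triple or scale H_2 `<=` H_1 `<=` H_0 are linear subspaces of one real
   vector space V, each with its own norm.  An operator X -> Y is given by a
   function V -> V of which only the values on X matter, so restricting it to
   a smaller space leaves the function unchanged. *)
Record normed_subspace (R : realType) (V : lmodType R) := NormedSubspace {
  carrier : set V ;
  snorm : V -> R
}.

Section Operators.
Context (R : realType) (V : lmodType R).
Implicit Types (X Y H : normed_subspace V) (U K M : set V) (T : V -> V).

Definition open_in X U : Prop :=
  U `<=` carrier X /\
  forall u, U u -> exists2 e : R, 0 < e &
    forall v, carrier X v -> snorm X (v - u) < e -> U v.

Definition linear_on X T : Prop :=
  forall (a : R) x y, carrier X x -> carrier X y ->
    T (a *: x + y) = a *: T x + T y.

(* L(X, Y) *)
Definition bounded_op X Y : set (V -> V) := [set T |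
  [/\ (forall x, carrier X x -> carrier Y (T x)),
      linear_on X T &
      exists c : R, forall x, carrier X x -> snorm Y (T x) <= c * snorm X x]].

Definition opnorm X Y T : R :=
  sup [set snorm Y (T x) | x in [set x | carrier X x /\ snorm X x <= 1]].

(* A is in C^0(U, L(X, Y)), where U carries the topology of H. *)
Definition continuous_field H U X Y (A : V -> V -> V) : Prop :=
  (forall u, U u -> bounded_op X Y (A u)) /\
  forall u, U u -> forall e : R, 0 < e -> exists2 d : R, 0 < d &
    forall v, U v -> snorm H (v - u) < d -> opnorm X Y (A v - A u) < e.

(* dim K / M = n: the classes of e_0, ..., e_{n-1} form a basis of K / M. *)
Definition quotient_dim K M (n : nat) : Prop :=
  exists e : 'I_n -> V, (forall i, K (e i)) /\
    forall x, K x -> exists! c : 'rV[R]_n, M (x - \sum_(i < n) c 0 i *: e i).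

Definition kernel X T : set V := [set x | carrier X x /\ T x = 0].

Definition image_closed X Y T : Prop :=
  forall y, carrier Y y ->
    (forall e : R, 0 < e ->
       exists2 x, carrier X x & snorm Y (T x - y) < e) ->
    (T @` carrier X) y.

Definition fredholm X Y T (index : int) : Prop :=
  [/\ bounded_op X Y T,
      image_closed X Y T &
      exists m n : nat,
        [/\ quotient_dim (kernel X T) [set 0] m,
            quotient_dim (carrier Y) (T @` carrier X) n &
            index = m%:Z - n%:Z]].

Definition frechet_derivative X Y U (f : V -> V) (u : V) T : Prop :=
  bounded_op X Y T /\
  forall e : R, 0 < e -> exists2 d : R, 0 < d &
    forall v, U v -> snorm X (v - u) < d ->
      snorm Y (f v - f u - T (v - u)) <= e * snorm X (v - u).

(* dot is the inner product of H0. *)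
Definition weak_hessian_field (dot : V -> V -> R) (H0 H1 H2 : normed_subspace V)
    (U1 : set V) (A : V -> V -> V) : Prop :=
  let U2 := U1 `&` carrier H2 in
  [/\ open_in H1 U1,
      continuous_field H1 U1 H1 H0 A,
      continuous_field H2 U2 H2 H1 A,
      (forall u x y, U1 u -> carrier H1 x -> carrier H1 y ->
         dot (A u x) y = dot x (A u y)) &
      (forall u, U1 u -> fredholm H1 H0 (A u) 0) /\
      (forall u, U2 u -> fredholm H2 H1 (A u) 0)].

(* Hs r is the space H_r for real r in [0, 1). *)
Definition almost_extends (Hs : R -> normed_subspace V)
    (H0 H1 H2 : normed_subspace V) (U1 : set V) (A : V -> V -> V) : Prop :=
  let U2 := U1 `&` carrier H2 in
  exists F C : V -> V -> V,
  (forall u x, U1 u -> carrier H1 x -> A u x = F u x + C u x) /\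
  [/\ continuous_field H1 U1 H1 H0 F,
      continuous_field H1 U1 H2 H1 F,
      (exists r : R, [/\ 0 <= r, r < 1 & continuous_field H1 U1 (Hs r) H0 C]) /\
      continuous_field H2 U2 H1 H1 C,
      (forall u, U1 u -> fredholm H2 H1 (F u) 0) &
      (forall u, U1 u -> exists (N : set V) (kappa : R),
         [/\ open_in H1 N, N `<=` U1, N u &
             forall v w, N v -> carrier H2 v -> N w -> carrier H2 w ->
               opnorm H1 H1 (C v - C w) <=
               kappa * (snorm H2 (v - w) +
                        Num.min (snorm H2 v) (snorm H2 w) * snorm H1 (v - w))])].

End Operators.

Section SquareIntegrable.
Context (R : realType).

(* The circle R / Z is represented by the fundamental domain [0, 1]: functions
   are defined on R, and the measure is Lebesgue measure restricted to [0, 1]. *)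
Definition circle_measure : {measure set (measurableTypeR R) -> \bar R} :=
  mrestr lebesgue_measure (measurable_itv `[0%R : R, 1%R]).

Definition L2fun := LfunType circle_measure (lee1n 2).

Definition ae_null : {pred L2fun} :=
  [pred f : L2fun | `[< (f : R -> R) = cst 0 %[ae circle_measure] >]].

Lemma ae_null_zmod : zmod_closed ae_null.
Proof.
split=> [|f g].
  by apply/asboolP; apply: nearW => t _.
move=> /asboolP f0 /asboolP g0; apply/asboolP.
apply: (@filterS2 _ _ (ae_filter_ringOfSetsType _) _ _ _ _ f0 g0) => t ft gt _.
by transitivity ((f : R -> R) t - (g : R -> R) t); rewrite // ft// gt// subr0.
Qed.

HB.instance Definition _ := GRing.isZmodClosed.Build L2fun ae_null ae_null_zmod.

(* L^2(S^1, R): square-integrable functions modulo equality a.e. *)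
Definition L2 : Type := Quotient.quot ae_null.
HB.instance Definition _ := GRing.Zmodule.on L2.
HB.instance Definition _ := EqQuotient.on L2.

Local Open Scope quotient_scope.

Definition L2_class (f : L2fun) : L2 := \pi_(Quotient.quot ae_null) f.

Definition L2_repr (u : L2) : L2fun := repr u.

Lemma L2_reprK u : L2_class (L2_repr u) = u.
Proof. exact: reprK. Qed.

Lemma L2_classP (f g : L2fun) : ae_null (f - g) -> L2_class f = L2_class g.
Proof. by move=> fg; apply/eqP; rewrite eqmodE /= Quotient.equivE. Qed.

Lemma L2_class_eq (f g : L2fun) : L2_class f = L2_class g -> ae_null (f - g).
Proof. by move/eqP; rewrite eqmodE /= Quotient.equivE. Qed.

Lemma L2_classD (f g : L2fun) : L2_class (f + g) = L2_class f + L2_class g.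
Proof. exact: Quotient.pi_add. Qed.

Definition L2_scale (a : R) (u : L2) : L2 := L2_class (a *: L2_repr u).

Lemma L2_scaleE a (f : L2fun) : L2_scale a (L2_class f) = L2_class (a *: f).
Proof.
apply: L2_classP; rewrite -scalerBr.
have /asboolP h := L2_class_eq (L2_reprK (L2_class f)); apply/asboolP.
apply: (@filterS _ _ (ae_filter_ringOfSetsType _) _ _ _ h) => t ht _.
by transitivity (a * ((L2_repr (L2_class f) - f : L2fun) : R -> R) t);
  rewrite // ht// mulr0.
Qed.

Lemma L2_scaleA a b u : L2_scale a (L2_scale b u) = L2_scale (a * b) u.
Proof. by rewrite -[u]L2_reprK !L2_scaleE scalerA. Qed.

Lemma L2_scale1 : left_id 1 L2_scale.
Proof. by move=> u; rewrite -[u]L2_reprK L2_scaleE scale1r. Qed.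

Lemma L2_scaleDr : right_distributive L2_scale +%R.
Proof.
move=> a u v; rewrite -[u]L2_reprK -[v]L2_reprK.
by rewrite !(L2_scaleE, =^~ L2_classD) scalerDr.
Qed.

Lemma L2_scaleDl u : {morph L2_scale^~ u : a b / a + b}.
Proof.
move=> a b; rewrite -[u]L2_reprK.
by rewrite !L2_scaleE -L2_classD scalerDl.
Qed.

HB.instance Definition _ := GRing.Zmodule_isLmodule.Build R L2
  L2_scaleA L2_scale1 L2_scaleDr L2_scaleDl.

Definition circle_integral (f : R -> R) : R := \int[circle_measure]_t f t.

Definition L2_integral (u : L2) (f : R -> R) : R :=
  circle_integral (fun t => L2_repr u t * f t).

(* Smooth functions on R / Z. *)
Definition test_function (phi : R -> R) : Prop :=
  (forall n t, derivable (derive1n n phi) t 1) /\ (forall t, phi (t + 1) = phi t).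

Definition weak_derivative (n : nat) (u w : L2) : Prop :=
  forall phi, test_function phi ->
    L2_integral u (derive1n n phi) = (-1) ^+ n * L2_integral w phi.

End SquareIntegrable.

Section LoopSpaces.
Context (R : realType).

(* L^2(S^1, C), with C identified with R^2: the pair (x, y) stands for x + i y. *)
Definition loop : lmodType R := (L2 R * L2 R)%type.

Implicit Types z w : loop.

(* The integral of Re (conj z * w). *)
Definition dot z w : R :=
  L2_integral z.1 (L2_repr w.1) + L2_integral z.2 (L2_repr w.2).

Definition L2norm z : R := Num.sqrt (dot z z).

Definition loop_weak_derivative n z w : Prop :=
  weak_derivative n z.1 w.1 /\ weak_derivative n z.2 w.2.

(* The n-th weak derivative of z if z has one in L^2, and 0 otherwise. *)
Definition D n z : loop := xget 0 [set w | loop_weak_derivative n z w].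

Definition L2_space : normed_subspace loop := NormedSubspace setT L2norm.

(* W^{m,2}(S^1, C). *)
Definition sobolev (m : nat) : normed_subspace loop :=
  NormedSubspace
    [set z | forall n, (n <= m)%N -> exists w, loop_weak_derivative n z w]
    (fun z => Num.sqrt (L2norm z ^+ 2 + \sum_(1 <= n < m.+1) L2norm (D n z) ^+ 2)).

(* The square modulus of the k-th Fourier coefficient of z, which is the
   integral of (cos (2 pi k t) - i sin (2 pi k t)) (x t + i y t). *)
Definition fourier_sqr z (k : int) : R :=
  let c t := cos (2 * pi * k%:~R * t) in
  let s t := sin (2 * pi * k%:~R * t) in
  (L2_integral z.1 c + L2_integral z.2 s) ^+ 2 +
  (L2_integral z.2 c - L2_integral z.1 s) ^+ 2.

Definition fractional_seminorm_sqr (s : R) z : \bar R :=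
  (\esum_(k in [set: int])
    (`|2 * pi * k%:~R| `^ (2 * s) * fourier_sqr z k)%:E)%E.

(* W^{s,2}(S^1, C) for real s >= 0, with squared norm
   ||z||^2 + \sum_k |2 pi k|^(2 s) |z_k|^2, where z_k is the k-th Fourier
   coefficient.  By Parseval this norm is equivalent to
   (\sum_k (1 + k^2)^s |z_k|^2)^(1/2), and to the norm of sobolev m if s = m. *)
Definition fractional_sobolev (s : R) : normed_subspace loop :=
  NormedSubspace
    [set z | (fractional_seminorm_sqr s z < +oo)%E]
    (fun z => Num.sqrt (L2norm z ^+ 2 + fine (fractional_seminorm_sqr s z))).

Definition h0 := L2_space.
Definition h1 := sobolev 2.
Definition h2 := sobolev 4.
Definition h (r : R) := fractional_sobolev (2 * r).

(* z(tau) is the value at tau of the continuous representative g of z. *)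
Definition loop_in (Z : set (R * R)) z : Prop :=
  exists g : R -> R * R,
    [/\ continuous g,
        (forall t, g (t + 1) = g t),
        (L2_repr z.1 : R -> R) = fst \o g %[ae circle_measure R],
        (L2_repr z.2 : R -> R) = snd \o g %[ae circle_measure R] &
        forall t, Z (g t)].

Definition u1 (Z : set (R * R)) : set loop :=
  [set z | [/\ carrier h1 z, z <> 0 & loop_in Z z]].

(* The L^2-gradient of B_0(z) = 2 ||z||^2 ||z'||^2 + 1 / ||z||^2. *)
Definition grad_action z : loop :=
  (4 * L2norm (D 1 z) ^+ 2) *: z
  - (4 * L2norm z ^+ 2) *: D 2 z
  - (2 / L2norm z ^+ 4) *: z.

(* B is the field z |-> d(grad B_0)|_z along u1; the values of B z outside
   carrier h1 are irrelevant. *)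
Definition hessian_field (Z : set (R * R)) (B : loop -> loop -> loop) : Prop :=
  forall z, u1 Z z -> frechet_derivative h1 h0 (u1 Z) grad_action z (B z).

End LoopSpaces.

(* Main.v *)
(* Integrating <z', x'> by parts, the derivative of the gradient is
     B^z x = -4 |z|^2 x'' + (4 |z'|^2 - 2 / |z|^4) x - 8 <z'', x> z - 8 <z, x> z'' + 8 <z, x> z / |z|^6.
   Take F^z x = -4 |z|^2 x'' and let C^z be the rest, which is bounded on L^2, so r = 0.  In the
   estimate (C) only the rank one term <z, x> z'' is critical: <v, x> v'' - <w, x> w'' splits as
   <v, x> (v - w)'' + <v - w, x> w'', or with v and w exchanged, hence the minimum of the two norms.

   All operators to be shown Fredholm have the form T x = c x'' + a x + (finite rank) with c != 0.
   With V the Volterra operator (primitive), x'' is inverted by V^2 up to finite rank, and 1 + b V^2 is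
   inverted by variation of constants, so that T is a bijection plus an operator of finite rank: its
   kernel and the codimension of its image have the same finite dimension.  By symmetry the image is
   orthogonal to the kernel, hence is its complement.  The index from W^{4,2} to W^{2,2} follows because
   T x in W^{2,2} forces x in W^{4,2}.

   Weak derivatives on the circle are handled through primitives: u' = w weakly iff w has mean zero and
   u = V w + constant, because a function orthogonal to all trigonometric polynomials vanishes. *)

(* Working modulo finite rank replaces the theory of compact operators by matrix ranks: the index
   vanishes because the left kernel and the cokernel of a square matrix have equal dimension. The
   operator chosen for comparison is the double Volterra operator and not a periodic inverse, since
   an initial value problem is uniquely solvable for every coefficient while the periodic one
   resonates.

   The field is known only as a field of derivatives, so its values must first be identified with
   the explicit formula. This requires that [u1 Z] is open in W^{2,2}, hence a Sobolev embedding
   into continuous loops. All continuity statements come from one calculus of bounded Lipschitz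
   quantities on balls that keep the L^2 norm of the base point away from 0.

   The obstacle in (C) is that z'' lies in W^{2,2} only for z in W^{4,2}, with a norm that is
   unbounded on W^{2,2} balls; all other terms of C are Lipschitz there. *)
From HB Require Import structures.
Require Import Defs.
From mathcomp Require Import all_boot all_order all_algebra.
From mathcomp Require Import all_classical all_reals all_analysis measurable_realfun ring lra.
Set Implicit Arguments.
Unset Strict Implicit.
Unset Printing Implicit Defensive.
Import Order.TTheory GRing.Theory Num.Theory.
Import numFieldNormedType.Exports.
Local Open Scope classical_set_scope.
Local Open Scope ring_scope.

(** * Square-integrable functions on the circle *)

Section CircleIntegral.
Context (R : realType).
Local Notation mu := (circle_measure R).
Implicit Types (f g : R -> R) (u v w : L2 R).

Lemma circle_measureT : mu setT = 1%E.
Proof.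
by rewrite /circle_measure /= /mrestr setTI lebesgue_measure_itv /= lte_fin ltr01 oppr0 adde0.
Qed.

Lemma circle_measure_lty : (lebesgue_measure (`[0%R, 1%R] : set R) < +oo)%E.
Proof. by rewrite lebesgue_measure_itv /= lte_fin ltr01 oppr0 adde0 ltry. Qed.

(** The same measure, packaged as a finite one so that product measures and Fubini apply. *)
Definition circle_finite_measure : {finite_measure set (measurableTypeR R) -> \bar R} :=
  @mfrestr _ (measurableTypeR R) R _ lebesgue_measure (measurable_itv `[0 : R, 1]) circle_measure_lty.

Lemma circle_measure_set1 (x : R) : mu [set x] = 0%E.
Proof.
apply/eqP; rewrite eq_le measure_ge0 andbT -(lebesgue_measure_set1 x).
rewrite /circle_measure /= /mrestr; apply: le_measure; rewrite ?inE /=.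
- by apply: measurableI => //; exact: measurable_itv.
- exact: measurable_set1.
- by move=> y [].
Qed.

Lemma circle_measureC : mu (~` `[0, 1]) = 0%E.
Proof. by rewrite /circle_measure /= /mrestr setICl measure0. Qed.

Lemma ae_circle (P : R -> Prop) : (forall t, 0 <= t <= 1 -> P t) -> \forall t \ae mu, P t.
Proof.
move=> h; exists (~` `[0, 1]%classic); split.
- by apply: measurableC; exact: measurable_itv.
- exact: circle_measureC.
- by move=> t nP; apply: contra_not nP => /=; rewrite in_itv /=; exact: h.
Qed.

Definition sq_integrable f := f \in Lfun mu 2%:E.

Lemma sq_measurable f : sq_integrable f -> measurable_fun setT f.
Proof. by rewrite /sq_integrable inE => /andP[]; rewrite inE. Qed.

Lemma sq_repr u : sq_integrable (L2_repr u).
Proof. exact: LfunP. Qed.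

Lemma sq_mul_integrable f g : sq_integrable f -> sq_integrable g ->
  mu.-integrable setT (EFin \o (fun t => f t * g t)).
Proof. by move=> hf hg; apply/Lfun1_integrable; exact: Lfun2_mul_Lfun1. Qed.

Lemma sq_integrableE f : measurable_fun setT f ->
  mu.-integrable setT (EFin \o (fun t => f t ^+ 2)) -> sq_integrable f.
Proof.
move=> mf /integrableP[_ fi]; rewrite /sq_integrable inE; apply/andP; split; first by rewrite inE.
rewrite inE /= /finite_norm; apply: (@lty_poweRy _ _ 2) => //.
rewrite powR_Lnorm //; apply: le_lt_trans fi; rewrite le_eqVlt; apply/orP; left; apply/eqP.
by apply: eq_integral => t _ /=; rewrite normrX powR_mulrn.
Qed.

Lemma sqD f g : sq_integrable f -> sq_integrable g -> sq_integrable (fun t => f t + g t).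
Proof. exact: (Lfun_addr_closed mu (lee1n 2)).2. Qed.

Lemma sqZ (a : R) f : sq_integrable f -> sq_integrable (fun t => a * f t).
Proof. move=> hf; have := Lfun_scale a (ler1n R 2) hf.
by congr sq_integrable; apply/funext => t /=; rewrite mulrC. Qed.

Lemma sqB f g : sq_integrable f -> sq_integrable g -> sq_integrable (fun t => f t - g t).
Proof. by move=> hf hg; exact: (sqD hf (Lfun_oppr_closed hg)). Qed.

Lemma sqM f g (c : R) : measurable_fun setT f -> (forall t, `|f t| <= c) ->
  sq_integrable g -> sq_integrable (fun t => f t * g t).
Proof.
move=> mf fc hg; have mg := sq_measurable hg.
apply: sq_integrableE; first exact: measurable_funM.
have := integrableZl measurableT (c ^+ 2) (Lfun2_integrable_sqr hg).
apply: le_integrable => //.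
  by apply/measurable_EFinP; apply: measurable_funX; exact: measurable_funM.
move=> t _ /=; rewrite lee_fin exprMn normrM [leRHS]normrM ler_wpM2r // !normrX.
by rewrite ler_pXn2r ?nnegrE //; apply: le_trans (fc t) (ler_norm _).
Qed.

Lemma sq_cst (c : R) : sq_integrable (fun=> c).
Proof.
apply: sq_integrableE => //; apply: measurable_bounded_integrable => //.
  by rewrite circle_measureT ltry.
exists `|c ^+ 2|; split; first by apply: num_real.
by move=> M cM t _ /=; exact: ltW cM.
Qed.

Lemma sq_bounded f (c : R) : measurable_fun setT f -> (forall t, `|f t| <= c) -> sq_integrable f.
Proof.
move=> mf fc; have := sqM mf fc (sq_cst 1).
by congr sq_integrable; apply/funext => t; rewrite mulr1.
Qed.

Lemma sq_integrable1 f : sq_integrable f -> mu.-integrable setT (EFin \o f).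
Proof.
move=> hf; have := sq_mul_integrable hf (sq_cst 1).
by congr (_.-integrable _ _); apply/funext => t /=; rewrite mulr1.
Qed.

Lemma sq_indic (t : R) : sq_integrable \1_(`]-oo, t]).
Proof.
apply: (sq_bounded (c := 1)); first by apply: measurable_indic.
by move=> x; rewrite indicE ger0_norm // lern1 leq_b1.
Qed.

Lemma L2P u v : (L2_repr u : R -> R) = L2_repr v %[ae mu] -> u = v.
Proof.
move=> uv; rewrite -[u]L2_reprK -[v]L2_reprK; apply: L2_classP.
apply/asboolP; apply: (@filterS _ _ (ae_filter_ringOfSetsType _) _ _ _ uv) => t ht _.
by transitivity ((L2_repr u : R -> R) t - (L2_repr v : R -> R) t); rewrite // ht // subrr.
Qed.

Lemma L2_class_repr (F : L2fun R) : (L2_repr (L2_class F) : R -> R) = F %[ae mu].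
Proof.
have /asboolP h := L2_class_eq (L2_reprK (L2_class F)).
apply: (@filterS _ _ (ae_filter_ringOfSetsType _) _ _ _ h) => t ht _.
apply/eqP; rewrite -subr_eq0; apply/eqP; rewrite -[RHS](ht I).
by [].
Qed.

Lemma L2_reprD u v : (L2_repr (u + v) : R -> R) = (L2_repr u : R -> R) \+ L2_repr v %[ae mu].
Proof.
have := L2_class_repr (L2_repr u + L2_repr v).
by rewrite L2_classD !L2_reprK.
Qed.

Lemma L2_reprZ (a : R) u : (L2_repr (a *: u) : R -> R) = (fun t => a * L2_repr u t) %[ae mu].
Proof. have := L2_class_repr (a *: L2_repr u).
by rewrite -L2_scaleE L2_reprK. Qed.

(** Total in [f], with value 0 if no class represents [f], so that terms can be rewritten without
    carrying proofs of square integrability. *)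
Definition mkL2 f : L2 R := xget 0 [set u | (L2_repr u : R -> R) = f %[ae mu]].

Lemma mkL2K f : sq_integrable f -> (L2_repr (mkL2 f) : R -> R) = f %[ae mu].
Proof.
move=> hf; rewrite /mkL2; case: xgetP => // /(_ (L2_class (Lfun_Sub (lee1n 2) hf))) /=.
by case; apply: ae_eq_trans (L2_class_repr _) _; rewrite Lfun_valP; exact: ae_eq_refl.
Qed.

Lemma mkL2_uniq f u : (L2_repr u : R -> R) = f %[ae mu] -> mkL2 f = u.
Proof.
move=> uf; rewrite /mkL2; case: xgetP => [v _ vf|/(_ u)//].
by apply: L2P; apply: ae_eq_trans vf (ae_eq_sym uf).
Qed.

Lemma mkL2_repr u : mkL2 (L2_repr u) = u.
Proof. exact/mkL2_uniq/ae_eq_refl. Qed.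

Lemma mkL2_ae f g : f = g %[ae mu] -> mkL2 f = mkL2 g.
Proof.
move=> fg; rewrite /mkL2; congr xget; apply/seteqP; split=> u /= h.
  exact: ae_eq_trans h fg.
exact: ae_eq_trans h (ae_eq_sym fg).
Qed.

Lemma mkL2D f g : sq_integrable f -> sq_integrable g ->
  mkL2 (fun t => f t + g t) = mkL2 f + mkL2 g.
Proof.
move=> hf hg; apply: mkL2_uniq; apply: ae_eq_trans (L2_reprD _ _) _.
apply: (@filterS2 _ _ (ae_filter_ringOfSetsType _) _ _ _ _ (mkL2K hf) (mkL2K hg)) => t /= h1 h2 _.
by rewrite h1 // h2.
Qed.

Lemma mkL2Z (a : R) f : sq_integrable f -> mkL2 (fun t => a * f t) = a *: mkL2 f.
Proof.
move=> hf; apply: mkL2_uniq; apply: ae_eq_trans (L2_reprZ _ _) _.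
by apply: (@filterS _ _ (ae_filter_ringOfSetsType _) _ _ _ (mkL2K hf)) => t /= h1 _; rewrite h1.
Qed.

Lemma circle_integral_ae f g : mu.-integrable setT (EFin \o f) ->
  mu.-integrable setT (EFin \o g) -> f = g %[ae mu] -> circle_integral f = circle_integral g.
Proof.
move=> /integrableP[mf _] /integrableP[mg _] fg; rewrite /circle_integral /Rintegral; congr fine.
by apply: ae_eq_integral => //; apply: (@filterS _ _ (ae_filter_ringOfSetsType _) _ _ _ fg) => t /= h _; rewrite h.
Qed.

Definition ip u v : R := L2_integral u (L2_repr v).

Lemma L2_integralE u f : sq_integrable f -> L2_integral u f = ip u (mkL2 f).
Proof.
move=> hf; apply: circle_integral_ae.
- exact: sq_mul_integrable (sq_repr _) _.
- exact: sq_mul_integrable (sq_repr _) (sq_repr _).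
- by apply: (@filterS _ _ (ae_filter_ringOfSetsType _) _ _ _ (mkL2K hf)) => t /= h _; rewrite h.
Qed.

Lemma ip_mk f g : sq_integrable f -> sq_integrable g ->
  ip (mkL2 f) (mkL2 g) = circle_integral (fun t => f t * g t).
Proof.
move=> hf hg; rewrite -L2_integralE //; apply: circle_integral_ae.
- exact: sq_mul_integrable (sq_repr _) _.
- exact: sq_mul_integrable.
- by apply: (@filterS _ _ (ae_filter_ringOfSetsType _) _ _ _ (mkL2K hf)) => t /= h _; rewrite h.
Qed.

Lemma ipC u v : ip u v = ip v u.
Proof. by congr circle_integral; apply/funext => t; rewrite mulrC. Qed.

Lemma ipDl u v w : ip (u + v) w = ip u w + ip v w.
Proof.
have := sq_repr; move=> S.
rewrite /ip /L2_integral [RHS](_ : _ =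
  circle_integral (fun t => L2_repr u t * L2_repr w t + L2_repr v t * L2_repr w t)).
  apply: circle_integral_ae; first exact: sq_mul_integrable.
    by apply: (integrableD measurableT (sq_mul_integrable (S u) (S w)) (sq_mul_integrable (S v) (S w))).
  apply: (@filterS _ _ (ae_filter_ringOfSetsType _) _ _ _ (L2_reprD u v)) => t /= h _.
  by rewrite h // mulrDl.
by rewrite /circle_integral RintegralD //; exact: sq_mul_integrable.
Qed.

Lemma ipZl (a : R) u w : ip (a *: u) w = a * ip u w.
Proof.
have := sq_repr; move=> S.
rewrite /ip /L2_integral [RHS](_ : _ =
  circle_integral (fun t => a * (L2_repr u t * L2_repr w t))).
  apply: circle_integral_ae; first exact: sq_mul_integrable.
    by apply: (integrableZl measurableT a (sq_mul_integrable (S u) (S w))).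
  apply: (@filterS _ _ (ae_filter_ringOfSetsType _) _ _ _ (L2_reprZ a u)) => t /= h _.
  by rewrite h // mulrA.
by rewrite /circle_integral RintegralZl //; exact: sq_mul_integrable.
Qed.

Lemma ip_ge0 u : 0 <= ip u u.
Proof. by apply: Rintegral_ge0 => t _; rewrite -expr2 sqr_ge0. Qed.

Lemma ip_eq0 u : ip u u = 0 -> u = 0.
Proof.
move=> u0; apply: L2P.
have iu := sq_mul_integrable (sq_repr u) (sq_repr u).
have /ae_eq_integral_abs : (\int[mu]_t `|(L2_repr u t * L2_repr u t)%:E| = 0)%E.
  rewrite -[RHS]/(0%:E) -u0 /ip /L2_integral /circle_integral /Rintegral fineK.
    by apply: eq_integral => t _; rewrite gee0_abs // lee_fin -expr2 sqr_ge0.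
  by apply: integrable_fin_num.
have [miu _] := integrableP _ _ _ iu.
move=> /(_ measurableT miu) h.
have h0 : (L2_repr 0 : R -> R) = (fun=> 0) %[ae mu].
  rewrite -(scale0r (0 : L2 R)); apply: ae_eq_trans (L2_reprZ _ _) _.
  by apply: nearW => t _; rewrite mul0r.
apply: ae_eq_trans (ae_eq_sym h0).
apply: (@filterS _ _ (ae_filter_ringOfSetsType _) _ _ _ h) => t /= ht _.
by have /eqP := ht I; rewrite eqe mulf_eq0 orbb => /eqP.
Qed.

End CircleIntegral.

(** * Cauchy-Schwarz and triangle inequality for positive semidefinite forms *)

Section InnerProductSpace.
Context (R : realType) (V : lmodType R) (q : V -> V -> R).
Context (qC : forall u v, q u v = q v u)
  (qDl : forall u v w, q (u + v) w = q u w + q v w)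
  (qZl : forall a u w, q (a *: u) w = a * q u w)
  (q_ge0 : forall u, 0 <= q u u).

Lemma form_sqrD u v a : q (u + a *: v) (u + a *: v) = q u u + a * q u v *+ 2 + a ^+ 2 * q v v.
Proof.
rewrite qDl qZl [q u _]qC [q v _]qC !qDl !qZl [q v u]qC.
by rewrite expr2; ring.
Qed.

Lemma Cauchy_Schwarz_sqr u v : q u v ^+ 2 <= q u u * q v v.
Proof.
have [v0|v0] := eqVneq (q v v) 0.
  have [->|uv0] := eqVneq (q u v) 0; first by rewrite expr0n /= mulr_ge0.
  (* As [v] is a null vector, the quadratic in [a] is affine; this [a] gives it the value -1. *)
  pose a := - (q u u + 1) / (q u v *+ 2).
  have := q_ge0 (u + a *: v); rewrite form_sqrD v0 mulr0 addr0.
  have -> : a * q u v *+ 2 = - (q u u + 1) by rewrite /a; field; rewrite uv0.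
  rewrite opprD addrA subrr add0r.
  by move=> h; exfalso; lra.
have {}v0 : 0 < q v v by rewrite lt_def v0 q_ge0.
(* The coefficient is the minimizer of the quadratic [form_sqrD] in [a]. *)
have := q_ge0 (u + (- q u v / q v v) *: v).
rewrite form_sqrD => h.
rewrite -subr_ge0 -(pmulr_lge0 _ (_ : 0 < (q v v)^-1)) ?invr_gt0 //.
rewrite [leRHS](_ : _ = q u u + (- q u v / q v v * q u v) *+ 2 + (- q u v / q v v) ^+ 2 * q v v) //.
by field; rewrite gt_eqF.
Qed.

Lemma Cauchy_Schwarz u v : `|q u v| <= Num.sqrt (q u u) * Num.sqrt (q v v).
Proof. by rewrite -sqrtrM // -sqrtr_sqr ler_wsqrtr // Cauchy_Schwarz_sqr. Qed.

Lemma form_triangle u v :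
  Num.sqrt (q (u + v) (u + v)) <= Num.sqrt (q u u) + Num.sqrt (q v v).
Proof.
rewrite -(ler_pXn2r (_ : 0 < 2)%N) ?nnegrE ?addr_ge0 ?sqrtr_ge0 // sqrrD !sqr_sqrtr //.
have := form_sqrD u v 1; rewrite scale1r expr1n !mul1r => ->.
rewrite lerD2r lerD2l lerMn2r /=; exact: le_trans (ler_norm _) (Cauchy_Schwarz _ _).
Qed.

Lemma form_sqrtZ a u : Num.sqrt (q (a *: u) (a *: u)) = `|a| * Num.sqrt (q u u).
Proof.
by rewrite qZl qC qZl mulrA -expr2 sqrtrM ?sqr_ge0 // sqrtr_sqr.
Qed.

End InnerProductSpace.

(** * Primitives and integration by parts *)

Section Primitive.
Context (R : realType).
Local Notation mu := (circle_measure R).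
Implicit Types (f g s : R -> R) (u v w : L2 R).

Definition nrm u : R := Num.sqrt (ip u u).

Lemma nrm_ge0 u : 0 <= nrm u.
Proof. exact: sqrtr_ge0. Qed.

Lemma ip_le u v : `|ip u v| <= nrm u * nrm v.
Proof. exact: (Cauchy_Schwarz (@ipC R) (@ipDl R) (@ipZl R) (@ip_ge0 R)). Qed.

Lemma ipDr u v w : ip u (v + w) = ip u v + ip u w.
Proof. by rewrite ipC ipDl !(ipC _ u). Qed.

Lemma ipZr a u v : ip u (a *: v) = a * ip u v.
Proof. by rewrite ipC ipZl ipC. Qed.

Lemma ip0l u : ip 0 u = 0.
Proof. by rewrite -(scale0r (0 : L2 R)) ipZl mul0r. Qed.

Lemma ip0r u : ip u 0 = 0.
Proof. by rewrite ipC ip0l. Qed.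

Lemma ipNl u v : ip (- u) v = - ip u v.
Proof. by rewrite -scaleN1r ipZl mulN1r. Qed.

Lemma ipNr u v : ip u (- v) = - ip u v.
Proof. by rewrite ipC ipNl ipC. Qed.

Lemma ipBl u v w : ip (u - v) w = ip u w - ip v w.
Proof. by rewrite ipDl ipNl. Qed.

Lemma ipBr u v w : ip u (v - w) = ip u v - ip u w.
Proof. by rewrite ipDr ipNr. Qed.

Lemma sq_ae f g : measurable_fun setT f -> f = g %[ae mu] -> sq_integrable g -> sq_integrable f.
Proof.
move=> mf fg hg; have mg := sq_measurable hg; apply: sq_integrableE => //.
have /integrableP[mg2 g2] := Lfun2_integrable_sqr hg.
have mf2 : measurable_fun setT (EFin \o (fun t => f t ^+ 2)).
  by apply/measurable_EFinP; exact: measurable_funX.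
apply/integrableP; split=> //; apply: le_lt_trans g2.
rewrite le_eqVlt; apply/orP; left; apply/eqP; apply: ae_eq_integral => //.
- exact: measurableT_comp.
- exact: measurableT_comp.
- by apply: (@filterS _ _ (ae_filter_ringOfSetsType _) _ _ _ fg) => t /= h _; rewrite h.
Qed.

Lemma ae_eq_circle f g : (forall t, 0 <= t <= 1 -> f t = g t) -> f = g %[ae mu].
Proof. by move=> h; apply: ae_circle => t t01 _; exact: h. Qed.

(** The measure sees only [0, 1], so a bound there is enough. Continuous multipliers such as
    exponentials are unbounded on the line. *)
Lemma sqM01 f g (c : R) : measurable_fun setT f -> (forall t, 0 <= t <= 1 -> `|f t| <= c) ->
  sq_integrable g -> sq_integrable (fun t => f t * g t).
Proof.
move=> mf fc hg; pose f1 t := f t * \1_(`[0, 1]%classic) t.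
have mi : measurable_fun setT (\1_(`[0, 1]%classic) : R -> R).
  by apply: measurable_indic; exact: measurable_itv.
have mf1 : measurable_fun setT f1 by exact: measurable_funM.
have c0 : 0 <= c by apply: le_trans (fc 0 _); rewrite ?normr_ge0 // lexx ler01.
have f1c t : `|f1 t| <= c.
  rewrite /f1 indicE; case: (boolP (_ \in _)) => [|_]; last by rewrite mulr0 normr0.
  by rewrite inE /= in_itv /= mulr1 => /fc.
apply: sq_ae (sqM mf1 f1c hg); first by apply: measurable_funM => //; exact: sq_measurable.
apply: ae_eq_circle => t t01; rewrite /f1 indicE mem_set ?mulr1 //.
Qed.

Lemma continuous_bounded01 s : continuous s -> exists c, forall t, 0 <= t <= 1 -> `|s t| <= c.
Proof.
move=> cs; have [|c _ hc] := @EVT_max R (fun t => `|s t|) 0 1 ler01.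
  by apply: continuous_subspaceT => t; apply: continuous_comp; [exact: cs|exact: norm_continuous].
by exists `|s c| => t t01; apply: hc; rewrite in_itv.
Qed.

Lemma sq_contM s g : continuous s -> sq_integrable g -> sq_integrable (fun t => s t * g t).
Proof.
move=> cs; have [c hc] := continuous_bounded01 cs.
exact: sqM01 (continuous_measurable_fun cs) hc.
Qed.

Lemma sq_cont s : continuous s -> sq_integrable s.
Proof.
move=> cs; have := sq_contM cs (sq_cst 1).
by congr sq_integrable; apply/funext => t; rewrite mulr1.
Qed.

Definition cut (t : R) : L2 R := mkL2 \1_(`]-oo, t]).

(** The integral of [u] from 0 to t. As an inner product with an indicator it inherits linearity
    from [ip] and its estimates from Cauchy-Schwarz. *)
Definition prim u (t : R) : R := ip u (cut t).

Definition V u : L2 R := mkL2 (prim u).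

Definition one : L2 R := mkL2 (fun=> 1).

Definition mean u : R := ip u one.

Definition clamp (t : R) : R := Num.max 0 (Num.min t 1).

Lemma circle_integral_indic (A : set R) : measurable A -> circle_integral \1_A = fine (mu A).
Proof. by move=> mA; rewrite /circle_integral /Rintegral integral_indic // setIT. Qed.

Lemma circle_measure_cut (t : R) : mu (`]-oo, t]%classic) = (clamp t)%:E.
Proof.
rewrite /circle_measure /= /mrestr.
have -> : `]-oo, t]%classic `&` `[0, 1]%classic = `[0, Num.min t 1]%classic :> set R.
  by apply/seteqP; split=> x /=; rewrite !in_itv /= le_min; [move=> [-> /andP[-> ->]]|move=> /and3P[-> -> ->]].
rewrite lebesgue_measure_itv /= lte_fin /clamp; case: ltP => h /=; rewrite ?oppr0 ?adde0 //.
Qed.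

Lemma indic_cutM (a b x : R) :
  \1_(`]-oo, a]) x * \1_(`]-oo, b]) x = \1_(`]-oo, Num.min a b]) x :> R.
Proof.
have E c : (x \in `]-oo, c]%classic) = (x <= c) by apply/idP/idP; rewrite inE /= in_itv.
by rewrite !indicE !E le_min -natrM mulnb.
Qed.

Lemma ip_cut (s t : R) : ip (cut s) (cut t) = clamp (Num.min s t).
Proof.
rewrite ip_mk; [|exact: sq_indic|exact: sq_indic].
have -> : (fun x => \1_(`]-oo, s]) x * \1_(`]-oo, t]) x) = \1_(`]-oo, Num.min s t]) :> (R -> R).
  apply/funext => x; exact: indic_cutM.
by rewrite circle_integral_indic // circle_measure_cut.
Qed.

Lemma clamp_le1 t : clamp t <= 1.
Proof. by rewrite /clamp ge_max ler01 ge_min lexx orbT. Qed.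

Lemma clamp_sub (s t : R) : s <= t -> clamp t - clamp s <= t - s.
Proof.
move=> st; rewrite /clamp.
by case: (leP t 1) => t1; case: (leP s 1) => s1; rewrite /Num.max; do 2 case: ltP => ?; lra.
Qed.

Lemma nrm_cut t : nrm (cut t) <= 1.
Proof.
by rewrite /nrm ip_cut minxx -[leRHS]sqrtr1 ler_wsqrtr // clamp_le1.
Qed.

Lemma prim_bound u t : `|prim u t| <= nrm u.
Proof.
apply: le_trans (ip_le _ _) _; rewrite -[leRHS]mulr1 ler_wpM2l ?nrm_ge0 //; exact: nrm_cut.
Qed.

(** The increment is the inner product of [u] with [cut t - cut s], whose squared norm is at most
    the distance of s and t. *)
Lemma prim_holder u (s t : R) : `|prim u t - prim u s| <= nrm u * Num.sqrt `|t - s|.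
Proof.
wlog st : s t / s <= t => [hw|].
  by have [|/ltW] := leP s t; [exact: hw|rewrite distrC (distrC t); exact: hw].
rewrite /prim -ipBr; apply: le_trans (ip_le _ _) _; rewrite ler_wpM2l ?nrm_ge0 // ler_wsqrtr //.
rewrite ipBl !ipBr !ip_cut !minxx (minC t s) (min_idPl st) ger0_norm ?subr_ge0 //.
by have := clamp_sub st; lra.
Qed.

Lemma prim_continuous u : continuous (prim u).
Proof.
move=> t; apply/cvgrPdist_le => e e0.
have n0 : 0 < nrm u + 1 by rewrite ltr_wpDl ?nrm_ge0.
have d0 : 0 < (e / (nrm u + 1)) ^+ 2 by rewrite exprn_gt0 // divr_gt0.
exists ((e / (nrm u + 1)) ^+ 2) => //= s; rewrite /ball /= => ts.
apply: le_trans (prim_holder _ _ _) _.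
have h : Num.sqrt `|t - s| <= e / (nrm u + 1).
  have e1 : 0 <= e / (nrm u + 1) by rewrite divr_ge0 // ltW.
  rewrite -[leRHS](ger0_norm e1) -[leRHS]sqrtr_sqr ler_wsqrtr //; exact: ltW.
apply: (@le_trans _ _ ((nrm u + 1) * (e / (nrm u + 1)))).
  by apply: ler_pM; rewrite ?nrm_ge0 ?sqrtr_ge0 // lerDl.
by rewrite mulrC divfK // gt_eqF.
Qed.

Lemma prim_linear a u v t : prim (a *: u + v) t = a * prim u t + prim v t.
Proof. by rewrite /prim ipDl ipZl. Qed.

Lemma sq_prim u : sq_integrable (prim u).
Proof. exact/sq_cont/prim_continuous. Qed.

Lemma V_linear : linear V.
Proof.
move=> a u v; rewrite /V -(mkL2Z a (sq_prim u)) -mkL2D; [|exact/sqZ/sq_prim|exact: sq_prim].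
by congr mkL2; apply/funext => t; exact: prim_linear.
Qed.

HB.instance Definition _ := GRing.isLinear.Build R (L2 R) (L2 R) _ V V_linear.

Lemma mean_linear : scalar mean.
Proof. by move=> a u v; rewrite /mean ipDl ipZl. Qed.

HB.instance Definition _ := GRing.isLinear.Build R (L2 R) R _ mean mean_linear.

Lemma sq_cutM f t : sq_integrable f -> sq_integrable (fun x => f x * \1_(`]-oo, t]) x).
Proof.
move=> hf; have := @sqM R \1_(`]-oo, t]) f 1 (sq_measurable (sq_indic t)) _ hf.
rewrite (_ : (fun x => _ * f x) = fun x => f x * \1_(`]-oo, t]) x); last by apply/funext => x; rewrite mulrC.
by apply=> x; rewrite indicE ger0_norm // lern1 leq_b1.
Qed.

Lemma prim_mk f t : sq_integrable f ->
  prim (mkL2 f) t = circle_integral (fun x => f x * \1_(`]-oo, t]) x).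
Proof. by move=> hf; rewrite /prim ip_mk //; exact: sq_indic. Qed.

Lemma prim_mean u t : 1 <= t -> prim u t = mean u.
Proof.
move=> t1; rewrite /prim /mean; congr (ip _ _); apply: mkL2_ae; apply: ae_eq_circle => x /andP[_ x1].
by rewrite indicE mem_set // /= in_itv /= (le_trans x1).
Qed.

Lemma prim_le0 u t : t <= 0 -> prim u t = 0.
Proof.
move=> t0; apply/eqP; rewrite -normr_eq0 eq_le normr_ge0 andbT.
apply: le_trans (ip_le _ _) _; rewrite {2}/nrm ip_cut minxx /clamp (max_idPl _) ?sqrtr0 ?mulr0 //.
by rewrite ge_min t0.
Qed.

Lemma mean_mk f : sq_integrable f -> mean (mkL2 f) = circle_integral f.
Proof.
move=> hf; rewrite /mean /one ip_mk //; last exact: sq_cst.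
by congr circle_integral; apply/funext => x; rewrite mulr1.
Qed.

Lemma prim_cutM f (s t : R) : sq_integrable f ->
  prim (mkL2 (fun x => f x * \1_(`]-oo, t]) x)) s = prim (mkL2 f) (Num.min s t).
Proof.
move=> hf; rewrite prim_mk; last exact: sq_cutM.
rewrite prim_mk //; congr circle_integral; apply/funext => x; rewrite -mulrA; congr (_ * _).
by rewrite indic_cutM minC.
Qed.

End Primitive.

Section IntegrationByParts.
Context (R : realType).
Local Notation mu := (circle_measure R).
Local Notation nu := (circle_finite_measure R).
Implicit Types (f g : R -> R) (u v w : L2 R).

Let T := measurableTypeR R.

Lemma integrable_tensor f g : sq_integrable f -> sq_integrable g ->
  (nu \x nu)%E.-integrable setT (fun z : T * T => (f z.1 * g z.2)%:E).
Proof.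
move=> hf hg; have mf := sq_measurable hf; have mg := sq_measurable hg.
have [_ fi] := integrableP _ _ _ (sq_integrable1 hf).
have [_ gi] := integrableP _ _ _ (sq_integrable1 hg).
apply/integrable12ltyP.
  apply/measurable_EFinP; apply: measurable_funM.
    exact: measurableT_comp mf measurable_fst.
  exact: measurableT_comp mg measurable_snd.
rewrite [ltLHS](_ : _ = (\int[nu]_x (`|(f x)%:E| * \int[mu]_y `|(g y)%:E|))%E); last first.
  apply: eq_integral => x _; rewrite -ge0_integralZl //.
    by apply: eq_integral => y _ /=; rewrite normrM.
  by apply: measurableT_comp => //; exact/measurable_EFinP.
rewrite ge0_integralZr ?integral_ge0 //; last first.
  by apply: measurableT_comp => //; exact/measurable_EFinP.
by apply: lte_mul_pinfty; rewrite ?integral_ge0 // ge0_fin_numE ?integral_ge0.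
Qed.

Lemma measurable_le_set : measurable [set z : T * T | z.2 <= z.1].
Proof.
have := @measurable_fun_ler _ (T * T)%type R setT snd fst measurable_snd measurable_fst.
move=> /(_ measurableT [set true]); rewrite setTI; apply.
by [].
Qed.

Lemma circle_Fubini f g : sq_integrable f -> sq_integrable g ->
  (\int[mu]_x \int[mu]_y (f x * (g y * (y <= x)%R%:R))%:E =
   \int[mu]_y \int[mu]_x (g y * (f x * (y <= x)%R%:R))%:E)%E.
Proof.
move=> hf hg; have mf := sq_measurable hf; have mg := sq_measurable hg.
pose h (z : T * T) : R := f z.1 * g z.2 * \1_[set z : T * T | z.2 <= z.1] z.
have ih : (nu \x nu)%E.-integrable setT (EFin \o h).
  apply: le_integrable (integrable_tensor hf hg) => //.
    apply/measurable_EFinP; apply: measurable_funM.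
      apply: measurable_funM.
        exact: measurableT_comp mf measurable_fst.
      exact: measurableT_comp mg measurable_snd.
    by apply: measurable_indic; exact: measurable_le_set.
  move=> z _ /=; rewrite lee_fin /h normrM indicE ler_piMr // ger0_norm ?ler0n //.
  by rewrite lern1 leq_b1.
have hE x y : h (x, y) = f x * g y * (y <= x)%R%:R.
  rewrite /h indicE; congr (_ * _%:R); congr nat_of_bool.
  by apply/idP/idP; rewrite inE.
have := Fubini ih; rewrite [in X in X -> _]/comp => H.
transitivity (\int[nu]_x \int[nu]_y (h (x, y))%:E)%E.
  by apply: eq_integral => x _; apply: eq_integral => y _; rewrite hE mulrA.
rewrite H; apply: eq_integral => y _; apply: eq_integral => x _.
by rewrite hE mulrCA mulrA.
Qed.

Lemma circle_integralD f g : sq_integrable f -> sq_integrable g ->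
  circle_integral (fun x => f x + g x) = circle_integral f + circle_integral g.
Proof. by move=> hf hg; apply: RintegralD => //; exact: sq_integrable1. Qed.

Lemma circle_integralZ a f : sq_integrable f ->
  circle_integral (fun x => a * f x) = a * circle_integral f.
Proof. by move=> hf; apply: RintegralZl => //; exact: sq_integrable1. Qed.

Lemma prim_mkE f x : sq_integrable f ->
  (prim (mkL2 f) x)%:E = (\int[mu]_y (f y * (y <= x)%R%:R)%:E)%E.
Proof.
move=> hf; rewrite prim_mk // /circle_integral /Rintegral fineK; last first.
  by apply: integrable_fin_num => //; apply: sq_integrable1; exact: sq_cutM.
apply: eq_integral => y _; rewrite indicE; congr (_ * _%:R)%:E; congr nat_of_bool.
by apply/idP/idP; rewrite inE /= in_itv.
Qed.

Lemma prim_strict f y : sq_integrable f ->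
  (\int[mu]_x (f x * (y <= x)%R%:R)%:E)%E = (circle_integral f - prim (mkL2 f) y)%:E.
Proof.
move=> hf; have hc := sq_cutM y hf.
have -> : circle_integral f - prim (mkL2 f) y =
    circle_integral (fun x => f x - f x * \1_(`]-oo, y]) x).
  rewrite prim_mk // -mulN1r -circle_integralZ // -circle_integralD //; last exact: sqZ.
  by congr circle_integral; apply/funext => x; rewrite mulN1r.
have hs := sqB hf hc; have [mfc _] := integrableP _ _ _ (sq_integrable1 hs).
rewrite /circle_integral /Rintegral fineK; last first.
  by apply: integrable_fin_num => //; exact: sq_integrable1.
apply: ae_eq_integral => //.
  apply/measurable_EFinP; apply: measurable_funM; first exact: sq_measurable.
  rewrite (_ : (fun x => _) = \1_(`[y, +oo[)); last first.
    apply/funext => x; rewrite indicE; congr (_%:R); congr nat_of_bool.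
    by apply/idP/idP; rewrite inE /= in_itv /= andbT.
  by apply: measurable_indic; exact: measurable_itv.
(* The two integrands can differ only at the point y, which is null. *)
exists [set y]; split; [exact: measurable_set1|exact: circle_measure_set1|].
move=> x /=; apply: contra_notP => /eqP xy _; congr (_%:E).
rewrite indicE; have -> : (x \in `]-oo, y]%classic) = (x <= y).
  by apply/idP/idP; rewrite inE /= in_itv.
have [] := ltgtP x y; rewrite ?mulr1 ?mulr0 ?subrr ?subr0 // => e.
by rewrite e eqxx in xy.
Qed.

(** Integration by parts: the unit square is the union of the triangles y <= x and x <= y, which
    overlap in a null set, and Fubini evaluates the integral of f x * g y over one of them in both
    orders. *)
Lemma RotaBaxter f g : sq_integrable f -> sq_integrable g ->
  circle_integral (fun x => f x * prim (mkL2 g) x) + circle_integral (fun y => g y * prim (mkL2 f) y)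
  = circle_integral f * circle_integral g.
Proof.
move=> hf hg; have := circle_Fubini hf hg.
have sP a b : sq_integrable a -> sq_integrable (fun x => a x * prim (mkL2 b) x).
  move=> ha; rewrite (_ : (fun x => _) = fun x => prim (mkL2 b) x * a x); last first.
    by apply/funext => x; rewrite mulrC.
  by apply: sq_contM => //; exact: prim_continuous.
rewrite [LHS](_ : _ = (circle_integral (fun x => f x * prim (mkL2 g) x))%:E); last first.
  rewrite /circle_integral /Rintegral fineK; last first.
    by apply: integrable_fin_num => //; apply: sq_integrable1; exact: sP.
  apply: eq_integral => x _; rewrite EFinM prim_mkE //.
  rewrite -integralZl //; last first.
    rewrite (_ : (fun y => _) = EFin \o (fun y => g y * \1_(`]-oo, x]) y)).
      by apply: sq_integrable1; exact: sq_cutM.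
    apply/funext => y /=; rewrite indicE; congr (_ * _%:R)%:E; congr nat_of_bool.
    by apply/idP/idP; rewrite inE /= in_itv.
have -> : (\int[mu]_y \int[mu]_x (g y * (f x * (y <= x)%R%:R))%:E)%E =
    (circle_integral (fun y => g y * (circle_integral f - prim (mkL2 f) y)))%:E.
  rewrite /circle_integral /Rintegral fineK; last first.
    apply: integrable_fin_num => //; apply: sq_integrable1.
    rewrite (_ : (fun x => _) = fun x => fine (\int[mu]_x0 (f x0)%:E) * g x - g x * prim (mkL2 f) x).
      by apply: sqB; [exact: sqZ|exact: sP].
    by apply/funext => x; rewrite mulrBr mulrC.
  apply: eq_integral => y _; rewrite EFinM -[X in _ = (_ * X)%E]prim_strict //.
  rewrite -integralZl //; last first.
    apply/integrableP; split.
      apply/measurable_EFinP; apply: measurable_funM; first exact: sq_measurable.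
      rewrite (_ : (fun x => _) = \1_(`[y, +oo[)); last first.
        apply/funext => x; rewrite indicE; congr (_%:R); congr nat_of_bool.
        by apply/idP/idP; rewrite inE /= in_itv /= andbT.
      by apply: measurable_indic; exact: measurable_itv.
    have /integrableP[mF] := sq_integrable1 hf; apply: le_lt_trans.
    apply: ge0_le_integral => //.
    - apply: measurableT_comp => //; apply/measurable_EFinP; apply: measurable_funM; first exact: sq_measurable.
      rewrite (_ : (fun x => _) = \1_(`[y, +oo[)); last first.
        apply/funext => x; rewrite indicE; congr (_%:R); congr nat_of_bool.
        by apply/idP/idP; rewrite inE /= in_itv /= andbT.
      by apply: measurable_indic; exact: measurable_itv.
    - exact: measurableT_comp.
    - move=> x _ /=; rewrite lee_fin normrM ler_piMr // ger0_norm ?ler0n //.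
      by rewrite lern1 leq_b1.
move=> [] ->; rewrite -circle_integralD; [|by
    rewrite (_ : (fun x => _) = fun x => circle_integral f * g x - g x * prim (mkL2 f) x);
    [apply: sqB; [exact: sqZ|exact: sP]|apply/funext => x; rewrite mulrBr mulrC]|exact: sP].
rewrite -circle_integralZ //; congr circle_integral; apply/funext => y.
by rewrite mulrBr subrK mulrC.
Qed.

(** On functions of mean zero the right side vanishes and [V] is skew-symmetric; this is the source
    of every integration by parts on the circle below. *)
Lemma ip_V u v : ip (V u) v + ip u (V v) = mean u * mean v.
Proof.
have hu := sq_repr u; have hv := sq_repr v.
have := RotaBaxter hu hv; rewrite !mkL2_repr => H.
have -> : mean u * mean v = circle_integral (L2_repr u) * circle_integral (L2_repr v).
  by rewrite -{1}[u]mkL2_repr -{1}[v]mkL2_repr !mean_mk.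
rewrite -H addrC; congr (_ + _).
  rewrite -{1}[u]mkL2_repr ip_mk //; exact: sq_prim.
rewrite ipC -{1}[v]mkL2_repr ip_mk //; exact: sq_prim.
Qed.

End IntegrationByParts.

(** * The Volterra operator and multiplication by smooth functions *)

Section Volterra.
Context (R : realType).
Local Notation mu := (circle_measure R).
Implicit Types (f g s : R -> R) (u v w : L2 R).

(** Passes to Lebesgue measure on [0, t], for which the fundamental theorem of calculus and Lebesgue
    differentiation are available. *)
Lemma prim_lebesgue f (t : R) : sq_integrable f -> 0 <= t <= 1 ->
  (prim (mkL2 f) t)%:E = (\int[lebesgue_measure]_(x in `[0%R, t]) (f x)%:E)%E.
Proof.
move=> hf /andP[t0 t1]; have hc := sq_cutM t hf.
have mf := sq_measurable hf.
rewrite prim_mk // /circle_integral /Rintegral fineK; last first.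
  by apply: integrable_fin_num => //; exact: sq_integrable1.
transitivity (\int[mu]_(x in `[0%R, t]) (f x)%:E)%E.
  rewrite [RHS]integral_mkcond; apply: ae_eq_integral => //.
  - by apply/measurable_EFinP; exact: sq_measurable hc.
  - apply/(measurable_restrictT _ _).1; first exact: measurable_itv.
    by apply/measurable_EFinP; exact: measurable_funS mf.
  - apply: ae_circle => x /andP[x0 x1] _; rewrite patchE indicE.
    have -> : (x \in `]-oo, t]%classic) = (x <= t) by apply/idP/idP; rewrite inE /= in_itv.
    have -> : (x \in `[0%R, t]%classic) = (x <= t) by apply/idP/idP; rewrite inE /= in_itv /= x0.
    by case: ifP => _; rewrite ?mulr1 ?mulr0.
apply: eq_measure_integral => A mA At; rewrite /circle_measure /= /mrestr; congr lebesgue_measure.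
apply: setIidl => x /At /=; rewrite !in_itv /= => /andP[-> /le_trans]; exact.
Qed.

Definition C1 s s1 : Prop := (forall t, is_derive t (1 : R) s (s1 t)) /\ continuous s1.

Lemma C1_continuous s s1 : C1 s s1 -> continuous s.
Proof.
move=> [d _] t; have [ds _] := d t.
by apply/differentiable_continuous/derivable1_diffP.
Qed.

Lemma FTC2 s s1 t : C1 s s1 -> 0 <= t <= 1 -> prim (mkL2 s1) t = s t - s 0.
Proof.
move=> C /andP[]; rewrite le_eqVlt => /predU1P[<- _|t0 t1]; first by rewrite prim_le0 // subrr.
have cs := C1_continuous C; have [d c1] := C.
apply: EFin_inj; rewrite prim_lebesgue ?(ltW t0) //; last exact: sq_cont.
rewrite (@continuous_FTC2 R s1 s 0 t) //.
- exact: continuous_subspaceT.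
- split; first by move=> x _; have [] := d x.
  + by apply: cvg_at_right_filter; exact: cs.
  + by apply: cvg_at_left_filter; exact: cs.
- by move=> x _; rewrite derive1E; have [_ ->] := d x.
Qed.

Lemma V_FTC2 s s1 : C1 s s1 -> V (mkL2 s1) = mkL2 s - s 0 *: one R.
Proof.
move=> C; have cs := C1_continuous C.
rewrite /V (@mkL2_ae _ _ (fun x => s x + - s 0 * 1)).
  by rewrite mkL2D ?mkL2Z ?scaleNr //; [exact: sq_cst|exact: sq_cont|apply: sqZ; exact: sq_cst].
by apply: ae_eq_circle => t t01; rewrite (FTC2 C) // mulr1.
Qed.

Definition mul s u : L2 R := mkL2 (fun x => s x * L2_repr u x).

Lemma mul_mk s f : continuous s -> sq_integrable f -> mul s (mkL2 f) = mkL2 (fun x => s x * f x).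
Proof.
move=> cs hf; apply: mkL2_ae.
by apply: (@filterS _ _ (ae_filter_ringOfSetsType _) _ _ _ (mkL2K hf)) => t /= h _; rewrite h.
Qed.

Lemma mulA s1 s2 u : continuous s1 -> continuous s2 ->
  mul s1 (mul s2 u) = mul (fun x => s1 x * s2 x) u.
Proof.
move=> c1 c2; rewrite -[u]mkL2_repr (mul_mk c2 (sq_repr u)) mul_mk //; last exact/sq_contM/sq_repr.
rewrite mul_mk //; last exact: sq_repr.
  by congr mkL2; apply/funext => x; rewrite mulrA.
by move=> x; apply: cvgM; [exact: c1|exact: c2].
Qed.

Lemma mul_is_linear s : continuous s -> linear (mul s).
Proof.
move=> cs a u v.
rewrite -[u]mkL2_repr -[v]mkL2_repr; have hu := sq_repr u; have hv := sq_repr v.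
rewrite !(mul_mk cs) // -!mkL2Z // -?mkL2D ?(mul_mk cs) // -?mkL2D //;
  try (by repeat (apply: sqZ || apply: sqD || apply: sq_contM)).
by congr mkL2; apply/funext => x /=; ring.
Qed.

Lemma mulDl s1 s2 u : continuous s1 -> continuous s2 ->
  mul (fun x => s1 x + s2 x) u = mul s1 u + mul s2 u.
Proof.
move=> c1 c2; have hu := sq_repr u.
rewrite /mul -mkL2D; [|exact: sq_contM|exact: sq_contM].
by congr mkL2; apply/funext => x; rewrite mulrDl.
Qed.

Lemma mul_cst a u : mul (fun=> a) u = a *: u.
Proof. by rewrite /mul (mkL2Z _ (sq_repr u)) mkL2_repr. Qed.

(** The product rule integrated from 0, where s V u vanishes. Its value at t is [RotaBaxter] for
    [s1] and [u], both cut off at t. *)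
Lemma V_product s s1 u : C1 s s1 -> mul s (V u) = V (mul s1 (V u) + mul s u).
Proof.
move=> C; have cs := C1_continuous C; have [d c1] := C.
pose g : R -> R := L2_repr u; have hg : sq_integrable g by exact: sq_repr.
have eu : mkL2 g = u by exact: mkL2_repr.
rewrite /V mul_mk //; last exact: sq_prim.
apply: mkL2_ae; apply: ae_eq_circle => t t01.
pose i : R -> R := \1_(`]-oo, t]).
have h1 : sq_integrable (fun x => s1 x * i x) by apply: sq_contM => //; exact: sq_indic.
have h2 : sq_integrable (fun x => g x * i x) by exact: sq_cutM.
have := RotaBaxter h1 h2.
have hs1 : sq_integrable s1 by exact: sq_cont.
have P1 x : 0 <= x <= 1 -> prim (mkL2 (fun x => s1 x * i x)) x = s (Num.min x t) - s 0.
  move=> x01; rewrite prim_cutM // (FTC2 C) //.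
  by move: x01 t01; rewrite /Num.min; case: ifP.
have P2 x : prim (mkL2 (fun x => g x * i x)) x = prim u (Num.min x t).
  by rewrite prim_cutM // eu.
have -> : circle_integral (fun x => s1 x * i x) = s t - s 0.
  by rewrite -prim_mk // (FTC2 C).
have -> : circle_integral (fun x => g x * i x) = prim u t by rewrite -prim_mk // eu.
have hV : sq_integrable (fun x => s1 x * prim u x) by apply: sq_contM => //; exact: sq_prim.
have hsg : sq_integrable (fun x => s x * g x) by exact: sq_contM.
have ind x : i x = 0 \/ x <= t /\ i x = 1.
  rewrite /i indicE; case: (boolP (x \in _)) => h; [right|by left].
  by split=> //; move: h; rewrite inE /= in_itv.
have -> : circle_integral (fun x => s1 x * i x * prim (mkL2 (fun x => g x * i x)) x) =
    prim (mul s1 (V u)) t.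
  rewrite /V mul_mk //; last exact: sq_prim.
  rewrite prim_mk //; congr circle_integral; apply/funext => x; rewrite P2 -/(i x).
  by have [->|[xt ->]] := ind x; rewrite ?mulr0 ?mul0r // (min_idPl xt) !mulr1.
(* The primitive of [s1] is s - s 0 and not s. The extra term cancels against the one in (s t - s 0)
   * prim u t. *)
have -> : circle_integral (fun x => g x * i x * prim (mkL2 (fun x => s1 x * i x)) x) =
    prim (mul s u) t - s 0 * prim u t.
  rewrite {2}(_ : u = mkL2 g) // !prim_mk // -mulNr -circle_integralZ // -circle_integralD //;
    [|exact: sq_cutM|by apply: sqZ; exact: sq_cutM].
  have hL : sq_integrable (fun x => (s x * g x) * i x + - s 0 * (g x * i x)).
    by apply: sqD; [exact: sq_cutM|by apply: sqZ; exact: sq_cutM].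
  have E : (fun x => g x * i x * prim (mkL2 (fun x0 => s1 x0 * i x0)) x) =
      (fun x => (s x * g x) * i x + - s 0 * (g x * i x)) %[ae mu].
    apply: ae_eq_circle => x x01; rewrite P1 //.
    by have [->|[xt ->]] := ind x; rewrite ?(min_idPl xt); ring.
  apply: circle_integral_ae => //; last exact: sq_integrable1.
  apply: sq_integrable1; rewrite (_ : (fun x => _) = fun x => prim (mkL2 (fun x => s1 x * i x)) x * (g x * i x)).
    by apply: sq_contM => //; exact: prim_continuous.
  by apply/funext => x; rewrite mulrC.
have -> : prim (mul s1 (V u) + mul s u) t = prim (mul s1 (V u)) t + prim (mul s u) t.
  by rewrite /prim ipDl.
by move=> /(congr1 (fun z => z + s 0 * prim u t)); rewrite addrA subrK => ->; ring.
Qed.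

End Volterra.

(** * Inverting 1 + b V^2 by variation of constants *)

Definition linear_pack (R : pzRingType) (E F : lmodType R) (f : E -> F) (lf : linear f) :
  {linear E -> F} := HB.pack f (GRing.isLinear.Build R E F *:%R f lf).

(* (1 + b V^2) u = f is the initial value problem y'' + b y = f, y(0) = y'(0) = 0, for y = V^2 u.
   P, Q, P1, Q1 stand for multiplication by fundamental solutions p, q of the homogeneous equation
   and by their derivatives, normalized to Wronskian 1. *)
Lemma variation_of_constants (R : fieldType) (E : lmodType R) (V P P1 Q Q1 : {linear E -> E}) (b : R) :
  (forall u, P (V u) = V (P1 (V u) + P u)) -> (forall u, P1 (V u) = V (- b *: P (V u) + P1 u)) ->
  (forall u, Q (V u) = V (Q1 (V u) + Q u)) -> (forall u, Q1 (V u) = V (- b *: Q (V u) + Q1 u)) ->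
  (forall u, Q (P u) = P (Q u)) -> (forall u, Q1 (P u) = P (Q1 u)) ->
  (forall u, P1 (Q u) = Q (P1 u)) -> (forall u, P (Q1 u) - Q (P1 u) = u) ->
  exists N : {linear E -> E},
    (forall u, N (u + b *: V (V u)) = u) /\ (forall f, N f + b *: V (V (N f)) = f).
Proof.
move=> dP dP1 dQ dQ1 QP Q1P P1Q W.
have cancel (x y z : E) : x + z - (y + z) = x - y by rewrite opprD addrACA subrr addr0.
have swap (x y z t : E) : x + y - (z + t) = y - t + (x - z) by rewrite opprD addrACA addrC.
(* With Wronskian 1, y = q V(p f) - p V(q f) solves y'' + b y = f with zero initial data. The
   unknown of the integral equation is u = y'' = f - b y, which is [N] below. *)
pose G f := Q (V (P f)) - P (V (Q f)).
have Glin : linear G.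
  by move=> a u v; rewrite /G !linearP scalerDr addrACA.
have GV f : G f = V (V (f - b *: G f)).
  rewrite {1}/G dQ dP -linearB /= QP cancel dQ1 dP1 -linearB /= swap Q1P P1Q W.
  by rewrite -scalerBr scaleNr.
have VG u : G (u + b *: V (V u)) = V (V u).
  (* For y = V (V u) the identity (p y' - p' y)' = p (y'' + b y) is integrated; [EQ] is the same for
     q. *)
  have EP : V (P (u + b *: V (V u))) = P (V u) - P1 (V (V u)).
    rewrite (dP u) (dP1 (V u)) -linearB /= [P1 (V u) + _]addrC cancel.
    by rewrite linearD linearZ /= scaleNr opprK.
  have EQ : V (Q (u + b *: V (V u))) = Q (V u) - Q1 (V (V u)).
    rewrite (dQ u) (dQ1 (V u)) -linearB /= [Q1 (V u) + _]addrC cancel.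
    by rewrite linearD linearZ /= scaleNr opprK.
  rewrite /G EP EQ (linearB Q) (linearB P) /= QP -[RHS]W opprB addrC addrA; congr (_ - _).
  by rewrite addrAC -addrA subrr addr0.
pose N u := u - b *: G u.
have Nlin : linear N.
  move=> a u v; have GE : G (a *: u + v) = a *: G u + G v by exact: Glin.
  have E1 : a *: (u - b *: G u) = a *: u - b *: (a *: G u) by rewrite scalerBr !scalerA mulrC.
  have E2 : b *: (a *: G u + G v) = b *: (a *: G u) + b *: G v by rewrite scalerDr.
  by rewrite /N GE E1 E2 opprD addrACA.
pose NL : {linear E -> E} := linear_pack Nlin.
exists NL; split=> [u|f]; rewrite /= /N.
  by rewrite VG addrK.
by rewrite -GV subrK.
Qed.

Section FundamentalSolutions.
Context (R : realType).
Implicit Types (w a b : R) (s : R -> R) (u f : L2 R).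

Lemma C1_affine_comp (F F1 : R -> R) w : C1 F F1 ->
  C1 (fun x => F (w * x)) (fun x => w * F1 (w * x)).
Proof.
move=> [d c].
have cw : continuous (fun x : R => w * x) by move=> x; apply: cvgM; [exact: cvg_cst|exact: cvg_id].
split=> [t|t]; last first.
  by apply: cvgM; [exact: cvg_cst|apply: continuous_comp; [exact: cw|exact: c]].
have dw : is_derive t (1 : R) (fun x : R => w * x) w.
  have := @is_deriveZ R R R id w t 1 1 (is_derive_id t 1).
  by rewrite /GRing.scale /= mulr1.
rewrite mulrC; exact: (@is_derive1_comp R F (fun x => w * x) t (F1 (w * t)) w (d _) dw).
Qed.

Lemma C1_scale a s s1 : C1 s s1 -> C1 (fun x => a * s x) (fun x => a * s1 x).
Proof.
move=> [d c]; split=> t; last by apply: cvgM; [exact: cvg_cst|exact: c].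
exact: (@is_deriveZ R R R s a t 1 (s1 t) (d t)).
Qed.

Lemma C1_add s s1 r r1 : C1 s s1 -> C1 r r1 -> C1 (fun x => s x + r x) (fun x => s1 x + r1 x).
Proof.
move=> [d c] [d' c']; split=> t; last by apply: cvgD; [exact: c|exact: c'].
exact: (@is_deriveD R R R s r t 1 (s1 t) (r1 t) (d t) (d' t)).
Qed.

Lemma C1_cst a : C1 (fun=> a) (fun=> 0).
Proof. by split=> t; [exact: is_derive_cst|exact: cvg_cst]. Qed.

Lemma C1_id : C1 (fun x : R => x) (fun=> 1).
Proof. by split=> t; [exact: is_derive_id|exact: cvg_cst]. Qed.

Lemma C1_cos w : C1 (fun x => cos (w * x)) (fun x => - w * sin (w * x)).
Proof.
have C : C1 (@cos R) (fun x => - sin x).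
  split=> t; first exact: is_derive_cos.
  by apply: cvgN; exact: continuous_sin.
by have := C1_affine_comp w C; congr (C1 _ _); apply/funext => x; rewrite mulrN mulNr.
Qed.

Lemma C1_sin w : C1 (fun x => sin (w * x)) (fun x => w * cos (w * x)).
Proof.
by apply: C1_affine_comp; split=> t; [exact: is_derive_sin|exact: continuous_cos].
Qed.

Lemma C1_expR w : C1 (fun x => expR (w * x)) (fun x => w * expR (w * x)).
Proof.
by apply: C1_affine_comp; split=> t; [exact: is_derive_expR|exact: continuous_expR].
Qed.

Lemma fundamental_solutions b : exists p p1 q q1 : R -> R,
  [/\ C1 p p1, C1 p1 (fun x => - b * p x), C1 q q1, C1 q1 (fun x => - b * q x) &
      forall x, p x * q1 x - p1 x * q x = 1].
Proof.
have [b0|b0|->] := ltgtP b 0.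
- pose w := Num.sqrt (- b); have ww : w * w = - b by rewrite -expr2 sqr_sqrtr // oppr_ge0 ltW.
  have w0 : w != 0 by rewrite sqrtr_eq0 -ltNge oppr_gt0.
  exists (fun x => expR (w * x)), (fun x => w * expR (w * x)).
  (* The factor - 1 / (2 w) normalizes the Wronskian with exp (w x) to 1. *)
  exists (fun x => - (2 * w)^-1 * expR (- w * x)), (fun x => 2^-1 * expR (- w * x)).
  have e a c : C1 (fun x => a * expR (c * x)) (fun x => a * (c * expR (c * x))).
    exact/C1_scale/C1_expR.
  split.
  + exact: C1_expR.
  + have := e w w; congr (C1 _ _); apply/funext => x; rewrite mulrA ww; ring.
  + have := e (- (2 * w)^-1) (- w); congr (C1 _ _); apply/funext => x; field; exact: w0.
  + have := e 2^-1 (- w); congr (C1 _ _); apply/funext => x; rewrite -ww; field; exact: w0.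
  + move=> x; have E : expR (w * x) * expR (- w * x) = 1.
      by rewrite -expRD mulNr subrr expR0.
    rewrite [X in X - _]mulrCA E [X in _ - X](_ : _ = - 2^-1 * (expR (w * x) * expR (- w * x))).
      by rewrite E; field.
    by field; exact: w0.
- pose w := Num.sqrt b; have ww : w * w = b by rewrite -expr2 sqr_sqrtr // ltW.
  have w0 : w != 0 by rewrite sqrtr_eq0 -ltNge.
  exists (fun x => cos (w * x)), (fun x => - w * sin (w * x)).
  exists (fun x => w^-1 * sin (w * x)), (fun x => cos (w * x)); split.
  + exact: C1_cos.
  + have := C1_scale (- w) (C1_sin w); congr (C1 _ _); apply/funext => x; rewrite -ww; ring.
  + have := C1_scale w^-1 (C1_sin w); congr (C1 _ _); apply/funext => x; field; exact: w0.
  + have := C1_cos w; congr (C1 _ _); apply/funext => x; rewrite -ww; field; exact: w0.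
  + move=> x; rewrite -(cos2Dsin2 (w * x)); field; exact: w0.
- exists (fun=> 1), (fun=> 0), (fun x => x), (fun=> 1).
  have := C1_cst; move=> Cc; split=> //.
  + by have := Cc 0; congr (C1 _ _); apply/funext => x; rewrite oppr0 mul0r.
  + exact: C1_id.
  + by have := Cc 1; congr (C1 _ _); apply/funext => x; rewrite oppr0 mul0r.
  + by move=> x; rewrite mul0r subr0 mulr1.
Qed.

(** Multiplications commute with each other and satisfy the integrated product rule [V_product],
    which is all that [variation_of_constants] asks for. *)
Lemma Volterra_bijective b : exists N : {linear L2 R -> L2 R},
  (forall u, N (u + b *: V (V u)) = u) /\ (forall f, N f + b *: V (V (N f)) = f).
Proof.
have [p [p1 [q [q1 [Cp Cp1 Cq Cq1 W]]]]] := fundamental_solutions b.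
have cp := C1_continuous Cp; have cq := C1_continuous Cq.
have cp1 := C1_continuous Cp1; have cq1 := C1_continuous Cq1.
pose L s (c : continuous s) : {linear L2 R -> L2 R} :=
  linear_pack (mul_is_linear c).
have com s r (c : continuous s) (d : continuous r) u : mul s (mul r u) = mul r (mul s u).
  by rewrite !mulA //; congr (mul _ _); apply/funext => x; rewrite mulrC.
have ode s s1 (C : C1 s s1) (C' : C1 s1 (fun x => - b * s x)) u :
    mul s1 (V u) = V (- b *: mul s (V u) + mul s1 u).
  rewrite (V_product _ C') -mul_cst mulA //; first exact: cst_continuous.
  exact: C1_continuous C.
have wr u : mul p (mul q1 u) - mul q (mul p1 u) = u.
  rewrite (mulA _ cp cq1) (mulA _ cq cp1) -scaleN1r -mul_cst mulA; last 2 first.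
  - exact: cst_continuous.
  - by move=> x; apply: cvgM; [exact: cq|exact: cp1].
  rewrite -mulDl.
  + rewrite (_ : (fun x => _) = fun=> 1) ?mul_cst ?scale1r //.
    by apply/funext => x; rewrite -[RHS](W x); ring.
  + by move=> x; apply: cvgM; [exact: cp|exact: cq1].
  + by move=> x; apply: cvgM; [exact: cvg_cst|apply: cvgM; [exact: cq|exact: cp1]].
apply: (@variation_of_constants R (L2 R) (@V R) (L p cp) (L p1 cp1) (L q cq) (L q1 cq1)) => /= u.
- exact: V_product.
- exact: ode.
- exact: V_product.
- exact: ode.
- exact: com.
- exact: com.
- exact: com.
- exact: wr.
Qed.

End FundamentalSolutions.

(** * Density of trigonometric polynomials *)

Section TrigonometricPolynomials.
Context (R : realType).
Implicit Types (f g : R -> R) (u v w : L2 R).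

Inductive trig : (R -> R) -> Prop :=
| trig_cos (k : int) : trig (fun x => cos (2 * pi * k%:~R * x))
| trig_sin (k : int) : trig (fun x => sin (2 * pi * k%:~R * x))
| trig_add f g : trig f -> trig g -> trig (fun x => f x + g x)
| trig_scale a f : trig f -> trig (fun x => a * f x).

Lemma trig_cst a : trig (fun=> a).
Proof.
have := trig_scale a (trig_cos 0); congr trig; apply/funext => x.
by rewrite mulr0 mul0r cos0 mulr1.
Qed.

(** Product-to-sum formulas. Frequencies may be negative, so k - l needs no case distinction. *)
Lemma trig_mul f g : trig f -> trig g -> trig (fun x => f x * g x).
Proof.

have freq (k l : int) x : 2 * pi * (k + l)%:~R * x = 2 * pi * k%:~R * x + 2 * pi * l%:~R * x :> R.
  by rewrite intrD mulrDr mulrDl.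
have freqN (k : int) x : 2 * pi * (- k)%:~R * x = - (2 * pi * k%:~R * x) :> R.
  by rewrite intrN mulrN mulNr.
have cc (k l : int) : trig (fun x => cos (2 * pi * k%:~R * x) * cos (2 * pi * l%:~R * x)).
  have := trig_scale 2^-1 (trig_add (trig_cos (k + l)) (trig_cos (k - l))).
  congr trig; apply/funext => x; rewrite !freq freqN !cosD cosN sinN; by field.
have ss (k l : int) : trig (fun x => sin (2 * pi * k%:~R * x) * sin (2 * pi * l%:~R * x)).
  have := trig_scale 2^-1 (trig_add (trig_cos (k - l)) (trig_scale (- 1) (trig_cos (k + l)))).
  congr trig; apply/funext => x; rewrite !freq freqN !cosD cosN sinN; by field.
have sc (k l : int) : trig (fun x => sin (2 * pi * k%:~R * x) * cos (2 * pi * l%:~R * x)).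
  have := trig_scale 2^-1 (trig_add (trig_sin (k + l)) (trig_sin (k - l))).
  congr trig; apply/funext => x; rewrite !freq freqN !sinD cosN sinN; by field.
have swap a b : trig (fun x => a x * b x) -> trig (fun x => b x * a x).
  by congr trig; apply/funext => x; rewrite mulrC.
have linr a : (forall k : int, trig (fun x => a x * cos (2 * pi * k%:~R * x))) ->
    (forall k : int, trig (fun x => a x * sin (2 * pi * k%:~R * x))) ->
    forall b, trig b -> trig (fun x => a x * b x).
  move=> ac asn b; elim=> {b} [k|k|b c _ hb _ hc|r b _ hb].
  - exact: ac.
  - exact: asn.
  - by have := trig_add hb hc; congr trig; apply/funext => x; rewrite mulrDr.
  - by have := trig_scale r hb; congr trig; apply/funext => x; rewrite mulrCA.
move=> hf hg; apply: (linr f _ _ g hg) => k; apply: (swap _ _); apply: (linr _ _ _ f hf) => l.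
- exact: cc.
- exact: (swap _ _ (sc l k)).
- exact: sc.
- exact: ss.
Qed.

Lemma trig_exp f n : trig f -> trig (fun x => f x ^+ n).
Proof.
move=> hf; elim: n => [|n hn]; first exact: trig_cst.
by have := trig_mul hf hn; congr trig; apply/funext => x; rewrite exprS.
Qed.

Lemma trig_C1 f : trig f -> exists2 f1, trig f1 & C1 f f1.
Proof.
elim=> {f} [k|k|f g _ [f1 hf df] _ [g1 hg dg]|a f _ [f1 hf df]].
- by exists (fun x => - (2 * pi * k%:~R) * sin (2 * pi * k%:~R * x)); [exact/trig_scale/trig_sin|exact: C1_cos].
- by exists (fun x => (2 * pi * k%:~R) * cos (2 * pi * k%:~R * x)); [exact/trig_scale/trig_cos|exact: C1_sin].
- by exists (fun x => f1 x + g1 x); [exact: trig_add|exact: C1_add].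
- by exists (fun x => a * f1 x); [exact: trig_scale|exact: C1_scale].
Qed.

Lemma trig_continuous f : trig f -> continuous f.
Proof. by move=> /trig_C1[f1 _]; exact: C1_continuous. Qed.

Lemma derive1_C1 f f1 : C1 f f1 -> f^`()%classic = f1.
Proof. by move=> [d _]; apply/funext => t; rewrite derive1E; have [_ ->] := d t. Qed.

Lemma trig_derive1n f n : trig f -> trig (f^`(n))%classic.
Proof.
move=> hf; elim: n => [|n /trig_C1[f1 h1 c1]]; first by rewrite derive1n0.
by rewrite derive1nS (derive1_C1 c1).
Qed.

Lemma cos_sin_2pi_int (k : int) : cos (2 * pi * k%:~R) = 1 :> R /\ sin (2 * pi * k%:~R) = 0 :> R.
Proof.
have nat_case (n : nat) : cos (2 * pi * n%:R) = 1 :> R /\ sin (2 * pi * n%:R) = 0 :> R.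
  elim: n => [|n [hc hs]]; first by rewrite mulr0 cos0 sin0.
  have e : 2 * pi * n.+1%:R = 2 * pi * n%:R + pi *+ 2 :> R.
    by rewrite -[n.+1%:R]natr1 mulrDr mulr1 [2 * pi in X in _ + X]mulr_natl.
  by rewrite e cosD2pi sinD2pi.
case: k => n; first exact: nat_case.
by rewrite NegzE intrN mulrN cosN sinN; have [-> ->] := nat_case n.+1; rewrite oppr0.
Qed.

Lemma trig_periodic f t : trig f -> f (t + 1) = f t.
Proof.
elim=> {f} [k|k|f g _ hf _ hg|a f _ hf]; rewrite ?hf ?hg //.
all: have [hc hs] := cos_sin_2pi_int k; rewrite mulrDr mulr1 ?cosD ?sinD hc hs.
all: by rewrite !mulr0 !mulr1 ?subr0 ?addr0.
Qed.

Lemma trig_test f : trig f -> test_function f.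
Proof.
move=> hf; split=> [n t|t]; last exact: trig_periodic.
by have [f1 _ [d _]] := trig_C1 (trig_derive1n n hf); have [] := d t.
Qed.

(** Testing against derivatives of trigonometric polynomials therefore loses only the constants. *)
Lemma trig_antiderivative f : trig f ->
  exists a F F1, [/\ trig F, C1 F F1 & forall x, f x = a + F1 x].
Proof.
have z a : exists b F F1, [/\ trig F, C1 F F1 & forall x : R, a = b + F1 x].
  by exists a, (fun=> 0), (fun=> 0); split=> [||x]; [exact: trig_cst|exact: C1_cst|rewrite addr0].
have nz (k : int) : k != 0 -> 2 * pi * k%:~R != 0 :> R.
  move=> k0; apply: mulf_neq0; last by rewrite intr_eq0.
  by apply: mulf_neq0; [rewrite pnatr_eq0|rewrite gt_eqF // pi_gt0].
elim=> {f} [k|k|f g _ [a [F [F1 [hF dF eF]]]] _ [b [G [G1 [hG dG eG]]]]|c f _ [a [F [F1 [hF dF eF]]]]].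
- have [->|k0] := eqVneq k 0.
    have [a [F [F1 [hF dF eF]]]] := z 1; exists a, F, F1; split=> // x.
    by rewrite -eF mulr0 mul0r cos0.
  exists 0, (fun x => (2 * pi * k%:~R)^-1 * sin (2 * pi * k%:~R * x)), (fun x => cos (2 * pi * k%:~R * x)).
  split=> [||x]; [exact/trig_scale/trig_sin| |by rewrite add0r].
  have := C1_scale (2 * pi * k%:~R : R)^-1 (C1_sin (2 * pi * k%:~R)); congr (C1 _ _).
  by apply/funext => x; rewrite mulrA mulVf ?mul1r // nz.
- have [->|k0] := eqVneq k 0.
    have [a [F [F1 [hF dF eF]]]] := z 0; exists a, F, F1; split=> // x.
    by rewrite -eF mulr0 mul0r sin0.
  exists 0, (fun x => - (2 * pi * k%:~R)^-1 * cos (2 * pi * k%:~R * x)), (fun x => sin (2 * pi * k%:~R * x)).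
  split=> [||x]; [exact/trig_scale/trig_cos| |by rewrite add0r].
  have := C1_scale (- (2 * pi * k%:~R : R)^-1) (C1_cos (2 * pi * k%:~R)); congr (C1 _ _).
  by apply/funext => x; rewrite mulrA mulrNN mulVf ?mul1r // nz.
- exists (a + b), (fun x => F x + G x), (fun x => F1 x + G1 x).
  split=> [||x]; [exact: trig_add|exact: C1_add|by rewrite eF eG addrACA].
- exists (c * a), (fun x => c * F x), (fun x => c * F1 x).
  by split=> [||x]; [exact: trig_scale|exact: C1_scale|rewrite eF mulrDr].
Qed.

Lemma Bernoulli_ge (x : R) n : 0 <= x -> 1 + n%:R * x <= (1 + x) ^+ n.
Proof.
move=> x0; elim: n => [|n hn]; first by rewrite mul0r addr0 expr0.
rewrite exprS; apply: (@le_trans _ _ ((1 + x) * (1 + n%:R * x))).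
  have h : 0 <= n%:R * x * x by rewrite !mulr_ge0 ?ler0n.
  by rewrite -[n.+1%:R]natr1; lra.
by rewrite ler_wpM2l // addr_ge0.
Qed.

Lemma Bernoulli_le (x : R) n : 0 <= x <= 1 -> 1 - n%:R * x <= (1 - x) ^+ n.
Proof.
move=> /andP[x0 x1]; elim: n => [|n hn]; first by rewrite mul0r subr0 expr0.
rewrite exprS; apply: (@le_trans _ _ ((1 - x) * (1 - n%:R * x))).
  have h : 0 <= n%:R * x * x by rewrite !mulr_ge0 ?ler0n.
  by rewrite -[n.+1%:R]natr1; lra.
by rewrite ler_wpM2l // subr_ge0.
Qed.

(* The Brosowski-Deutsch polynomials: they separate the values below 1/2 from those above. *)
Definition threshold n (x : R) : R := (1 - x ^+ n) ^+ (2 ^ n).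

Lemma threshold_bound n x : 0 <= x <= 1 -> 0 <= threshold n x <= 1.
Proof.
move=> /andP[x0 x1]; have h : x ^+ n <= 1 by exact: exprn_ile1.
rewrite /threshold exprn_ge0 ?subr_ge0 //= exprn_ile1 ?subr_ge0 // gerBl.
exact: exprn_ge0.
Qed.

(** The Bernoulli inequality bounds it below by 1 - (2 x)^n. *)
Lemma threshold_lt x : 0 <= x -> x < 2^-1 -> threshold n x @[n --> \oo] --> (1 : R).
Proof.
move=> x0 x2; apply/cvgrPdist_le => e e0.
have y1 : `|2 * x| < 1 by rewrite ger0_norm ?mulr_ge0 //; lra.
have /cvgrPdist_le /(_ e e0) := cvg_geometric 1 y1; apply: filterS => n.
rewrite /geometric /= mul1r sub0r normrN => hn; rewrite distrC.
have xn : 0 <= x ^+ n <= 1 by rewrite exprn_ge0 //= exprn_ile1 //; lra.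
have := Bernoulli_le (2 ^ n) xn; rewrite -/(threshold n x).
have /andP[_ t1] : 0 <= threshold n x <= 1 by apply: threshold_bound; lra.
rewrite natrX -exprMn => h; rewrite ler0_norm ?subr_le0 // opprB.
by move: hn; rewrite ger0_norm ?exprn_ge0 ?mulr_ge0 //; lra.
Qed.

(** Multiplied by (1 + x^n)^(2^n), which is at least (2 x)^n, it becomes (1 - x^(2 n))^(2^n) <= 1;
    so it is at most (2 x)^(-n). *)
Lemma threshold_gt x : 2^-1 < x -> x <= 1 -> threshold n x @[n --> \oo] --> (0 : R).
Proof.
move=> x2 x1; apply/cvgrPdist_le => e e0.
have x0 : 0 < x by lra.
have y1 : `|(2 * x)^-1| < 1 by rewrite ger0_norm ?invr_ge0 ?mulr_ge0 ?ltW // invf_lt1 ?mulr_gt0 //; lra.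
have /cvgrPdist_le /(_ e e0) := cvg_geometric 1 y1; apply: filterS => n.
rewrite /geometric /= mul1r !sub0r !normrN.
have xn : 0 <= x ^+ n <= 1 by rewrite exprn_ge0 ?(ltW x0) //= exprn_ile1 // ltW.
have xx : 0 <= x <= 1 by rewrite ltW.
have /andP[t0 t1] := threshold_bound n xx.
have i0 : 0 <= (2 * x)^-1 by rewrite invr_ge0 mulr_ge0 // ltW.
rewrite ger0_norm ?exprn_ge0 // => hn.
rewrite ger0_norm //; apply: le_trans hn.
have B := @Bernoulli_ge (x ^+ n) (2 ^ n) (exprn_ge0 n (ltW x0)).
have P : 0 < (2 * x) ^+ n by rewrite exprn_gt0 // mulr_gt0.
rewrite exprVn -[leRHS]mul1r ler_pdivlMr //.
apply: (@le_trans _ _ (threshold n x * (1 + x ^+ n) ^+ (2 ^ n))).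
  by rewrite ler_wpM2l //; apply: le_trans B; rewrite natrX -exprMn; lra.
rewrite /threshold -exprMn exprn_ile1 //.
  by rewrite mulr_ge0 ?subr_ge0 ?addr_ge0 //; case/andP: xn.
rewrite -subr_sqr expr1n gerBl sqr_ge0 //.
Qed.

End TrigonometricPolynomials.

Section WeakDerivatives.
Context (R : realType).
Local Notation mu := (circle_measure R).
Implicit Types (f g : R -> R) (u v w : L2 R).

Lemma ae_neq (c : R) : \forall t \ae mu, t != c.
Proof.
exists [set c]; split; [exact: measurable_set1|exact: circle_measure_set1|].
by move=> t /= /negP; rewrite negbK => /eqP.
Qed.

(* The arc [0, a] of the circle is where this trigonometric polynomial is at least 1/2. *)
Let X (a t : R) : R := 2^-1 + 2^-1 * (sin (pi * t) * sin (pi * (a - t))).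

(** The two sine factors are not 1-periodic, but their product is (cos (pi (2 t - a)) - cos (pi a))
    / 2. *)
Let trig_X a : trig (X a).
Proof.
have := trig_add (trig_cst (2^-1 - 4^-1 * cos (pi * a)))
  (trig_scale 4^-1 (trig_add (trig_scale (cos (pi * a)) (trig_cos R 1))
                             (trig_scale (sin (pi * a)) (trig_sin R 1)))).
congr trig; apply/funext => t; rewrite /X mulrBr sinB mulr1.
have -> : 2 * pi * t = pi * t + pi * t by ring.
rewrite cosD sinD; have := cos2Dsin2 (pi * t).
set A := cos (pi * t); set B := sin (pi * t) => AB.
have -> : A * A = 1 - B * B by rewrite -AB; ring.
by field.
Qed.

Let X01 a t : 0 <= X a t <= 1.
Proof.
have : `|sin (pi * t) * sin (pi * (a - t))| <= 1.
  rewrite normrM; apply: mulr_ile1; rewrite ?normr_ge0 // ler_norml.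
    by rewrite sin_geN1 sin_le1.
  by rewrite sin_geN1 sin_le1.
by rewrite ler_norml /X => /andP[h1 h2]; apply/andP; split; lra.
Qed.

Let sin_pi_gt0 t : 0 < t < 1 -> 0 < sin (pi * t) :> R.
Proof.
move=> /andP[t0 t1]; apply: sin_gt0_pi; rewrite mulr_gt0 ?pi_gt0 //=.
by rewrite -[ltRHS]mulr1 ltr_pM2l ?pi_gt0.
Qed.

(** The polynomials [threshold n (X a t)] stay in [0, 1] and tend to 1 for t > a and to 0 for t < a.
    Dominated convergence makes [u] orthogonal to the indicator of t > a; orthogonality to constants
    then gives the claim. *)
Lemma trig_orthogonal_prim u (a : R) : (forall f, trig f -> L2_integral u f = 0) ->
  0 < a < 1 -> prim u a = 0.
Proof.
move=> hu /andP[a0 a1]; pose h : R -> R := L2_repr u.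
have sh : sq_integrable h by exact: sq_repr.
have mh := sq_measurable sh.
pose F n (t : R) := (h t * threshold n (X a t))%:E.
pose G (t : R) := (h t * (1 - \1_(`]-oo, a]) t))%:E.
have tt n : trig (fun t => threshold n (X a t)).
  rewrite /threshold; apply: trig_exp.
  have := trig_add (trig_cst 1) (trig_scale (-1) (trig_exp n (trig_X a))).
  by congr trig; apply/funext => t; rewrite mulN1r.
have mF n : measurable_fun setT (F n).
  apply/measurable_EFinP; apply: measurable_funM => //.
  by apply: continuous_measurable_fun; exact/trig_continuous/tt.
have mG : measurable_fun setT G.
  apply/measurable_EFinP; apply: measurable_funM => //; apply: measurable_funB => //.
have cvg : \forall t \ae mu, setT t -> F ^~ t @ \oo --> G t.
  have c01 := @ae_circle R (fun t => 0 <= t <= 1) (fun t h => h).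
  (* At 0, a and 1 the value of [X] is exactly 1/2, on neither side of the threshold; these points
     are null. *)
  apply: (@filterS2 _ _ (ae_filter_ringOfSetsType _) _ _ _ _ c01
    (@filterS2 _ _ (ae_filter_ringOfSetsType _) _ _ _ (fun t pa p01 => conj pa p01) (ae_neq a)
    (@filterS2 _ _ (ae_filter_ringOfSetsType _) _ _ _ (fun t pa p01 => conj pa p01) (ae_neq 0) (ae_neq 1)))).
  move=> t /andP[t0 t1] [ta [tn0 tn1]] _.
  have {}t0 : 0 < t by rewrite lt_def tn0.
  have {}t1 : t < 1 by rewrite lt_def eq_sym tn1.
  apply: cvg_EFin; first by apply: nearW.
  rewrite /comp /=; apply: cvgM; first exact: cvg_cst.
  have st : 0 < sin (pi * t) by apply: sin_pi_gt0; rewrite t0.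
  have /andP[X0 X1] := X01 a t.
  rewrite indicE; have -> : (t \in `]-oo, a]%classic) = (t <= a).
    by apply/idP/idP; rewrite inE /= in_itv.
  have [at_|ta'|] := ltgtP a t; last by move=> e; rewrite e eqxx in ta.
    rewrite subr0; apply: threshold_lt => //; rewrite /X.
    have : 0 < sin (pi * (t - a)) by apply: sin_pi_gt0; lra.
    rewrite -(opprB a) mulrN sinN oppr_gt0 => sa.
    by have := pmulr_rlt0 (sin (pi * (a - t))) st; rewrite sa => ?; lra.
  rewrite subrr; apply: threshold_gt => //; rewrite /X.
  have sa : 0 < sin (pi * (a - t)) by apply: sin_pi_gt0; lra.
  by have := mulr_gt0 st sa; lra.
have dom : \forall t \ae mu, forall n, setT t -> (`|F n t| <= (`|h t|%R)%:E)%E.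
  apply: nearW => t n _; rewrite /F /= lee_fin normrM ler_piMr //.
  by have /andP[] := threshold_bound n (X01 a t); move=> T0 T1; rewrite ger0_norm.
have ih := integrable_norm (sq_integrable1 sh).
have [_ _] := @dominated_convergence _ (measurableTypeR R) R mu setT measurableT F G _ mF mG cvg ih dom.
have F0 n : (\int[mu]_(t in setT) F n t)%E = 0%E.
  have e : fine (\int[mu]_(t in setT) F n t)%E = 0 := hu _ (tt n).
  rewrite -[LHS]fineK ?e //; apply: integrable_fin_num => //; apply: sq_integrable1.
  rewrite (_ : (fun t => _) = fun t => threshold n (X a t) * h t).
    by apply: sq_contM => //; exact/trig_continuous/tt.
  by apply/funext => t; rewrite mulrC.
under eq_fun do rewrite F0; move=> /(cvg_unique _ (@cvg_cst _ _ _ _ _)) H.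
have sG : sq_integrable (fun t => h t * (1 - \1_(`]-oo, a]) t)).
  rewrite (_ : (fun t => _) = fun t => h t - h t * \1_(`]-oo, a]) t).
    by apply: sqB => //; exact: sq_cutM.
  by apply/funext => t; rewrite mulrBr mulr1.
have H0 : circle_integral (fun t => h t * (1 - \1_(`]-oo, a]) t)) = 0.
  by rewrite /circle_integral /Rintegral -/(G _) -H //.
have H1 : circle_integral h = 0.
  by rewrite -[RHS](hu _ (trig_cst 1)); congr circle_integral; apply/funext => t; rewrite mulr1.
have <- : mkL2 h = u by exact: mkL2_repr.
rewrite prim_mk // -[LHS](_ : circle_integral h + -1 * circle_integral (fun t => h t * (1 - \1_(`]-oo, a]) t)) = _).
  by rewrite H0 H1 mulr0 addr0.
rewrite -circle_integralZ // -circle_integralD //; last exact: sqZ.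
by congr circle_integral; apply/funext => t; ring.
Qed.

(** Almost every point is a Lebesgue point, where the function is the derivative of its primitive,
    and the primitive vanishes nearby. *)
Lemma prim_eq0 u : (forall a, 0 < a < 1 -> prim u a = 0) -> u = 0.
Proof.
move=> P0; pose h : R -> R := L2_repr u.
have sh : sq_integrable h by exact: sq_repr.
have eu : mkL2 h = u by exact: mkL2_repr.
have mh := sq_measurable sh.
have ih : lebesgue_measure.-integrable `[0%R, 1%R] (EFin \o h).
  apply/integrableP; split; first by apply/measurable_EFinP; exact: measurable_funS mh.
  have /integrableP[m _] := sq_integrable1 sh.
  have sa : sq_integrable (fun t => `|h t|).
    apply: sq_integrableE; first exact: measurableT_comp.
    have := Lfun2_integrable_sqr sh; congr (_.-integrable _ _); apply/funext => t /=.
    by rewrite real_normK // num_real.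
  have := prim_lebesgue (t := 1) sa; rewrite ler01 lexx => /(_ isT) H.
  by rewrite [ltLHS](_ : _ = (\int[lebesgue_measure]_(x in `[0%R, 1%R]) `|h x|%:E)%E) // -H ltry.
have : \forall x \ae lebesgue_measure, lebesgue_pt (h \_ `[0%R, 1%R]) x.
  by apply: lebesgue_differentiation; apply: integrable_locally.
case=> N [mN N0 hN].
apply: L2P; apply: ae_eq_trans (_ : (L2_repr u : R -> R) = (fun=> 0) %[ae mu]) _; last first.
  apply: ae_eq_sym; apply: ae_eq_trans (_ : (L2_repr (0 *: (0 : L2 R)) : R -> R) = (fun=> 0) %[ae mu]).
    by rewrite scale0r; exact: ae_eq_refl.
  by apply: ae_eq_trans (L2_reprZ _ _) _; apply: nearW => t _; rewrite mul0r.
have aeN : \forall t \ae mu, ~ N t.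
  exists N; split=> //.
    apply/eqP; rewrite eq_le measure_ge0 andbT -N0 /circle_measure /= /mrestr.
    by apply: le_measure; rewrite ?inE //=; (apply: measurableI => //; exact: measurable_itv) || (by move=> t []).
  by move=> t /=; apply: contra_notP.
have c01 := @ae_circle R (fun t => 0 <= t <= 1) (fun t h => h).
apply: (@filterS2 _ _ (ae_filter_ringOfSetsType _) _ _ _ _ c01
  (@filterS2 _ _ (ae_filter_ringOfSetsType _) _ _ _ (fun t pa p01 => conj pa p01) aeN
  (@filterS2 _ _ (ae_filter_ringOfSetsType _) _ _ _ (fun t pa p01 => conj pa p01) (ae_neq 0) (ae_neq 1)))).
move=> t /andP[t0 t1] [nN [tn0 tn1]] _.
have {}t0 : 0 < t by rewrite lt_def tn0.
have {}t1 : t < 1 by rewrite lt_def eq_sym tn1.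
have lp : lebesgue_pt (h \_ `[0%R, 1%R]) t by apply: contrapT => nl; apply: nN; exact: hN.
have iR : lebesgue_measure.-integrable `[0%R, 1%R] (EFin \o (h \_ `[0%R, 1%R])).
  apply: eq_integrable ih => // x xi; rewrite /= patchE.
  by rewrite xi.
have := @FTC1_lebesgue_pt R _ (BLeft 0) t 1 t1 iR _ lp; rewrite lte_fin => /(_ t0) [_].
rewrite patchE mem_set ?in_itv /= ?in_itv /= ?(ltW t0) ?(ltW t1) // -/h => <-.
rewrite derive1E (@near_eq_derive _ _ _ _ (fun=> 0)); first by rewrite derive_cst.
near=> y; have y01 : 0 < y < 1.
  apply/andP; split; near: y; [exact: lt_nbhsr|exact: lt_nbhsl].
have := prim_lebesgue (t := y) sh; rewrite eu P0 //.
case/andP: y01 => y0 y1; rewrite (ltW y0) (ltW y1) => /(_ isT) E.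
rewrite /Rintegral [X in fine X](_ : _ = 0%:E) // E; apply: eq_integral => x.
rewrite inE /= in_itv /= => /andP[x0 xy]; rewrite patchE mem_set //= in_itv /= x0.
by rewrite (le_trans xy (ltW y1)).
Unshelve. all: by end_near. Qed.

Lemma trig_dense u : (forall f, trig f -> L2_integral u f = 0) -> u = 0.
Proof. by move=> h; apply: prim_eq0 => a; exact: trig_orthogonal_prim. Qed.

End WeakDerivatives.

(** * Weak derivatives *)

Section WeakDerivativeTheory.
Context (R : realType).
Implicit Types (f g phi : R -> R) (u v w : L2 R).

Lemma test_C1 phi : test_function phi -> C1 phi (phi^`())%classic.
Proof.
move=> [d _]; split=> t.
  have h := d 0%N t; rewrite derive1n0 in h.
  by rewrite derive1E; exact: derivableP.
have := d 1%N t; rewrite derive1n1 => h.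
by apply/differentiable_continuous/derivable1_diffP.
Qed.

Lemma test_derive1 phi : test_function phi -> test_function (phi^`())%classic.
Proof.
move=> [d p]; split=> [n t|t]; first by rewrite -derive1Sn; exact: d.
have dphi x : is_derive x (1 : R) phi (phi^`()%classic x).
  by rewrite derive1E; apply: derivableP; have := d 0%N x; rewrite derive1n0.
have ds : is_derive t (1 : R) (fun x : R => x + 1) 1.
  by have := (C1_add (C1_id R) (C1_cst (1 : R))).1 t; rewrite addr0.
have dc := @is_derive1_comp R phi (fun x => x + 1) t _ 1 (dphi (t + 1)) ds.
have e : phi \o (fun x => x + 1) = phi by apply/funext => x /=; exact: p.
rewrite e mulr1 in dc; rewrite [RHS]derive1E; apply/esym.
by have [_ ->] := dc.
Qed.

Lemma test_continuous phi : test_function phi -> continuous phi.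
Proof. by move/test_C1/C1_continuous. Qed.

(** By periodicity phi' has mean zero, so [ip_V] has no right side; the term phi 0 is the constant
    by which [V] of phi' differs from phi. *)
Lemma ip_V_test u phi : test_function phi ->
  ip (V u) (mkL2 (phi^`())%classic) = phi 0 * mean u - ip u (mkL2 phi).
Proof.
move=> tp; have C := test_C1 tp.
have m0 : mean (mkL2 (phi^`())%classic) = 0.
  rewrite -(prim_mean _ (lexx 1)) (FTC2 C) ?lexx ?ler01 //.
  by rewrite -[X in phi X]add0r tp.2 subrr.
have := ip_V u (mkL2 (phi^`())%classic); rewrite m0 mulr0 (V_FTC2 C) ipBr ipZr -/(mean u).
by move/eqP; rewrite addr_eq0 opprB => /eqP.
Qed.

Lemma mean_test phi : test_function phi -> ip (one R) (mkL2 (phi^`())%classic) = 0.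
Proof.
move=> tp; have C := test_C1 tp.
rewrite ipC -/(mean _) -(prim_mean _ (lexx 1)) (FTC2 C) ?lexx ?ler01 //.
by rewrite -[X in phi X]add0r tp.2 subrr.
Qed.

Lemma weak_derivative_ip n u w : weak_derivative n u w <->
  forall phi, test_function phi -> ip u (mkL2 (derive1n n phi)) = (-1) ^+ n * ip w (mkL2 phi).
Proof.
have tn m phi : test_function phi -> test_function (derive1n m phi).
  move=> tp; elim: m => [|m IH]; first by rewrite derive1n0.
  by rewrite derive1nS; exact: test_derive1.
by split=> h phi tp; have := h phi tp; rewrite !L2_integralE //;
  try (by apply: sq_cont; exact: test_continuous); apply: sq_cont; apply: test_continuous; exact: tn.
Qed.

Lemma weak_derivative1P u w : weak_derivative 1 u w <->
  mean w = 0 /\ exists c, u = V w + c *: one R.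
Proof.
rewrite weak_derivative_ip; split=> [h|[m0 [c ->]] phi tp]; last first.
  rewrite derive1n1 ipDl ipZl mean_test // ip_V_test // m0 mulr0 sub0r mulr0 addr0.
  by rewrite expr1 mulN1r.
have t1 : test_function (fun=> 1 : R) by exact/trig_test/trig_cst.
have m0 : mean w = 0.
  have := h _ t1; rewrite derive1n1 (derive1_C1 (C1_cst 1)).
  have -> : mkL2 (fun=> 0 : R) = 0.
    have := mkL2Z 0 (sq_cst (0 : R)); rewrite scale0r => <-.
    by congr mkL2; apply/funext => t; rewrite mul0r.
  by rewrite ip0r expr1 mulN1r => /eqP; rewrite eq_sym oppr_eq0 => /eqP.
(* A trigonometric polynomial is a constant plus some F'. Against F' the hypothesis applies; against
   constants u - V w - c must have mean zero, which dictates c. *)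
split=> //; exists (mean (u - V w)); apply/eqP; rewrite -subr_eq0 opprD addrA subr_eq0; apply/eqP.
apply/eqP; rewrite -subr_eq0; apply/eqP; apply: trig_dense => f tf.
have [a [F [F1 [hF dF eF]]]] := trig_antiderivative tf.
have cF1 : continuous F1 by case: dF.
rewrite L2_integralE; last exact/sq_cont/trig_continuous.
have -> : mkL2 f = a *: one R + mkL2 F1.
  rewrite -(mkL2Z _ (sq_cst 1)) -mkL2D; [|exact/sqZ/sq_cst|exact: sq_cont].
  by congr mkL2; apply/funext => x; rewrite eF mulr1.
have tF := trig_test hF.
rewrite -(derive1_C1 dF) ipDr ipZr !ipBl !ipZl mean_test // -!/(mean _) ip_V_test //.
have := h F tF; rewrite derive1n1 expr1 mulN1r => ->.
have -> : mean (one R) = 1.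
  rewrite mean_mk ?(sq_cst 1) // -[RHS]/(fine 1%:E) -(circle_measureT R) -circle_integral_indic //.
  by congr circle_integral; apply/funext => x; rewrite indicE mem_set.
rewrite !linearB /= mulr1 subrr mulr0 m0 mulr0 add0r; ring.
Qed.

Lemma weak_derivativeD n (a : R) u v w x : weak_derivative n u w -> weak_derivative n v x ->
  weak_derivative n (a *: u + v) (a *: w + x).
Proof.
rewrite !weak_derivative_ip => hu hv phi tp.
by rewrite !ipDl !ipZl hu // hv // mulrDr mulrCA.
Qed.

Lemma weak_derivative_uniq n u w x : weak_derivative n u w -> weak_derivative n u x -> w = x.
Proof.
rewrite !weak_derivative_ip => hw hx; apply/eqP; rewrite -subr_eq0; apply/eqP.
apply: trig_dense => f tf; rewrite L2_integralE; last exact/sq_cont/trig_continuous.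
have := hw f (trig_test tf); rewrite (hx f (trig_test tf)) => /(mulfI _) e.
by rewrite ipBl e ?subrr // signr_eq0.
Qed.

(** Apply the hypothesis to phi', which is again a test function. *)
Lemma weak_derivativeS n u v w : weak_derivative n u v ->
  weak_derivative n.+1 u w <-> weak_derivative 1 v w.
Proof.
rewrite !weak_derivative_ip => hv; split=> h phi tp.
  have := hv _ (test_derive1 tp); rewrite -derive1Sn h // derive1n1 exprS expr1 !mulN1r mulNr.
  by rewrite -mulrN => /(mulfI _) ->; rewrite // signr_eq0.
have := h _ tp; rewrite derive1n1 derive1Sn hv; last exact: test_derive1.
by move=> ->; rewrite expr1 [(-1) ^+ n.+1]exprS !mulN1r mulrN mulNr.
Qed.

Lemma weak_derivative0 u : weak_derivative 0 u u.
Proof. by rewrite weak_derivative_ip => phi _; rewrite derive1n0 expr0 mul1r. Qed.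

End WeakDerivativeTheory.

(** * Fredholm operators *)

Section FiniteRank.
Context (K : fieldType) (E : lmodType K).

(** A factorization through row vectors, and not a bound on the dimension of the image, so that
    kernels and cokernels become those of a matrix. *)
Definition finite_rank (F : E -> E) : Prop :=
  exists n (phi : {linear E -> 'rV[K]_n}) (psi : {linear 'rV[K]_n -> E}),
    forall x, F x = psi (phi x).

Lemma finite_rank_comp (A B : {linear E -> E}) F : finite_rank F -> finite_rank (fun x => A (F (B x))).
Proof.
move=> [n [phi [psi e]]]; exists n, (phi \o B), (A \o psi) => x /=.
by rewrite e.
Qed.

Lemma finite_rankD F G : finite_rank F -> finite_rank G -> finite_rank (fun x => F x + G x).
Proof.
move=> [n [phi [psi e]]] [p [phi' [psi' e']]].
have l1 : linear (fun x => row_mx (phi x) (phi' x)).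
  by move=> a x y; rewrite !linearP /= scale_row_mx add_row_mx.
have l2 : linear (fun c : 'rV[K]_(n + p) => psi (lsubmx c) + psi' (rsubmx c)).
  by move=> a x y; rewrite !linearP /= scalerDr addrACA.
exists (n + p)%N, (linear_pack l1), (linear_pack l2) => x /=.
by rewrite row_mxKl row_mxKr e e'.
Qed.

Lemma finite_rankZ a F : finite_rank F -> finite_rank (fun x => a *: F x).
Proof.
move=> [n [phi [psi e]]]; exists n, phi, (a \*: psi) => x /=.
by rewrite e.
Qed.

Lemma finite_rank1 (p : {linear E -> K^o}) (q : E) : finite_rank (fun x => p x *: q).
Proof.
have l1 : linear (fun x => \row_(i < 1) p x : 'rV[K]_1).
  by move=> a x y; apply/rowP => i; rewrite !mxE linearP.
have l2 : linear (fun c : 'rV[K]_1 => c 0 0 *: q).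
  by move=> a x y; rewrite !mxE scalerDl scalerA.
by exists 1%N, (linear_pack l1), (linear_pack l2) => x /=; rewrite mxE.
Qed.

(* For an invertible M, the kernel and the cokernel of M + psi phi are those of the matrix
   of 1 + phi M^-1 psi. *)
Lemma finite_rank_perturbation (M N : {linear E -> E}) F : cancel M N -> cancel N M -> finite_rank F ->
  exists m (e : {linear 'rV[K]_m -> E}) p (th : {linear E -> 'rV[K]_p}),
    [/\ m = p, injective e, forall x, M x + F x = 0 <-> exists c, x = e c &
        forall y, (exists x, M x + F x = y) <-> th y = 0].
Proof.
move=> MN NM [n [phi [psi eF]]].
pose A : 'M[K]_n := lin1_mx (phi \o N \o psi).
have AE c : c *m A = phi (N (psi c)) by rewrite mul_rV_lin1.
pose B := 1%:M + A.
pose L := row_base (kermx B); pose C := col_base (cokermx B).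
have kB c : c *m L *m B = 0.
  have LB : L *m B = 0 by apply/eqP; rewrite -sub_kermx eq_row_base.
  by rewrite -mulmxA LB mulmx0.
have l1 : linear (fun c : 'rV[K]_(\rank (kermx B)) => N (psi (c *m L))).
  by move=> a x y; rewrite mulmxDl -scalemxAl !linearP.
have l2 : linear (fun y => phi (N y) *m C).
  by move=> a x y; rewrite !linearP /= mulmxDl -scalemxAl.
exists _, (linear_pack l1), _, (linear_pack l2); split=> /=.
(* Both dimensions are n - rank B because [B] is square; every index zero below comes from here. *)
- by rewrite mxrank_ker mxrank_coker.
- move=> c d /= e.
  have : c *m L = d *m L.
    have ecd : (c *m L - d *m L) *m A = 0 by rewrite mulmxBl !AE e subrr.
    have := kB _ (c - d); rewrite mulmxDr mulmx1 mulmxBl ecd addr0 => /eqP.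
    by rewrite subr_eq0 => /eqP.
  by apply: (row_free_inj (row_base_free _)).
- move=> x; split=> [|[c ->]]; last first.
    rewrite NM eF -AE -linearD /= -[X in X + _]mulmx1 -mulmxDr kB linear0 //.
  rewrite eF => /eqP; rewrite addr_eq0 => /eqP Mx.
  (* A kernel vector is N (psi c) with c = - phi x, and applying [phi] to this turns the equation
     into c *m B = 0. *)
  have xE : x = N (psi (- phi x)) by rewrite linearN /= -Mx MN.
  have : (- phi x <= L)%MS.
    rewrite eq_row_base sub_kermx mulmxDr mulmx1 AE -xE addNr //.
  by move=> /submxP[c cE]; exists c; rewrite -cE.
- move=> y; have -> : (phi (N y) *m C = 0) <-> (phi (N y) <= B)%MS.
    rewrite submxE; split=> [h|/eqP h]; last first.
      have : row_free (row_base (cokermx B)) by exact: row_base_free.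
      move=> rf; apply: (row_free_inj rf); rewrite mul0mx -mulmxA mulmx_base; exact: h.
    by rewrite -[cokermx B]mulmx_base mulmxA h mul0mx.
  split=> [[x <-]|/submxP[c cE]].
    rewrite linearD MN linearD /= eF -AE -[X in X + _]mulmx1 -mulmxDr; exact: submxMl.
  (* This x solves the equation iff psi (phi x) = psi c. In fact phi x = c, because phi (N y) = c *m
     B. *)
  exists (N (y - psi c)); rewrite NM eF.
  suff -> : phi (N (y - psi c)) = c by rewrite subrK.
  by rewrite !linearB /= -AE cE mulmxDr mulmx1 addrK.
Qed.

Lemma scaled_bijective (V N : {linear E -> E}) (c a : K) : c != 0 ->
  (forall u, N (u + (a / c) *: V (V u)) = u) -> (forall f, N f + (a / c) *: V (V (N f)) = f) ->
  exists M N' : {linear E -> E},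
    [/\ forall f, M f = c *: f + a *: V (V f), cancel M N' & cancel N' M].
Proof.
move=> c0 N1 N2.
have lM : linear (fun f : E => c *: f + a *: V (V f)).
  move=> r x y; have -> : V (V (r *: x + y)) = r *: V (V x) + V (V y) by rewrite !linearP.
  by rewrite !scalerDr !scalerA addrACA ![r * _]mulrC.
have lN : linear (fun f : E => N (c^-1 *: f)).
  by move=> r x y; rewrite scalerDr linearD /= scalerA mulrC -scalerA linearZ.
have factor f : c *: f + a *: V (V f) = c *: (f + (a / c) *: V (V f)).
  by rewrite scalerDr scalerA mulrC divfK.
exists (linear_pack lM), (linear_pack lN); split=> // f /=.
  by rewrite factor scalerA mulVf // scale1r N1.
by rewrite factor N2 scalerA mulfV // scale1r.
Qed.

End FiniteRank.

(** * Loops, their weak derivatives and Sobolev spaces *)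

Section Loops.
Context (R : realType).
Implicit Types (x y z w : loop R) (c : R).

Lemma dotE z w : dot z w = ip z.1 w.1 + ip z.2 w.2.
Proof. by []. Qed.

Lemma dotC z w : dot z w = dot w z.
Proof. by rewrite !dotE ipC (ipC z.2). Qed.

Lemma dotDl z w x : dot (z + w) x = dot z x + dot w x.
Proof. by rewrite !dotE !ipDl addrACA. Qed.

Lemma dotZl c z w : dot (c *: z) w = c * dot z w.
Proof. by rewrite !dotE !ipZl mulrDr. Qed.

Lemma dot_ge0 z : 0 <= dot z z.
Proof. by rewrite dotE addr_ge0 // ip_ge0. Qed.

Lemma dot_eq0 z : dot z z = 0 -> z = 0.
Proof.
rewrite dotE => /eqP; rewrite paddr_eq0 ?ip_ge0 // => /andP[/eqP/ip_eq0 z1 /eqP/ip_eq0 z2].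
by apply: injective_projections.
Qed.

Lemma dotDr z w x : dot z (w + x) = dot z w + dot z x.
Proof. by rewrite dotC dotDl !(dotC z). Qed.

Lemma dotZr c z w : dot z (c *: w) = c * dot z w.
Proof. by rewrite dotC dotZl dotC. Qed.

Lemma dotNl z w : dot (- z) w = - dot z w.
Proof. by rewrite -scaleN1r dotZl mulN1r. Qed.

Lemma dotNr z w : dot z (- w) = - dot z w.
Proof. by rewrite dotC dotNl dotC. Qed.

Lemma dotBl z w x : dot (z - w) x = dot z x - dot w x.
Proof. by rewrite dotDl dotNl. Qed.

Lemma dotBr z w x : dot x (z - w) = dot x z - dot x w.
Proof. by rewrite dotDr dotNr. Qed.

Lemma dot0l z : dot 0 z = 0.
Proof. by rewrite -(scale0r (0 : loop R)) dotZl mul0r. Qed.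

Lemma dot0r z : dot z 0 = 0.
Proof. by rewrite dotC dot0l. Qed.

Lemma L2norm_ge0 z : 0 <= L2norm z.
Proof. exact: sqrtr_ge0. Qed.

Lemma L2norm_sqr z : L2norm z ^+ 2 = dot z z.
Proof. by rewrite sqr_sqrtr // dot_ge0. Qed.

Lemma dot_le z w : `|dot z w| <= L2norm z * L2norm w.
Proof. exact: (Cauchy_Schwarz dotC dotDl dotZl dot_ge0). Qed.

Lemma L2norm_triangle z w : L2norm (z + w) <= L2norm z + L2norm w.
Proof. exact: (form_triangle dotC dotDl dotZl dot_ge0). Qed.

Lemma L2normZ c z : L2norm (c *: z) = `|c| * L2norm z.
Proof. exact: (form_sqrtZ dotC dotZl). Qed.

Lemma L2norm_eq0 z : L2norm z = 0 -> z = 0.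
Proof.
move=> z0; apply: dot_eq0; have := L2norm_sqr z; rewrite z0 expr0n /= => <-.
by [].
Qed.

Definition VV z : loop R := (V z.1, V z.2).
Definition avg z : loop R := (mean z.1 *: one R, mean z.2 *: one R).

Lemma VV_linear : linear VV.
Proof. by move=> a x y; apply: injective_projections; rewrite /VV /= linearP. Qed.

Lemma avg_linear : linear avg.
Proof.
by move=> a x y; apply: injective_projections; rewrite /avg /= linearP scalerDl scalerA.
Qed.

HB.instance Definition _ := GRing.isLinear.Build R (loop R) (loop R) _ VV VV_linear.
HB.instance Definition _ := GRing.isLinear.Build R (loop R) (loop R) _ avg avg_linear.

Lemma mean_one : mean (one R) = 1.
Proof.
rewrite mean_mk ?(sq_cst 1) // -[RHS]/(fine 1%:E) -(circle_measureT R) -circle_integral_indic //.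
by congr circle_integral; apply/funext => x; rewrite indicE mem_set.
Qed.

Lemma avgK z : avg (avg z) = avg z.
Proof. by apply: injective_projections; rewrite /avg /= linearZ /= mean_one mulr1. Qed.

Lemma avg_sym z w : dot (avg z) w = dot z (avg w).
Proof.
rewrite !dotE /= !ipZl !ipZr; congr (_ + _).
  by rewrite [ip (one R) _]ipC mulrC.
by rewrite [ip (one R) _]ipC mulrC.
Qed.

Lemma dot_VV z w : dot (VV z) w + dot z (VV w) = dot (avg z) w.
Proof.
by rewrite !dotE addrACA /= !ip_V !ipZl ![ip (one R) _]ipC.
Qed.

Lemma loop_weak_derivative1P z w : loop_weak_derivative 1 z w <->
  avg w = 0 /\ exists2 c, avg c = c & z = VV w + c.
Proof.
have one0 : one R != 0.
  by apply/eqP => e; have := mean_one; rewrite e linear0 => /eqP; rewrite eq_sym oner_eq0.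
rewrite /loop_weak_derivative !weak_derivative1P; split.
  move=> [[m1 [c1 e1]] [m2 [c2 e2]]]; split.
    by rewrite /avg m1 m2 !scale0r.
  exists (c1 *: one R, c2 *: one R).
    by apply: injective_projections; rewrite /avg /= linearZ /= mean_one mulr1.
  by apply: injective_projections; rewrite /= ?e1 ?e2.
move=> [[/eqP m1 /eqP m2] [c ec ->]].
move: m1 m2; rewrite !scaler_eq0 (negbTE one0) !orbF => /eqP m1 /eqP m2.
split; split=> //; [exists (mean c.1)|exists (mean c.2)]; rewrite /=; congr (_ + _).
- by rewrite -{1}ec.
- by rewrite -{1}ec.
Qed.

Lemma loop_weak_derivativeD n c x y z w :
  loop_weak_derivative n x z -> loop_weak_derivative n y w ->
  loop_weak_derivative n (c *: x + y) (c *: z + w).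
Proof. by move=> [h1 h2] [h3 h4]; split=> /=; exact: weak_derivativeD. Qed.

Lemma loop_weak_derivative_uniq n x z w :
  loop_weak_derivative n x z -> loop_weak_derivative n x w -> z = w.
Proof.
move=> [h1 h2] [h3 h4]; apply: injective_projections.
  exact: weak_derivative_uniq h1 h3.
exact: weak_derivative_uniq h2 h4.
Qed.

Lemma loop_weak_derivativeS n x y z : loop_weak_derivative n x y ->
  loop_weak_derivative n.+1 x z <-> loop_weak_derivative 1 y z.
Proof.
by move=> [h1 h2]; split=> -[h3 h4]; split; have [] := weak_derivativeS z.1 h1;
  have [] := weak_derivativeS z.2 h2; auto.
Qed.

Lemma loop_weak_derivative0 x : loop_weak_derivative 0 x x.
Proof. by split; exact: weak_derivative0. Qed.

Lemma loop_weak_derivative_zero n : loop_weak_derivative n 0 (0 : loop R).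
Proof.
elim: n => [|n h]; first exact: loop_weak_derivative0.
apply/(loop_weak_derivativeS _ h)/loop_weak_derivative1P; split; first by rewrite linear0.
by exists 0; rewrite ?linear0 ?addr0.
Qed.

Lemma DE n x y : loop_weak_derivative n x y -> D n x = y.
Proof.
move=> h; rewrite /D; case: xgetP => [w _ hw|/(_ y)//].
exact: loop_weak_derivative_uniq hw h.
Qed.

Lemma sobolevP m x n : carrier (sobolev R m) x -> (n <= m)%N -> loop_weak_derivative n x (D n x).
Proof. by move=> hx nm; have [w h] := hx _ nm; rewrite (DE h). Qed.

Lemma sobolev_linear m c x y : carrier (sobolev R m) x -> carrier (sobolev R m) y ->
  carrier (sobolev R m) (c *: x + y).
Proof.
move=> hx hy n nm; exists (c *: D n x + D n y).
by apply: loop_weak_derivativeD; exact: sobolevP nm.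
Qed.

Lemma D_linear m n c x y : carrier (sobolev R m) x -> carrier (sobolev R m) y -> (n <= m)%N ->
  D n (c *: x + y) = c *: D n x + D n y.
Proof. by move=> hx hy nm; apply: DE; apply: loop_weak_derivativeD; exact: sobolevP nm. Qed.

Lemma sobolev0 m : carrier (sobolev R m) 0.
Proof. by move=> n _; exists 0; exact: loop_weak_derivative_zero. Qed.

Lemma sobolevZ m c x : carrier (sobolev R m) x -> carrier (sobolev R m) (c *: x).
Proof. by move=> hx; have := sobolev_linear c hx (@sobolev0 m); rewrite addr0. Qed.

Lemma sobolevD m x y : carrier (sobolev R m) x -> carrier (sobolev R m) y ->
  carrier (sobolev R m) (x + y).
Proof. by move=> hx hy; have := sobolev_linear 1 hx hy; rewrite scale1r. Qed.

Lemma sobolevB m x y : carrier (sobolev R m) x -> carrier (sobolev R m) y ->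
  carrier (sobolev R m) (x - y).
Proof. by move=> hx hy; have := sobolev_linear (-1) hy hx; rewrite scaleN1r addrC. Qed.

Lemma sobolev_le m p x : (p <= m)%N -> carrier (sobolev R m) x -> carrier (sobolev R p) x.
Proof. by move=> pm hx n np; apply: hx; exact: leq_trans pm. Qed.

Lemma D0 x : D 0 x = x.
Proof. exact/DE/loop_weak_derivative0. Qed.

Lemma DD m n p x : carrier (sobolev R m) x -> (n + p <= m)%N -> loop_weak_derivative p (D n x) (D (n + p) x).
Proof.
move=> hx; elim: p => [|p IH] le.
  rewrite addn0; exact: loop_weak_derivative0.
have le' : (n + p <= m)%N by apply: leq_trans le; rewrite addnS.
apply/(loop_weak_derivativeS _ (IH le')).
apply: (loop_weak_derivativeS _ (sobolevP hx le')).1.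
have e : (n + p.+1 = (n + p).+1)%N := addnS n p.
by move: le; rewrite e; exact: sobolevP hx.
Qed.

Lemma sobolev_D m n x : carrier (sobolev R (n + m)) x -> carrier (sobolev R m) (D n x).
Proof. by move=> hx p pm; exists (D (n + p) x); apply: DD hx _; rewrite leq_add2l. Qed.

Lemma D_D m n p x : carrier (sobolev R m) x -> (n + p <= m)%N -> D p (D n x) = D (n + p) x.
Proof. by move=> hx le; apply/DE/(DD hx le). Qed.

(** The gain of regularity: derivatives of y are further derivatives of x. *)
Lemma sobolev_extend m p n x y : carrier (sobolev R m) x -> loop_weak_derivative n x y ->
  (n <= m)%N -> carrier (sobolev R p) y -> carrier (sobolev R (n + p)) x.
Proof.
move=> hx hxy nm hy k kp; have [kn|nk] := leqP k n.
  by exists (D k x); apply: sobolevP hx _; exact: leq_trans nm.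
have key q : (q <= p)%N -> exists w, loop_weak_derivative (n + q) x w /\ loop_weak_derivative q y w.
  elim: q => [_|q IH qp]; first by exists y; rewrite addn0; split=> //; exact: loop_weak_derivative0.
  have [w [w1 w2]] := IH (ltnW qp); have [v hv] := hy _ qp.
  have v1 := (loop_weak_derivativeS _ w2).1 hv.
  by exists v; split=> //; rewrite addnS; apply/(loop_weak_derivativeS _ w1).
have le : (k - n <= p)%N by rewrite leq_subLR.
by have [w [hw _]] := key _ le; exists w; rewrite subnKC ?(ltnW nk) in hw.
Qed.

(** Both loops are primitives up to constants. Derivatives have mean zero, so the constants and the
    boundary term of [dot_VV] drop out. *)
Lemma dot_derivative x y z w : loop_weak_derivative 1 x z -> loop_weak_derivative 1 y w ->
  dot z y = - dot x w.
Proof.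
move=> /loop_weak_derivative1P[z0 [c ec ->]] /loop_weak_derivative1P[w0 [d ed ->]].
have zd : dot z d = 0 by rewrite -ed -avg_sym z0 dot0l.
have cw : dot c w = 0 by rewrite -ec avg_sym w0 dot0r.
rewrite dotDr dotDl zd cw !addr0; have := dot_VV z w; rewrite z0 dot0l.
by move=> /eqP; rewrite addrC addr_eq0 => /eqP.
Qed.

Lemma dot_derivative2 m x y : (2 <= m)%N -> carrier (sobolev R m) x -> carrier (sobolev R m) y ->
  dot (D 2 x) y = dot x (D 2 y).
Proof.
move=> m2 hx hy.
have d z : carrier (sobolev R m) z -> loop_weak_derivative 1 z (D 1 z) /\ loop_weak_derivative 1 (D 1 z) (D 2 z).
  by move=> hz; split; [apply: sobolevP hz _; exact: leq_trans m2|exact: (DD (n:=1) (p:=1) hz)].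
have [x1 x2] := d _ hx; have [y1 y2] := d _ hy.
by rewrite (dot_derivative x2 y1) (dot_derivative x1 y2) // opprK.
Qed.

End Loops.

(** * Kernel, image and index of second order operators on loops *)

Section Fredholm.
Context (R : realType).
Implicit Types (x y z f : loop R).
Local Notation E := (loop R).

Definition osc z : E := z - avg z.

Lemma osc_linear : linear osc.
Proof. by move=> a x y; rewrite /osc linearP scalerBr opprD addrACA. Qed.

HB.instance Definition _ := GRing.isLinear.Build R E E _ osc osc_linear.

Lemma avgB x y : avg (x - y) = avg x - avg y.
Proof. exact: linearB. Qed.

Lemma VVB x y : VV (x - y) = VV x - VV y.
Proof. exact: linearB. Qed.

Lemma avg_osc z : avg (osc z) = 0.
Proof. by rewrite /osc avgB avgK subrr. Qed.

(* The inverse of x |-> x'' - avg x. *)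
Definition J f : E := osc (VV (osc (VV (osc f)))) - avg f.

Lemma J_linear : linear J.
Proof. move=> a x y; have VVP u v : VV (a *: u + v) = a *: VV u + VV v by exact: linearP.
have oscP u v : osc (a *: u + v) = a *: osc u + osc v by exact: osc_linear.
have avgP u v : avg (a *: u + v) = a *: avg u + avg v by exact: linearP.
by rewrite /J oscP VVP oscP VVP oscP avgP scalerBr opprD addrACA. Qed.

HB.instance Definition _ := GRing.isLinear.Build R E E _ J J_linear.

Lemma J_avg f : avg (J f) = - avg f.
Proof. by rewrite /J avgB avg_osc avgK sub0r. Qed.

Lemma loop_weak_derivative_osc f : avg f = 0 -> loop_weak_derivative 1 (osc (VV f)) f.
Proof.
move=> f0; apply/loop_weak_derivative1P; split=> //.
by exists (- avg (VV f)) => //; rewrite linearN /= avgK.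
Qed.

Lemma loop_weak_derivative_avg f : loop_weak_derivative 1 (avg f) 0.
Proof.
by apply/loop_weak_derivative1P; rewrite linear0; split=> //; exists (avg f); rewrite ?avgK // linear0 add0r.
Qed.

Lemma loop_weak_derivativeB n x y z w : loop_weak_derivative n x z -> loop_weak_derivative n y w ->
  loop_weak_derivative n (x - y) (z - w).
Proof.
by move=> h1 h2; have := loop_weak_derivativeD (-1) h2 h1; rewrite !scaleN1r [- y + _]addrC [- w + _]addrC.
Qed.

Lemma J_derivative1 f : loop_weak_derivative 1 (J f) (osc (VV (osc f))).
Proof.
rewrite -[osc _]subr0; apply: loop_weak_derivativeB; last exact: loop_weak_derivative_avg.
by apply: loop_weak_derivative_osc; rewrite avg_osc.
Qed.

Lemma J_derivative2 f : loop_weak_derivative 2 (J f) (osc f).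
Proof.
apply/(loop_weak_derivativeS _ (J_derivative1 f)).
by apply: loop_weak_derivative_osc; rewrite avg_osc.
Qed.

Lemma J_sobolev f : carrier (h1 R) (J f).
Proof.
move=> [|[|[|//]]] _; first by exists (J f); exact: loop_weak_derivative0.
  by exists (osc (VV (osc f))); exact: J_derivative1.
by exists (osc f); exact: J_derivative2.
Qed.

Lemma avg_derivative x y : loop_weak_derivative 1 x y -> avg y = 0.
Proof. by case/loop_weak_derivative1P. Qed.

Lemma derivative_zero x : loop_weak_derivative 1 x 0 -> x = avg x.
Proof. by case/loop_weak_derivative1P => _ [c ec ->]; rewrite linear0 add0r ec. Qed.

Lemma h1_derivatives x : carrier (h1 R) x ->
  loop_weak_derivative 1 x (D 1 x) /\ loop_weak_derivative 1 (D 1 x) (D 2 x).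
Proof.
move=> hx; split; first exact: sobolevP hx _.
exact: (DD (n := 1) (p := 1) hx).
Qed.

(** With this argument, [J] returns a loop with the second derivative and the mean of x. The first
    derivatives then differ by a constant of mean zero, hence agree, and so do the loops. *)
Lemma J_surjective x : carrier (h1 R) x -> x = J (D 2 x - avg x).
Proof.
move=> hx; have [d1 d2] := h1_derivatives hx.
set f := D 2 x - avg x.
have a2 := avg_derivative d2.
have af : avg f = - avg x by rewrite avgB a2 avgK sub0r.
have of_ : osc f = D 2 x by rewrite /osc af opprK /f subrK.
have w1 := loop_weak_derivativeB d1 (J_derivative1 f).
have w2 : loop_weak_derivative 1 (D 1 x - osc (VV (osc f))) 0.
  rewrite -(subrr (D 2 x)) -{2}of_; apply: loop_weak_derivativeB => //.
  by apply: loop_weak_derivative_osc; rewrite avg_osc.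
have e := derivative_zero w2; rewrite (avg_derivative w1) in e.
rewrite e in w1; have := derivative_zero w1.
by rewrite avgB J_avg af opprK subrr => /eqP; rewrite subr_eq0 => /eqP.
Qed.

Lemma J_injective f : J f = 0 -> f = 0.
Proof.
move=> J0; have := J_derivative2 f; rewrite J0 => /(loop_weak_derivative_uniq (loop_weak_derivative_zero R 2)) o0.
have := J_avg f; rewrite J0 linear0 => /eqP; rewrite eq_sym oppr_eq0 => /eqP a0.
have <- : osc f + avg f = f by rewrite /osc subrK.
by rewrite -o0 a0 addr0.
Qed.

Lemma finite_rank_avg : finite_rank (@avg R).
Proof.
have s1 : scalar (fun z : E => mean z.1) by move=> a x y; rewrite /= linearP.
have s2 : scalar (fun z : E => mean z.2) by move=> a x y; rewrite /= linearP.
pose l1 : {linear E -> R^o} := linear_pack s1.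
pose l2 : {linear E -> R^o} := linear_pack s2.
have := finite_rankD (finite_rank1 l1 ((one R, 0) : E)) (finite_rank1 l2 ((0, one R) : E)).
move=> [n [phi [psi h]]]; exists n, phi, psi => x; rewrite -h.
by apply: injective_projections; rewrite /= ?scaler0 ?addr0 ?add0r.
Qed.

(** Each [osc] is the identity minus [avg]; on expansion all terms but the first contain [avg],
    which has finite rank. *)
Lemma J_Volterra : exists2 F, finite_rank F & forall f, J f = VV (VV f) + F f.
Proof.
pose V := [the {linear E -> E} of @VV R]; pose O := [the {linear E -> E} of osc].
pose I := [the {linear E -> E} of @idfun E].
have fa (A B : {linear E -> E}) := finite_rank_comp A B finite_rank_avg.
exists (fun f => (-1) *: (V (V (avg (I f)))) + ((-1) *: (V (avg (V (O f)))) +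
   ((-1) *: (avg (V (O (V (O f))))) + (-1) *: avg f))).
  apply: finite_rankD; first exact: finite_rankZ (fa (V \o V) I).
  apply: finite_rankD; first exact: finite_rankZ (fa V (V \o O)).
  apply: finite_rankD; first exact: finite_rankZ (fa I (V \o (O \o (V \o O)))).
  exact: finite_rankZ finite_rank_avg.
move=> f; have e1 : VV (VV (osc f)) = VV (VV f) - VV (VV (avg f)).
  exact: (etrans (congr1 (@VV R) (VVB f (avg f))) (VVB _ _)).
have e2 : VV (osc (VV (osc f))) = VV (VV (osc f)) - VV (avg (VV (osc f))) := VVB _ _.
transitivity (VV (VV f) - VV (VV (avg f)) - VV (avg (VV (osc f))) - avg (VV (osc (VV (osc f)))) - avg f).
  by rewrite -e1 -e2.
rewrite [RHS]/=; set t1 := VV (VV (avg f)); set t2 := VV (avg _); set t3 := avg (VV _).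
by rewrite !scaleN1r -!addrA.
Qed.

Lemma loop_Volterra b : exists N : {linear E -> E},
  (forall u, N (u + b *: VV (VV u)) = u) /\ (forall f, N f + b *: VV (VV (N f)) = f).
Proof.
have [N [h1 h2]] := Volterra_bijective b.
have l : linear (fun z : E => (N z.1, N z.2) : E).
  by move=> a x y; apply: injective_projections; rewrite /= linearP.
exists (linear_pack l); split=> u.
  by apply: injective_projections; rewrite /= h1.
by apply: injective_projections; rewrite /= h2.
Qed.

Definition symmetric_on (T : E -> E) := forall x y, carrier (h1 R) x -> carrier (h1 R) y ->
  dot (T x) y = dot x (T y).

Lemma elliptic_decomposition (T F : E -> E) (c a : R) : c != 0 -> finite_rank F ->
  (forall x, carrier (h1 R) x -> T x = c *: D 2 x + a *: x + F x) -> symmetric_on T ->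
  exists m (e : {linear 'rV[R]_m -> E}),
  [/\ injective e, forall k, carrier (h1 R) (e k) /\ T (e k) = 0,
      forall x, carrier (h1 R) x -> T x = 0 -> exists k, x = e k &
      forall y, exists k, exists2 x, carrier (h1 R) x & T x = y - e k].
Proof.
move=> c0 frF TE sym.
have [F1 fr1 JE] := J_Volterra.
have [N [N1 N2]] := loop_Volterra (a / c).
have [M [N' [ME MN NM]]] := scaled_bijective c0 N1 N2.
(* T (J f) is c * osc f + a * J f + F (J f). The first summand here is the mean part of [osc], the
   second the finite rank part of [J]. *)
pose G f := (- c) *: avg f + (a *: F1 f + F (J f)).
have frG : finite_rank G.
  apply: finite_rankD; first exact/finite_rankZ/finite_rank_avg.
  apply: finite_rankD; first exact: finite_rankZ.
  exact: (finite_rank_comp [the {linear E -> E} of @idfun E] [the {linear E -> E} of J] frF).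
have SE f : T (J f) = M f + G f.
  rewrite ME (TE _ (J_sobolev f)) (DE (J_derivative2 f)) /= /G [in a *: J f]JE /osc.
  by rewrite scalerBr scalerDr scaleNr addrACA -!addrA; congr (_ + _); rewrite addrCA; congr (_ + _);
     rewrite addrCA.
have [m [e [p [th [mp einj kerE imE]]]]] := finite_rank_perturbation MN NM frG.
pose e' := [the {linear 'rV[R]_m -> E} of J \o e].
have e'inj : injective e'.
  move=> k l /= h; apply: einj; apply/eqP; rewrite -subr_eq0; apply/eqP; apply: J_injective.
  by rewrite linearB /= h subrr.
have ker k : T (e' k) = 0 by rewrite /= SE; apply/kerE; exists k.
exists m, e'; split=> //.
- by move=> k; split; [exact: J_sobolev|].
- move=> x hx Tx; have xE := J_surjective hx; rewrite xE SE in Tx.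
  by have [k ek] := (kerE _).1 Tx; exists k; rewrite /= -ek.
- have imT y : th y = 0 -> exists2 x, carrier (h1 R) x & T x = y.
    by move=> /imE[f fE]; exists (J f); [exact: J_sobolev|rewrite SE].
  (* [A] is the cokernel map restricted to the kernel of T. Whatever it kills lies in the image as
     well as in the kernel, hence is orthogonal to itself by symmetry. So [A] is injective and,
     being square, onto. *)
  pose A := lin1_mx (th \o e').
  have Afree : row_free A.
    rewrite -kermx_eq0; apply/eqP/row_matrixP => i; rewrite row0.
    set k := row i _; have kA : k *m A = 0 by rewrite -row_mul mulmx_ker row0.
    move: kA; rewrite mul_rV_lin1 => /imT[x hx Tx].
    apply: e'inj; rewrite linear0; apply: dot_eq0; rewrite -{1}Tx /= sym //; last exact: J_sobolev.
    by rewrite (ker k) dot0r.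
  have Afull : row_full A by rewrite /row_full (eqP Afree) mp.
  move=> y; have /submxP[k kE] : (th y <= A)%MS by exact: submx_full.
  exists k; have [|x hx Tx] := imT (y - e' k); last by exists x.
  by rewrite linearB /= kE mul_rV_lin1 subrr.
Qed.

(** Serves both pairs of spaces. For closedness, the kernel component of y is orthogonal to the
    image, so its norm is at most the L^2 distance from y to the image, hence at most the distance
    in Y; it vanishes for a limit of image points. *)
Lemma fredholm0 (X Y : normed_subspace E) (T : E -> E) m (e : {linear 'rV[R]_m -> E}) :
  bounded_op X Y T -> injective e ->
  (forall k, [/\ carrier X (e k), carrier Y (e k) & T (e k) = 0]) ->
  (forall x, carrier X x -> T x = 0 -> exists k, x = e k) ->
  (forall x k, carrier X x -> dot (T x) (e k) = 0) ->
  (forall y, carrier Y y -> exists k, exists2 x, carrier X x & T x = y - e k) ->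
  (forall y, carrier Y y -> L2norm y <= snorm Y y) ->
  (forall x y, carrier Y x -> carrier Y y -> carrier Y (x - y)) ->
  fredholm X Y T 0.
Proof.
move=> bT einj eK ker orth dec nY subY.
have [TY _ _] := bT.
have eE (k : 'rV[R]_m) : \sum_(i < m) k 0 i *: e (delta_mx 0 i) = e k.
  rewrite {2}[k]row_sum_delta linear_sum /=.
  by apply: eq_bigr => i _; rewrite linearZ.
split=> //.
  move=> y hy lim; have [k [x0 hx0 Tx0]] := dec y hy.
  suff k0 : e k = 0 by exists x0 => //; rewrite Tx0 k0 subr0.
  have ek z : carrier X z -> dot (e k) (e k) = dot (y - T z) (e k).
    move=> hz; rewrite dotBl (orth z k hz) subr0.
    by apply/eqP; rewrite eq_sym -subr_eq0 -dotBl -Tx0 orth.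
  have [->|n0] := eqVneq (e k) 0; first by [].
  have npos : 0 < L2norm (e k).
    rewrite lt_def L2norm_ge0 andbT; apply: contra n0 => /eqP/L2norm_eq0 ->; exact: eqxx.
  have [z hz zlt] := lim _ npos.
  have := le_trans (ler_norm _) (dot_le (y - T z) (e k)).
  rewrite -(ek z hz) -L2norm_sqr expr2 ler_pM2r // => le1.
  have le2 := nY _ (subY _ _ (TY _ hz) hy).
  have : L2norm (y - T z) = L2norm (T z - y).
    by rewrite -(opprB (T z) y) -[- (T z - y)]scaleN1r L2normZ normrN1 mul1r.
  by move=> e3; rewrite e3 in le1; have := le_lt_trans (le_trans le1 le2) zlt; rewrite ltxx.
exists m, m; split.
- exists (fun i => e (delta_mx 0 i)); split=> [i|x [hx Tx]].
    by have [? _ ?] := eK (delta_mx 0 i).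
  have [k xk] := ker x hx Tx; exists k; split=> /=; first by rewrite eE xk subrr.
  by move=> l /=; rewrite eE xk => /eqP; rewrite subr_eq0 => /eqP /einj.
- exists (fun i => e (delta_mx 0 i)); split=> [i|y hy].
    by have [] := eK (delta_mx 0 i).
  have [k [x hx Tx]] := dec y hy; exists k; split=> /=.
    by rewrite eE; exists x.
  (* Two choices differ by a kernel vector that lies in the image and is therefore orthogonal to
     itself. *)
  move=> l [x' hx' Tx']; rewrite eE in Tx'; apply: einj.
  apply/eqP; rewrite -subr_eq0 -linearB; apply/eqP/dot_eq0.
  set d := e (k - l); have dE : d = (y - e l) - (y - e k).
    by rewrite /d linearB opprB [RHS]addrC addrA subrK.
by rewrite {1}dE -Tx -Tx' dotBl /d !orth // subrr.
- by rewrite subrr.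
Qed.

End Fredholm.

(** * Lipschitz dependence on the base point *)

Section SobolevNorms.
Context (R : realType).
Implicit Types (x y z v w : loop R) (m n p : nat).

Lemma sobolev_normE m x :
  snorm (sobolev R m) x = Num.sqrt (\sum_(i < m.+1) dot (D i x) (D i x)).
Proof.
rewrite /=; congr Num.sqrt; rewrite -(big_mkord xpredT (fun i => dot (D i x) (D i x))).
rewrite [RHS]big_ltn // D0 L2norm_sqr; congr (_ + _).
by apply: eq_bigr => i _; rewrite L2norm_sqr.
Qed.

Lemma sobolev_norm_ge0 m x : 0 <= snorm (sobolev R m) x.
Proof. exact: sqrtr_ge0. Qed.

Lemma L2norm_D_le m n x : (n <= m)%N -> L2norm (D n x) <= snorm (sobolev R m) x.
Proof.
move=> nm; rewrite sobolev_normE ler_wsqrtr // (bigD1 (Ordinal (nm : n < m.+1)%N)) //=.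
by rewrite lerDl sumr_ge0 // => i _; exact: dot_ge0.
Qed.

Lemma L2norm_le m x : L2norm x <= snorm (sobolev R m) x.
Proof. by rewrite -{1}(D0 x); exact: L2norm_D_le. Qed.

Lemma sobolev_norm_le m n x : (n <= m)%N -> snorm (sobolev R n) x <= snorm (sobolev R m) x.
Proof.
move=> nm; rewrite !sobolev_normE ler_wsqrtr //.
rewrite -!(big_mkord xpredT (fun i => dot (D i x) (D i x))) [leRHS](big_cat_nat (n := n.+1)) //=.
by rewrite lerDl sumr_ge0 // => i _; exact: dot_ge0.
Qed.

Lemma sobolev_norm_D m n p x : carrier (sobolev R m) x -> (n + p <= m)%N ->
  snorm (sobolev R p) (D n x) <= snorm (sobolev R m) x.
Proof.
move=> hx le; apply: le_trans (sobolev_norm_le x le).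
rewrite !sobolev_normE ler_wsqrtr //.
rewrite -!(big_mkord xpredT (fun i => dot (D i _) (D i _))).
have n1 : (n <= (n + p).+1)%N by rewrite ltnW // ltnS leq_addr.
rewrite [leRHS](big_cat_nat (n := n)) //=.
have -> : \sum_(0 <= i < p.+1) dot (D i (D n x)) (D i (D n x)) = \sum_(n <= i < (n + p).+1) dot (D i x) (D i x).
  have e (G : nat -> R) : \sum_(n <= i < (n + p).+1) G i = \sum_(0 <= i < p.+1) G (i + n)%N.
    by rewrite -{1}[n]add0n big_addn -addnS addKn.
  rewrite e big_nat [RHS]big_nat; apply: eq_bigr => i /andP[_ ip].
  by rewrite (D_D hx) ?(addnC i) // (leq_trans _ le) // leq_add2l.
by rewrite lerDr sumr_ge0 // => i _; exact: dot_ge0.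
Qed.

Lemma sobolev0_norm x : snorm (sobolev R 0) x = L2norm x.
Proof. by rewrite sobolev_normE big_ord1 D0. Qed.

Section Triangle.
Variable m : nat.
Local Notation F := {ffun 'I_m.+1 -> loop R}.
Let q (f g : F) : R := \sum_i dot (f i) (g i).
Let qC f g : q f g = q g f.
Proof. by apply: eq_bigr => i _; rewrite dotC. Qed.
Let qD f g h : q (f + g) h = q f h + q g h.
Proof. by rewrite /q -big_split; apply: eq_bigr => i _; rewrite ffunE dotDl. Qed.
Let qZ a f g : q (a *: f) g = a * q f g.
Proof. by rewrite /q big_distrr; apply: eq_bigr => i _; rewrite ffunE dotZl. Qed.
Let q0 f : 0 <= q f f.
Proof. by apply: sumr_ge0 => i _; exact: dot_ge0. Qed.
(** The Sobolev norm is the Euclidean norm of the jet. The jet is linear on [sobolev R m] only,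
    since [D] takes the default value 0 where a derivative is missing. *)
Let jet x : F := [ffun i : 'I_m.+1 => D i x].
Let normE x : snorm (sobolev R m) x = Num.sqrt (q (jet x) (jet x)).
Proof. by rewrite sobolev_normE; congr Num.sqrt; apply: eq_bigr => i _; rewrite ffunE. Qed.
Let jetP a x y : carrier (sobolev R m) x -> carrier (sobolev R m) y -> jet (a *: x + y) = a *: jet x + jet y.
Proof. by move=> hx hy; apply/ffunP => i; rewrite !ffunE (D_linear _ hx hy) // -ltnS. Qed.

Lemma sobolev_triangle x y : carrier (sobolev R m) x -> carrier (sobolev R m) y ->
  snorm (sobolev R m) (x + y) <= snorm (sobolev R m) x + snorm (sobolev R m) y.
Proof.
move=> hx hy; rewrite !normE; have := jetP 1 hx hy; rewrite !scale1r => ->.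
exact: form_triangle qC qD qZ q0 _ _.
Qed.

Lemma sobolev_normZ a x : carrier (sobolev R m) x ->
  snorm (sobolev R m) (a *: x) = `|a| * snorm (sobolev R m) x.
Proof.
move=> hx; rewrite !normE; have := jetP a hx (@sobolev0 R m).
have -> : jet 0 = 0 by apply/ffunP => i; rewrite !ffunE; apply: DE; exact: loop_weak_derivative_zero.
by rewrite !addr0 => ->; exact: form_sqrtZ qC qZ _ _.
Qed.
End Triangle.

Definition normed (Y : normed_subspace (loop R)) : Prop :=
  [/\ forall a x y, carrier Y x -> carrier Y y -> carrier Y (a *: x + y), carrier Y 0,
      forall x y, carrier Y x -> carrier Y y -> snorm Y (x + y) <= snorm Y x + snorm Y y,
      forall a x, carrier Y x -> snorm Y (a *: x) = `|a| * snorm Y x &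
      forall x, 0 <= snorm Y x].

Lemma sobolev_normed m : normed (sobolev R m).
Proof.
split; [exact: sobolev_linear|exact: sobolev0|exact: sobolev_triangle|exact: sobolev_normZ|].
exact: sobolev_norm_ge0.
Qed.

Lemma h0_normed : normed (h0 R).
Proof.
split=> //; [by move=> x y _ _; exact: L2norm_triangle|by move=> a x _; exact: L2normZ|].
exact: L2norm_ge0.
Qed.

Lemma normedD Y x y : normed Y -> carrier Y x -> carrier Y y -> carrier Y (x + y).
Proof. by move=> [h _ _ _ _] hx hy; have := h 1 x y hx hy; rewrite scale1r. Qed.

Lemma normedZ Y a x : normed Y -> carrier Y x -> carrier Y (a *: x).
Proof. by move=> [h h0 _ _ _] hx; have := h a x 0 hx h0; rewrite addr0. Qed.

Lemma normedB Y x y : normed Y -> carrier Y x -> carrier Y y -> carrier Y (x - y).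
Proof. by move=> nY hx hy; rewrite -scaleN1r; apply: normedD => //; exact: normedZ. Qed.

Lemma normed_distC Y x y : normed Y -> carrier Y x -> carrier Y y -> snorm Y (x - y) = snorm Y (y - x).
Proof.
move=> nY hx hy; have [_ _ _ nZ _] := nY.
by rewrite -(opprB y x) -[- (y - x)]scaleN1r nZ ?normrN1 ?mul1r //; exact: normedB.
Qed.

Lemma normed_triangle Y x y z : normed Y -> carrier Y x -> carrier Y y -> carrier Y z ->
  snorm Y (x - z) <= snorm Y (x - y) + snorm Y (y - z).
Proof.
move=> nY hx hy hz; have [_ _ tr _ _] := nY.
by have := tr (x - y) (y - z) (normedB nY hx hy) (normedB nY hy hz); rewrite addrA subrK.
Qed.

End SobolevNorms.

Section LipschitzFields.
Context (R : realType).
Local Notation E := (loop R).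
Variables (N : set E) (delta : E -> E -> R).
Hypothesis delta_ge0 : forall v w, N v -> N w -> 0 <= delta v w.
Implicit Types (X Y : normed_subspace E) (a b : E -> R) (p q : E -> E) (A B : E -> E -> E).

(** Boundedness and the Lipschitz estimate come together, as products need both. [N] and [delta]
    will be a ball of base points and their Sobolev distance. *)
Definition lip_scalar a := exists2 k, 0 <= k &
  forall v w, N v -> N w -> `|a v| <= k /\ `|a v - a w| <= k * delta v w.

Definition lip_vector Y p := exists2 k, 0 <= k &
  forall v w, N v -> N w -> [/\ carrier Y (p v), snorm Y (p v) <= k & snorm Y (p v - p w) <= k * delta v w].

Definition lip_field X Y A := exists2 k, 0 <= k &
  forall v w x, N v -> N w -> carrier X x ->
    [/\ carrier Y (A v x), snorm Y (A v x) <= k * snorm X x &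
        snorm Y (A v x - A w x) <= k * delta v w * snorm X x].

Lemma lip_scalar_cst c : lip_scalar (fun=> c).
Proof.
exists `|c| => // v w hv hw; split=> //.
by rewrite subrr normr0 mulr_ge0 // delta_ge0.
Qed.

Lemma lip_scalarD a b : lip_scalar a -> lip_scalar b -> lip_scalar (fun v => a v + b v).
Proof.
move=> [k k0 ha] [l l0 hb]; exists (k + l); first exact: addr_ge0.
move=> v w hv hw; have [a1 a2] := ha v w hv hw; have [b1 b2] := hb v w hv hw; split.
  exact: le_trans (ler_normD _ _) (lerD a1 b1).
by rewrite opprD addrACA mulrDl; exact: le_trans (ler_normD _ _) (lerD a2 b2).
Qed.

Lemma lip_scalarM a b : lip_scalar a -> lip_scalar b -> lip_scalar (fun v => a v * b v).
Proof.
move=> [k k0 ha] [l l0 hb]; exists (k * l + k * l); first by rewrite addr_ge0 // mulr_ge0.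
move=> v w hv hw; have [a1 a2] := ha v w hv hw; have [b1 b2] := hb v w hv hw.
have [b3 _] := hb w v hw hv.
split; first by rewrite normrM (le_trans (ler_pM _ _ a1 b1)) // lerDl mulr_ge0.
have -> : a v * b v - a w * b w = a v * (b v - b w) + (a v - a w) * b w by ring.
apply: le_trans (ler_normD _ _) _; rewrite !normrM mulrDl lerD //.
  by rewrite -mulrA ler_pM.
by rewrite mulrAC ler_pM.
Qed.

Lemma lip_scalarV a e : 0 < e -> (forall v, N v -> e <= a v) -> lip_scalar a ->
  lip_scalar (fun v => (a v)^-1).
Proof.
move=> e0 ea [k k0 ha]; exists (e^-1 + k / e ^+ 2).
  by rewrite addr_ge0 ?invr_ge0 ?divr_ge0 ?exprn_ge0 // ltW.
move=> v w hv hw; have [a1 a2] := ha v w hv hw.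
have av : 0 < a v := lt_le_trans e0 (ea v hv); have aw : 0 < a w := lt_le_trans e0 (ea w hw).
split.
  have i : (a v)^-1 <= e^-1 by rewrite lef_pV2 ?posrE // ea.
  by rewrite normfV gtr0_norm // (le_trans i) // lerDl divr_ge0 // exprn_ge0 // ltW.
have -> : (a v)^-1 - (a w)^-1 = (a w - a v) / (a v * a w) by field; rewrite !gt_eqF.
rewrite normrM distrC normfV (gtr0_norm (mulr_gt0 av aw)).
apply: (@le_trans _ _ (k * delta v w / (e ^+ 2))).
  apply: ler_pM => //; first by rewrite invr_ge0 mulr_ge0 // ltW.
  by rewrite lef_pV2 ?posrE ?exprn_gt0 ?mulr_gt0 // expr2; apply: ler_pM; rewrite ?(ltW e0) //; exact: ea.
by rewrite mulrDl mulrAC lerDr mulr_ge0 ?delta_ge0 // invr_ge0 ltW.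
Qed.

Lemma lip_scalar_dot p q : lip_vector (h0 R) p -> lip_vector (h0 R) q ->
  lip_scalar (fun v => dot (p v) (q v)).
Proof.
move=> [k k0 hp] [l l0 hq]; exists (k * l + k * l); first by rewrite addr_ge0 // mulr_ge0.
move=> v w hv hw; have [_ p1 p2] := hp v w hv hw; have [_ q1 q2] := hq v w hv hw.
have [_ q3 _] := hq w v hw hv.
split; first by rewrite (le_trans (dot_le _ _)) // (le_trans (ler_pM _ _ p1 q1)) ?L2norm_ge0 // lerDl mulr_ge0.
have -> : dot (p v) (q v) - dot (p w) (q w) = dot (p v) (q v - q w) + dot (p v - p w) (q w).
  by rewrite dotBr dotBl addrA subrK.
apply: le_trans (ler_normD _ _) _; rewrite mulrDl lerD // (le_trans (dot_le _ _)) //.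
  by rewrite -mulrA ler_pM ?L2norm_ge0.
by rewrite mulrAC ler_pM ?L2norm_ge0.
Qed.

Lemma lip_vectorZ Y a p : normed Y -> lip_scalar a -> lip_vector Y p -> lip_vector Y (fun v => a v *: p v).
Proof.
move=> nY [k k0 ha] [l l0 hp]; have [_ _ tr nZ n0] := nY.
exists (k * l + k * l); first by rewrite addr_ge0 // mulr_ge0.
move=> v w hv hw; have [a1 a2] := ha v w hv hw; have [p0 p1 p2] := hp v w hv hw.
have [q0 p3 _] := hp w v hw hv.
split; first exact: normedZ.
  by rewrite nZ // (le_trans (ler_pM _ _ a1 p1)) // lerDl mulr_ge0.
have -> : a v *: p v - a w *: p w = a v *: (p v - p w) + (a v - a w) *: p w.
  by rewrite scalerBr scalerBl addrA subrK.
have cB := normedB nY p0 q0.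
apply: le_trans (tr _ _ (normedZ _ nY cB) (normedZ _ nY q0)) _; rewrite !nZ // mulrDl lerD //.
  by rewrite -mulrA ler_pM.
by rewrite mulrAC ler_pM.
Qed.

Lemma lip_fieldD X Y A B : normed Y -> lip_field X Y A -> lip_field X Y B ->
  lip_field X Y (fun v x => A v x + B v x).
Proof.
move=> nY [k k0 hA] [l l0 hB]; have [_ _ tr nZ n0] := nY.
exists (k + l); first exact: addr_ge0.
move=> v w x hv hw hx; have [a0 a1 a2] := hA v w x hv hw hx; have [b0 b1 b2] := hB v w x hv hw hx.
have [a3 _ _] := hA w v x hw hv hx; have [b3 _ _] := hB w v x hw hv hx.
split; first exact: normedD.
  by rewrite mulrDl (le_trans (tr _ _ a0 b0)) // lerD.
have -> : A v x + B v x - (A w x + B w x) = (A v x - A w x) + (B v x - B w x) by rewrite opprD addrACA.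
by rewrite !mulrDl (le_trans (tr _ _ (normedB nY a0 a3) (normedB nY b0 b3))) // lerD.
Qed.

Lemma lip_field_scalar X Y a (L : E -> E) c : normed Y -> lip_scalar a -> 0 <= c ->
  (forall x, carrier X x -> carrier Y (L x) /\ snorm Y (L x) <= c * snorm X x) ->
  lip_field X Y (fun v x => a v *: L x).
Proof.
move=> nY [k k0 ha] c0 hL; have [_ _ tr nZ n0] := nY.
exists (k * c); first exact: mulr_ge0.
move=> v w x hv hw hx; have [a1 a2] := ha v w hv hw; have [L1 L2] := hL x hx.
split; first exact: normedZ.
  by rewrite nZ // -mulrA ler_pM.
have -> : k * c * delta v w * snorm X x = k * delta v w * (c * snorm X x) by ring.
by rewrite -scalerBl nZ // ler_pM.
Qed.

(** The argument x enters only through an L^2 pairing, so X may be L^2 or any integer or fractional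
    Sobolev space. *)
Lemma lip_field_rank1 X Y p q : normed Y -> (forall x, carrier X x -> L2norm x <= snorm X x) ->
  lip_vector (h0 R) p -> lip_vector Y q -> lip_field X Y (fun v x => dot (p v) x *: q v).
Proof.
move=> nY hX [k k0 hp] [l l0 hq]; have [_ _ tr nZ n0] := nY.
exists (k * l + k * l); first by rewrite addr_ge0 // mulr_ge0.
move=> v w x hv hw hx; have [_ p1 p2] := hp v w hv hw; have [q0 q1 q2] := hq v w hv hw.
have [q3 q4 _] := hq w v hw hv.
have X0 : 0 <= snorm X x := le_trans (L2norm_ge0 x) (hX x hx).
have B u c : L2norm u <= c -> `|dot u x| <= c * snorm X x.
  move=> uc; apply: le_trans (dot_le _ _) _; apply: ler_pM; rewrite ?L2norm_ge0 //; exact: hX.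
split; first exact: normedZ.
  rewrite nZ // mulrDl; apply: (@le_trans _ _ (k * l * snorm X x)).
    by rewrite mulrAC ler_pM // B.
  by rewrite lerDl mulr_ge0 // mulr_ge0.
have -> : dot (p v) x *: q v - dot (p w) x *: q w =
    dot (p v) x *: (q v - q w) + dot (p v - p w) x *: q w.
  by rewrite scalerBr dotBl scalerBl addrA subrK.
have cB := normedB nY q0 q3.
apply: le_trans (tr _ _ (normedZ _ nY cB) (normedZ _ nY q3)) _.
rewrite !nZ // !mulrDl lerD //.
  have -> : k * l * delta v w * snorm X x = k * snorm X x * (l * delta v w) by ring.
  by rewrite ler_pM // B.
have -> : k * l * delta v w * snorm X x = k * delta v w * snorm X x * l by ring.
by rewrite ler_pM // B.
Qed.

Lemma lip_D m n r : N `<=` carrier (sobolev R m) -> (n + r <= m)%N ->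
  (exists k, forall v, N v -> snorm (sobolev R m) v <= k) ->
  (forall v w, N v -> N w -> snorm (sobolev R m) (v - w) <= delta v w) ->
  lip_vector (sobolev R r) (D n).
Proof.
move=> Nm le [k hk] hd.
exists (`|k| + 1); first by rewrite addr_ge0.
move=> v w hv hw; have mv := Nm v hv; have mw := Nm w hw.
have nm : (n <= m)%N by apply: leq_trans le; exact: leq_addr.
split.
- apply: (@sobolev_D R r n v); exact: sobolev_le le mv.
- apply: le_trans (sobolev_norm_D mv le) (le_trans (hk v hv) _).
  by rewrite (le_trans (ler_norm _)) // lerDl.
- have -> : D n v - D n w = D n (v - w).
    have := D_linear (-1) mw mv nm; rewrite !scaleN1r => e.
    by rewrite addrC -e addrC.
  apply: le_trans (sobolev_norm_D (sobolevB mv mw) le) (le_trans (hd v w hv hw) _).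
  by rewrite mulrDl mul1r lerDr mulr_ge0 // delta_ge0.
Qed.

Lemma lip_h0 p : lip_vector (sobolev R 0) p -> lip_vector (h0 R) p.
Proof.
by move=> [k k0 h]; exists k => // v w hv hw; have [_] := h v w hv hw; rewrite !sobolev0_norm.
Qed.

End LipschitzFields.

(** * Openness of the set of admissible loops *)

Section SobolevEmbedding.
Context (R : realType).
Local Notation mu := (circle_measure R).
Implicit Types (u v w : L2 R) (t s : R) (z h : loop R).

Lemma periodic_floor (T : Type) (g : R -> T) t : (forall x, g (x + 1) = g x) ->
  g t = g (t - (Num.floor t)%:~R).
Proof.
move=> per.
have N (n : nat) x : g (x + n%:R) = g x.
  elim: n => [|n IH]; first by rewrite addr0.
  by rewrite -[n.+1%:R]natr1 addrA per IH.
have Zp (k : int) x : g (x + k%:~R) = g x.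
  case: k => n; first exact: N.
  rewrite NegzE intrN; have := N n.+1 (x - n.+1%:R); rewrite subrK => e; exact: esym e.
by rewrite -intrN Zp.
Qed.

Lemma frac_itv t : 0 <= t - (Num.floor t)%:~R < 1.
Proof.
have := real_floor_itv (num_real t); rewrite intrD => /andP[a b].
by apply/andP; split; lra.
Qed.

(** If w has mean zero, [prim w] vanishes at both 0 and 1, so that this periodic extension has no
    jump at the integers. *)
Definition periodized w t : R := prim w (t - (Num.floor t)%:~R).

Lemma periodized_per w t : periodized w (t + 1) = periodized w t.
Proof.
rewrite /periodized; have -> : Num.floor (t + 1) = Num.floor t + 1.
  apply: floor_def; have := floor_itv t; rewrite !intrD => /andP[a b].
  by apply/andP; split; lra.
by rewrite intrD opprD addrACA subrr addr0.
Qed.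

(** The factor 2 is for s and t in different periods: the increment is split at integers, where the
    function vanishes, into two pieces of length at most t - s. *)
Lemma periodized_holder w s t : mean w = 0 -> s <= t ->
  `|periodized w t - periodized w s| <= 2 * nrm w * Num.sqrt (t - s).
Proof.
move=> m0 st; rewrite /periodized.
have := real_floor_itv (num_real t); have := real_floor_itv (num_real s).
rewrite !intrD => /andP[s1 s2] /andP[t1 t2].
have n0 := nrm_ge0 w; have q0 := sqrtr_ge0 (t - s).
have H a b : `|a - b| <= t - s -> `|prim w a - prim w b| <= nrm w * Num.sqrt (t - s).
  by move=> ab; apply: le_trans (prim_holder _ _ _) _; rewrite ler_wpM2l // ler_wsqrtr.
have [e|ne] := eqVneq (Num.floor t) (Num.floor s).
  rewrite e; apply: le_trans (H _ _ _) _.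
    by rewrite opprD addrACA subrr addr0 ger0_norm // subr_ge0.
  by rewrite ler_wpM2r //; lra.
have lt : Num.floor s + 1 <= Num.floor t.
  by rewrite lezD1 lt_def ne le_floor.
have {}lt : (Num.floor s)%:~R + 1 <= (Num.floor t)%:~R :> R.
  by have : (Num.floor s + 1)%:~R <= (Num.floor t)%:~R :> R by [rewrite ler_int]; rewrite intrD.
have h1 : `|prim w (t - (Num.floor t)%:~R) - prim w 0| <= nrm w * Num.sqrt (t - s).
  by apply: H; rewrite subr0 ger0_norm; lra.
have h2 : `|prim w 1 - prim w (s - (Num.floor s)%:~R)| <= nrm w * Num.sqrt (t - s).
  by apply: H; rewrite ger0_norm; lra.
have -> : prim w (t - (Num.floor t)%:~R) - prim w (s - (Num.floor s)%:~R) =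
  (prim w (t - (Num.floor t)%:~R) - prim w 0) + (prim w 1 - prim w (s - (Num.floor s)%:~R)).
  have z0 : prim w 0 = 0 by exact: prim_le0.
  have z1 : prim w 1 = 0 by rewrite prim_mean.
  by rewrite z0 z1 subr0 sub0r.
by rewrite -mulrA [2 * _]mulr_natl mulr2n; exact: le_trans (ler_normD _ _) (lerD h1 h2).
Qed.

Lemma periodized_continuous w : mean w = 0 -> continuous (periodized w).
Proof.
move=> m0 t; apply/cvgrPdist_le => e e0.
have n0 : 0 < 2 * nrm w + 1 by rewrite ltr_wpDl // mulr_ge0 // nrm_ge0.
have d0 : 0 < (e / (2 * nrm w + 1)) ^+ 2 by rewrite exprn_gt0 // divr_gt0.
exists ((e / (2 * nrm w + 1)) ^+ 2) => //= s; rewrite /ball /= => ts.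
have B : `|periodized w t - periodized w s| <= 2 * nrm w * Num.sqrt `|t - s|.
  have [st|/ltW ts'] := leP s t.
    by rewrite [X in Num.sqrt X]ger0_norm ?subr_ge0 //; exact: periodized_holder.
  by rewrite distrC [`|t - s|]distrC [X in Num.sqrt X]ger0_norm ?subr_ge0 //; exact: periodized_holder.
apply: le_trans B _.
have e1 : 0 <= e / (2 * nrm w + 1) by rewrite divr_ge0 // ltW.
have h : Num.sqrt `|t - s| <= e / (2 * nrm w + 1).
  by rewrite -[leRHS](ger0_norm e1) -[leRHS]sqrtr_sqr ler_wsqrtr // ltW.
apply: (@le_trans _ _ ((2 * nrm w + 1) * (e / (2 * nrm w + 1)))).
  by apply: ler_pM; rewrite ?mulr_ge0 ?nrm_ge0 ?sqrtr_ge0 // lerDl.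
by rewrite mulrC divfK // gt_eqF.
Qed.

Lemma nrm_one : nrm (one R) = 1.
Proof. by rewrite /nrm -/(mean _) mean_one sqrtr1. Qed.

(** The representative is the primitive of w plus c = mean u - mean (V w). In the bound, the mean of
    V w is - <w, V 1> as w has mean zero, and the primitive is at most [nrm w]. *)
Lemma continuous_representative u w : weak_derivative 1 u w ->
  exists g : R -> R, [/\ continuous g, forall t, g (t + 1) = g t,
    (L2_repr u : R -> R) = g %[ae mu] &
    forall t, `|g t| <= nrm u + (nrm (V (one R)) + 1) * nrm w].
Proof.
move=> /weak_derivative1P[m0 [c ec]]; exists (fun t => periodized w t + c); split.
- by move=> t; apply: cvgD; [exact: periodized_continuous|exact: cvg_cst].
- by move=> t; rewrite periodized_per.
- have -> : u = mkL2 (fun t => prim w t + c * 1).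
    by rewrite mkL2D ?mkL2Z //; [exact: sq_cst|exact: sq_prim|apply: sqZ; exact: sq_cst].
  apply: ae_eq_trans (mkL2K _) _.
    by apply: sqD; [exact: sq_prim|apply: sqZ; exact: sq_cst].
  apply: ae_eq_circle => t /andP[t0]; rewrite mulr1 le_eqVlt => /predU1P[->|t1].
    have z0 : prim w 0 = 0 by exact: prim_le0.
    have z1 : prim w 1 = 0 by rewrite prim_mean.
    by rewrite /periodized floor1 subrr z0 z1.
  rewrite /periodized (_ : Num.floor t = 0) ?subr0 //.
  by apply/eqP; rewrite floor_eq; apply/andP; split; rewrite ?add0r.
- move=> t; have mc : c = mean u - mean (V w).
    have e : mean u = mean (V w) + c 
      by rewrite ec /mean ipDl ipZl; congr (_ + _); rewrite -[RHS]mulr1; congr (_ * _); exact: mean_one.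
    by rewrite e [mean _ + c]addrC addrK.
  have b1 : `|mean u| <= nrm u by rewrite -[leRHS]mulr1 -nrm_one; exact: ip_le.
  have b2 : `|mean (V w)| <= nrm w * nrm (V (one R)).
    have := ip_V w (one R); rewrite m0 mul0r => /eqP; rewrite addr_eq0 => /eqP E.
    by rewrite /mean E normrN; exact: ip_le.
  have b3 : `|periodized w t| <= nrm w by exact: prim_bound.
  rewrite mc addrC mulrDl mul1r [nrm (V _) * _]mulrC addrA.
  apply: le_trans (ler_normD _ _) _; apply: lerD b3.
  exact: le_trans (ler_normB _ _) (lerD b1 b2).
Qed.

Lemma nrm_component1 z : nrm z.1 <= L2norm z.
Proof. by rewrite ler_wsqrtr // dotE lerDl ip_ge0. Qed.

Lemma nrm_component2 z : nrm z.2 <= L2norm z.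
Proof. by rewrite ler_wsqrtr // dotE lerDr ip_ge0. Qed.

(** The sum of the coefficients of [nrm u] and [nrm w] in [continuous_representative]. *)
Definition embedding_constant : R := nrm (V (one R)) + 2.

Lemma loop_representative h : carrier (h1 R) h -> exists g : R -> R * R,
  [/\ continuous g, forall t, g (t + 1) = g t,
      (L2_repr h.1 : R -> R) = fst \o g %[ae mu], (L2_repr h.2 : R -> R) = snd \o g %[ae mu] &
      forall t, `|(g t).1| <= embedding_constant * snorm (h1 R) h /\
                `|(g t).2| <= embedding_constant * snorm (h1 R) h].
Proof.
move=> hh; have [[d1 d2] _] := h1_derivatives hh.
have [g1 [c1 p1 e1 b1]] := continuous_representative d1.
have [g2 [c2 p2 e2 b2]] := continuous_representative d2.
exists (fun t => (g1 t, g2 t)); split=> //.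
- by move=> t; exact: (cvg_pair (c1 t) (c2 t)).
- by move=> t; rewrite p1 p2.
have B (k : nat) : (k <= 2)%N -> nrm (D k h).1 <= snorm (h1 R) h /\ nrm (D k h).2 <= snorm (h1 R) h.
  move=> k2; have l := L2norm_D_le h k2; split; apply: le_trans l.
    exact: nrm_component1.
  exact: nrm_component2.
have [m1 m2] := B 0%N isT; have [n1 n2] := B 1%N isT; rewrite D0 in m1 m2.
have k0 := nrm_ge0 (V (one R)).
have key a b x : a <= snorm (h1 R) h -> b <= snorm (h1 R) h -> x <= a + (nrm (V (one R)) + 1) * b ->
    x <= embedding_constant * snorm (h1 R) h.
  move=> ha hb /le_trans; apply; rewrite /embedding_constant.
  have -> : (nrm (V (one R)) + 2) * snorm (h1 R) h =
    snorm (h1 R) h + (nrm (V (one R)) + 1) * snorm (h1 R) h by ring.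
  by rewrite lerD // ler_wpM2l // addr_ge0.
by move=> t; split; [exact: key m1 n1 (b1 t)|exact: key m2 n2 (b2 t)].
Qed.

(** A compact curve in an open set keeps a positive distance from the complement; compactness of
    [0, 1] makes the local radii uniform and periodicity moves t into [0, 1]. *)
Lemma loop_in_margin (Z : set (R * R)) (g : R -> R * R) : open Z -> continuous g ->
  (forall t, g (t + 1) = g t) -> (forall t, Z (g t)) ->
  exists2 e : R, 0 < e & forall t p, ball (g t) e p -> Z p.
Proof.
move=> oZ cg pg Zg.
have nc : near_covering `[0 : R, 1] by apply/compact_near_coveringP; exact: segment_compact.
pose P (e : R) (t : R) := forall p, ball (g t) e p -> Z p.
have : \forall e \near (0 : R)^'+, `[0, 1]%classic `<=` P e.
  apply: nc => t _.
  have /nbhs_ballP[e0 /= e0gt ball_Z] : nbhs (g t) Z by apply: open_nbhs_nbhs; split.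
  have e2 : 0 < e0 / 2 by rewrite divr_gt0.
  have near_t : \forall t' \near t, ball (g t) (e0 / 2) (g t').
    by apply: cg; apply/nbhs_ballP; exists (e0 / 2).
  have near_e : \forall e \near (0 : R)^'+, e <= e0 / 2 by exact: nbhs_right_le.
  exists ([set t' | ball (g t) (e0 / 2) (g t')], [set e | e <= e0 / 2]) => //.
  move=> [t' e] [/= bt be] p bp; apply: ball_Z; rewrite (splitr e0).
  exact: ball_triangle bt (le_ball be bp).
move=> H; have : \forall e \near (0 : R)^'+, 0 < e /\ (`[0, 1]%classic `<=` P e).
  by near=> e; split; [near: e; exact: nbhs_right_gt|near: e].
move=> /filter_ex[e [e0 Pe]]; exists e => // t; rewrite (periodic_floor t pg); apply: Pe.
by rewrite /= in_itv /=; have /andP[-> /ltW ->] := frac_itv t.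
Unshelve. all: by end_near. Qed.

Lemma u1_open (Z : set (R * R)) : open Z -> open_in (h1 R) (u1 Z).
Proof.
move=> oZ; split=> [u []//|u [hu u0 [g [cg pg g1 g2 Zg]]]].
have [e e0 eZ] := loop_in_margin oZ cg pg Zg.
have K0 : 0 < embedding_constant by rewrite ltr_wpDl // nrm_ge0.
have nu : 0 < snorm (h1 R) u.
  apply: lt_le_trans (L2norm_le 2 u); rewrite lt_def L2norm_ge0 andbT.
  by apply: contra_notN u0 => /eqP/L2norm_eq0.
(* The first radius excludes v = 0, the second keeps the continuous representative of v within the
   margin e. *)
exists (Num.min (snorm (h1 R) u) (e / embedding_constant)).
  by rewrite lt_min nu divr_gt0.
move=> v hv; rewrite lt_min => /andP[d1 d2].
split=> //.
  move=> v0; move: d1; rewrite v0 (normed_distC (sobolev_normed R 2)) // ?subr0 ?ltxx //.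
  exact: sobolev0.
have hh : carrier (h1 R) (v - u) by exact: sobolevB.
have [k [ck pk k1 k2 kb]] := loop_representative hh.
have kK : embedding_constant * snorm (h1 R) (v - u) < e by rewrite mulrC -ltr_pdivlMr.
have vE : v = u + (v - u) by rewrite addrC subrK.
exists (fun t => ((g t).1 + (k t).1, (g t).2 + (k t).2)); split.
- have comp (f : R -> R * R) : continuous f -> continuous (fst \o f) /\ continuous (snd \o f).
    by move=> cf; split=> t; apply: cvg_comp (cf t) _; [exact: cvg_fst|exact: cvg_snd].
  have [g1c g2c] := comp _ cg; have [k1c k2c] := comp _ ck.
  by move=> t; exact: (cvg_pair (cvgD (g1c t) (k1c t)) (cvgD (g2c t) (k2c t))).
- by move=> t; rewrite pg pk.
- have := L2_reprD u.1 (v - u).1; rewrite (_ : u.1 + (v - u).1 = v.1); last by rewrite {2}vE.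
  move=> E; apply: ae_eq_trans E _.
  by apply: (@filterS2 _ _ (ae_filter_ringOfSetsType _) _ _ _ _ g1 k1) => t /= a b _; rewrite a // b.
- have := L2_reprD u.2 (v - u).2; rewrite (_ : u.2 + (v - u).2 = v.2); last by rewrite {2}vE.
  move=> E; apply: ae_eq_trans E _.
  by apply: (@filterS2 _ _ (ae_filter_ringOfSetsType _) _ _ _ _ g2 k2) => t /= a b _; rewrite a // b.
- move=> t; apply: (eZ t); have [b1 b2] := kb t; split; rewrite /ball /= opprD addrA subrr sub0r normrN.
    exact: le_lt_trans b1 kK.
  exact: le_lt_trans b2 kK.
Qed.

End SobolevEmbedding.

(** * Operator norms, continuous fields and uniqueness of derivatives *)

Section Operators.
Context (R : realType).
Local Notation E := (loop R).
Implicit Types (X Y H : normed_subspace E) (T : E -> E) (U N : set E) (A B : E -> E -> E).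

Lemma opnorm_le X Y T k : 0 <= k -> (forall x, carrier X x -> 0 <= snorm X x) ->
  (forall x, carrier X x -> snorm Y (T x) <= k * snorm X x) -> opnorm X Y T <= k.
Proof.
move=> k0 X0 hT; rewrite /opnorm; set S := (X in sup X).
have ub : ubound S k.
  move=> _ [x [hx x1] <-]; apply: le_trans (hT x hx) _.
  by rewrite -[leRHS]mulr1 ler_wpM2l.
(* The supremum of the empty set is 0 by convention, which [k0] covers. *)
have [->|/set0P S0] := eqVneq S set0; first by rewrite sup0.
exact: ge_sup.
Qed.

Lemma lip_field_ext N N' delta X Y A B : (forall v, N' v -> N v) ->
  (forall v x, N' v -> carrier X x -> A v x = B v x) ->
  lip_field N delta X Y A -> lip_field N' delta X Y B.
Proof.
move=> sub e [k k0 h]; exists k => // v w x hv hw hx.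
by rewrite -!e //; exact: h (sub _ hv) (sub _ hw) hx.
Qed.

Lemma lip_field_continuous H U X Y A : (forall u, U u -> snorm H (u - u) = 0) ->
  (forall v w, U v -> U w -> 0 <= snorm H (v - w)) ->
  (forall x, carrier X x -> 0 <= snorm X x) ->
  (forall u, U u -> linear_on X (A u)) ->
  (forall u, U u -> exists2 d, 0 < d &
     lip_field [set v | U v /\ snorm H (v - u) < d] (fun v w => snorm H (v - w)) X Y A) ->
  continuous_field H U X Y A.
Proof.
move=> H0 Hge X0 lin lip.
have self u d : 0 < d -> U u -> [set v | U v /\ snorm H (v - u) < d] u by split; rewrite ?H0.
split=> u hu.
  have [d d0 [k k0 h]] := lip u hu; split; last 1 first.
  - by exists k => x hx; have [_ + _] := h u u x (self u d d0 hu) (self u d d0 hu) hx.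
  - by move=> x hx; have [+ _ _] := h u u x (self u d d0 hu) (self u d d0 hu) hx.
  - exact: lin.
move=> e e0; have [d d0 [k k0 h]] := lip u hu.
have e2 : 0 < e / 2 by rewrite divr_gt0.
have k1 : 0 < k + 1 by rewrite ltr_wpDl.
exists (Num.min d (e / 2 / (k + 1))); first by rewrite lt_min d0 divr_gt0.
move=> v hv; rewrite lt_min => /andP[vd ve].
apply: (@le_lt_trans _ _ (e / 2)); last by rewrite ltr_pdivrMr // mulr_natr mulr2n ltrDl.
apply: opnorm_le => //; first exact: ltW.
move=> x hx; have [_ _ h3] := h v u x (conj hv vd) (self u d d0 hu) hx.
apply: le_trans h3 _; rewrite ler_wpM2r ?X0 //.
apply: (@le_trans _ _ ((k + 1) * (e / 2 / (k + 1)))).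
  by apply: ler_pM => //; [exact: Hge|rewrite lerDl|exact: ltW].
by rewrite mulrC divfK // gt_eqF.
Qed.

Lemma linear_on0 T : linear_on (h1 R) T -> T 0 = 0.
Proof.
move=> lin; have c0 := @sobolev0 R 2.
have := lin 1 0 0 c0 c0; rewrite !scale1r addr0 => e.
by apply: (addrI (T 0)); rewrite -e addr0.
Qed.

(** Openness of U supplies the increments s x with small s > 0. Comparing the two first-order
    estimates and dividing by s bounds T x - T' x by any e > 0. *)
Lemma frechet_unique U f u T T' : open_in (h1 R) U -> U u ->
  frechet_derivative (h1 R) (h0 R) U f u T -> frechet_derivative (h1 R) (h0 R) U f u T' ->
  forall x, carrier (h1 R) x -> T x = T' x.
Proof.
move=> [Uc Uo] hu [[_ lin _] dT] [[_ lin' _] dT'] x hx.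
have c0 := @sobolev0 R 2; have cu := Uc u hu.
have nx := sobolev_norm_ge0 2 x; have sZ := sobolev_normZ (m := 2).
suff : L2norm (T x - T' x) = 0 by move/L2norm_eq0/eqP; rewrite subr_eq0 => /eqP.
apply/eqP; rewrite eq_le L2norm_ge0 andbT; apply/ler_addgt0Pr => e e0; rewrite add0r.
have x1 : 0 < snorm (h1 R) x + 1 by rewrite ltr_wpDl.
(* Chosen so that 2 * eta times the norm of x is at most e; adding 1 avoids a division by 0. *)
pose eta := e / 2 / (snorm (h1 R) x + 1).
have eta0 : 0 < eta by rewrite !divr_gt0.
have [d d0 hd] := dT eta eta0; have [d' d'0 hd'] := dT' eta eta0.
have [r r0 hr] := Uo u hu.
pose s := Num.min (Num.min d d') r / (snorm (h1 R) x + 1).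
have m0 : 0 < Num.min (Num.min d d') r by rewrite !lt_min d0 d'0.
have s0 : 0 < s by rewrite divr_gt0.
have sx : snorm (h1 R) (s *: x) = s * snorm (h1 R) x by rewrite sZ // gtr0_norm.
have sxlt : snorm (h1 R) (s *: x) < Num.min (Num.min d d') r.
  by rewrite sx /s -mulrA gtr_pMr // mulrC ltr_pdivrMr // mul1r ltrDl.
have csx := sobolevZ s hx.
have vE : u + s *: x - u = s *: x by rewrite addrC addKr.
move: (sxlt); rewrite !lt_min => /andP[/andP[l1 l2] l3].
have hv : U (u + s *: x) by apply: hr; [exact: sobolevD|rewrite vE].
have := hd _ hv; rewrite vE => /(_ l1) b1; have := hd' _ hv; rewrite vE => /(_ l2) b2.
have Ts : T (s *: x) = s *: T x by have := lin s x 0 hx c0; rewrite addr0 linear_on0 // addr0.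
have T's : T' (s *: x) = s *: T' x by have := lin' s x 0 hx c0; rewrite addr0 linear_on0 // addr0.
rewrite Ts in b1; rewrite T's in b2; set g := f _ - f u in b1 b2.
have tri : L2norm (s *: (T x - T' x)) <= L2norm (g - s *: T' x) + L2norm (g - s *: T x).
  have -> : s *: (T x - T' x) = (g - s *: T' x) + (- 1) *: (g - s *: T x).
    by rewrite scaleN1r opprB [RHS]addrC addrA subrK scalerBr.
  by apply: le_trans (L2norm_triangle _ _) _; rewrite L2normZ normrN1 mul1r.
rewrite L2normZ (gtr0_norm s0) in tri.
have {}tri := le_trans tri (lerD b2 b1).
have : s * L2norm (T x - T' x) <= s * (2 * (eta * snorm (h1 R) x)).
  have aux (p q r' t : R) : p <= r' * (q * t) + r' * (q * t) -> p <= q * (2 * (r' * t)).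
    by have -> : q * (2 * (r' * t)) = r' * (q * t) + r' * (q * t) by ring.
  by apply: aux; rewrite -sx.
rewrite ler_pM2l // => /le_trans; apply; rewrite /eta.
have -> : 2 * (e / 2 / (snorm (h1 R) x + 1) * snorm (h1 R) x) = e * (snorm (h1 R) x / (snorm (h1 R) x + 1)).
  have aux (p q : R) : q != 0 -> 2 * (e / 2 / q * p) = e * (p / q) by move=> q0; field.
  by apply: aux; rewrite gt_eqF.
by rewrite ger_pMr // ler_pdivrMr // mul1r lerDl.
Qed.

End Operators.

(** * The Hessian of the action *)

Section Hessian.
Context (R : realType) (Z : set (R * R)).
Local Notation E := (loop R).
Implicit Types (u v w x : E).

Definition principal u x : E := (- 4 * dot u u) *: D 2 x.

(** The terms of C with values along x and u. They are Lipschitz in u as operators on h1 for base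
    points near each other in h1, unlike the multiple of u'' that [compact_part] adds. *)
Definition lower_order u x : E :=
  ((4 * dot (D 1 u) (D 1 u) - 2 * (dot u u * dot u u)^-1) *: x + dot (- 8 *: D 2 u) x *: u)
  + dot ((8 * (dot u u * dot u u * dot u u)^-1) *: u) x *: u.

Definition compact_part u x : E := lower_order u x + dot (- 8 *: u) x *: D 2 u.

Definition hessian u x : E := principal u x + compact_part u x.

(** The radius keeps the L^2 norm of v above half that of u, so that its inverse powers stay
    bounded. The case m = 2 serves base points in h1, and m = 4 those in h2. *)
Definition good_ball m u : set E :=
  [set v | [/\ u1 Z v, carrier (sobolev R m) v & snorm (sobolev R m) (v - u) < L2norm u / 2]].

Section GoodBall.
Variables (m : nat) (u : E).
Hypotheses (m2 : (2 <= m)%N) (hu : u1 Z u) (mu : carrier (sobolev R m) u).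
Local Notation N := (good_ball m u).
Local Notation delta := (fun v w => snorm (sobolev R m) (v - w)).

Lemma L2norm_gt0 v : u1 Z v -> 0 < L2norm v.
Proof.
move=> [_ v0 _]; rewrite lt_def L2norm_ge0 andbT.
by apply: contra_notN v0 => /eqP/L2norm_eq0.
Qed.

Lemma good_delta_ge0 v w : N v -> N w -> 0 <= delta v w.
Proof. by move=> _ _; exact: sobolev_norm_ge0. Qed.

Lemma good_carrier : N `<=` carrier (sobolev R m).
Proof. by move=> v []. Qed.

Lemma good_bound v : N v -> snorm (sobolev R m) v <= snorm (sobolev R m) u + L2norm u / 2.
Proof.
move=> [_ mv /ltW d]; have := sobolev_triangle mu (sobolevB mv mu).
by rewrite addrC subrK => /le_trans; apply; rewrite lerD2l.
Qed.

Lemma good_below v : N v -> L2norm u ^+ 2 / 4 <= dot v v.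
Proof.
move=> [_ mv d]; have u0 := L2norm_gt0 hu.
have : L2norm u <= L2norm v + L2norm u / 2.
  have := L2norm_triangle v (u - v); rewrite addrC subrK => /le_trans; apply.
  rewrite lerD2l; apply: le_trans (L2norm_le m _) _.
  by rewrite (normed_distC (sobolev_normed R m)) // ltW.
move=> h; have {}h : L2norm u / 2 <= L2norm v by lra.
rewrite -L2norm_sqr.
have -> : L2norm u ^+ 2 / 4 = (L2norm u / 2) ^+ 2 by field.
by rewrite ler_pXn2r ?nnegrE ?L2norm_ge0 // divr_ge0 // ltW.
Qed.

Lemma good_lip_D n r : (n + r <= m)%N -> lip_vector N delta (sobolev R r) (D n).
Proof.
move=> le; apply: (@lip_D R N delta good_delta_ge0 m n r good_carrier le) => //.
by exists (snorm (sobolev R m) u + L2norm u / 2); exact: good_bound.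
Qed.

Lemma good_lip_D0 n : (n <= m)%N -> lip_vector N delta (h0 R) (D n).
Proof. by move=> le; apply: lip_h0; apply: good_lip_D; rewrite addn0. Qed.

Lemma good_lip_id r : (r <= m)%N -> lip_vector N delta (sobolev R r) id.
Proof.
move=> le; have := @good_lip_D 0%N r le.
by congr (lip_vector _ _ _ _); apply/funext => v; rewrite D0.
Qed.

Lemma good_lip_id0 : lip_vector N delta (h0 R) id.
Proof. exact/lip_h0/good_lip_id. Qed.

Lemma good_lip_sqr : lip_scalar N delta (fun v => dot v v).
Proof. exact: (lip_scalar_dot good_lip_id0 good_lip_id0). Qed.

Let e0 : 0 < L2norm u ^+ 2 / 4.
Proof. by rewrite divr_gt0 // exprn_gt0 // L2norm_gt0. Qed.

Lemma good_lip_inv2 : lip_scalar N delta (fun v => (dot v v * dot v v)^-1).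
Proof.
apply: (lip_scalarV good_delta_ge0 (mulr_gt0 e0 e0)).
  by move=> v hv; apply: ler_pM; rewrite ?(ltW e0) //; exact: good_below.
exact: lip_scalarM good_lip_sqr good_lip_sqr.
Qed.

Lemma good_lip_inv3 : lip_scalar N delta (fun v => (dot v v * dot v v * dot v v)^-1).
Proof.
apply: (lip_scalarV good_delta_ge0 (mulr_gt0 (mulr_gt0 e0 e0) e0)).
  move=> v hv; apply: ler_pM; rewrite ?(ltW e0) ?(ltW (mulr_gt0 e0 e0)) //; last exact: good_below.
  by apply: ler_pM; rewrite ?(ltW e0) //; exact: good_below.
apply: lip_scalarM good_lip_sqr; exact: lip_scalarM good_lip_sqr good_lip_sqr.
Qed.

Lemma good_principal r : lip_field N delta (sobolev R (2 + r)) (sobolev R r) principal.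
Proof.
apply: (lip_field_scalar (c := 1)) => //; first exact: sobolev_normed.
  apply: lip_scalarM good_lip_sqr; exact: lip_scalar_cst good_delta_ge0 _.
move=> x hx; split; first exact: sobolev_D.
by rewrite mul1r; apply: sobolev_norm_D hx _.
Qed.

Lemma good_lower_order X Y : normed Y -> (forall x, carrier X x -> L2norm x <= snorm X x) ->
  (forall x, carrier X x -> carrier Y x /\ snorm Y x <= snorm X x) ->
  lip_vector N delta Y id -> lip_field N delta X Y lower_order.
Proof.
move=> nY X0 XY id_lip.
have cst c : lip_scalar N delta (fun=> c) by exact: lip_scalar_cst good_delta_ge0 _.
have h0n := h0_normed R.
apply: lip_fieldD => //.
  apply: lip_fieldD => //.
    apply: (lip_field_scalar (L := id) (c := 1)) => //; last by move=> x; rewrite mul1r; exact: XY.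
    have := lip_scalarD (lip_scalarM (cst 4) (lip_scalar_dot (good_lip_D0 (n := 1) _) (good_lip_D0 (n := 1) _)))
      (lip_scalarM (cst (- 2)) good_lip_inv2).
    rewrite (_ : (fun v => _ + _) = fun v => 4 * dot (D 1 v) (D 1 v) - 2 * (dot v v * dot v v)^-1).
      by apply; exact: leq_trans m2.
    by apply/funext => v; rewrite mulNr.
  apply: (lip_field_rank1 (p := fun v => - 8 *: D 2 v) (q := id)) => //.
  by apply: lip_vectorZ => //; exact: good_lip_D0.
apply: (lip_field_rank1 (p := fun v => (8 * (dot v v * dot v v * dot v v)^-1) *: v) (q := id)) => //.
apply: lip_vectorZ => //; last exact: good_lip_id0.
by apply: lip_scalarM; [exact: cst|exact: good_lip_inv3].
Qed.

(** The decisive condition is on v'': it is Lipschitz in L^2 on balls of W^{2,2}, and in W^{2,2} on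
    balls of W^{4,2}. *)
Lemma good_compact_part X Y : normed Y -> (forall x, carrier X x -> L2norm x <= snorm X x) ->
  (forall x, carrier X x -> carrier Y x /\ snorm Y x <= snorm X x) ->
  lip_vector N delta Y id -> lip_vector N delta Y (D 2) -> lip_field N delta X Y compact_part.
Proof.
move=> nY X0 XY id_lip D_lip; have h0n := h0_normed R.
apply: lip_fieldD => //; first exact: good_lower_order.
apply: (lip_field_rank1 (p := fun v => - 8 *: v) (q := D 2)) => //.
by apply: lip_vectorZ => //; [exact: lip_scalar_cst good_delta_ge0 _|exact: good_lip_id0].
Qed.

End GoodBall.

End Hessian.

(** * First-order expansions with quadratic remainder *)

Section SecondOrder.
Context (R : realType).
Local Notation E := (loop R).
Variables (N : set E) (t : E -> R) (T : R).
Hypothesis t_bound : forall v, N v -> 0 <= t v <= T.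

(** Here [t v] is the size of the increment and [a'] the linear part. The linear bound on a v - a0
    is kept because the product rule multiplies two of them. *)
Definition scalar_expansion (a : E -> R) (a0 : R) (a' : E -> R) := exists2 k, 0 <= k &
  forall v, N v -> `|a v - a0| <= k * t v /\ `|a v - a0 - a' v| <= k * t v ^+ 2.

Definition vector_expansion (p : E -> E) (p0 : E) (p' : E -> E) := exists2 k, 0 <= k &
  forall v, N v -> L2norm (p v - p0) <= k * t v /\ L2norm (p v - p0 - p' v) <= k * t v ^+ 2.

Lemma scalar_expansionZ a a0 a' c : scalar_expansion a a0 a' ->
  scalar_expansion (fun v => c * a v) (c * a0) (fun v => c * a' v).
Proof.
move=> [k k0 h]; exists (`|c| * k); first exact: mulr_ge0.
move=> v hv; have [h1 h2] := h v hv.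
by rewrite -!mulrBr !normrM -!mulrA; split; rewrite ler_wpM2l.
Qed.

Lemma scalar_expansion_sqr p p0 p' : (forall v, N v -> p v = p0 + p' v) ->
  (exists2 k, 0 <= k & forall v, N v -> L2norm (p' v) <= k * t v) ->
  scalar_expansion (fun v => dot (p v) (p v)) (dot p0 p0) (fun v => 2 * dot p0 (p' v)).
Proof.
move=> pE [k k0 hk]; have n0 := L2norm_ge0 p0.
(* A negative bound T leaves [N] empty. *)
have [T0|T0] := lerP 0 T; last first.
  exists 0 => // v hv; have /andP[h1 h2] := t_bound hv.
  by have := lt_le_trans T0 (le_trans h1 h2); rewrite ltxx.
have c0 : 0 <= 2 * (L2norm p0 * k) + k ^+ 2 * T by rewrite addr_ge0 ?mulr_ge0 ?exprn_ge0.
exists (2 * (L2norm p0 * k) + k ^+ 2 * T + k ^+ 2); first by rewrite addr_ge0 // exprn_ge0.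
move=> v hv; have /andP[t0 tT] := t_bound hv; have hp := hk v hv.
have e1 : dot (p v) (p v) - dot p0 p0 = 2 * dot p0 (p' v) + dot (p' v) (p' v).
  rewrite pE // dotDl !dotDr [dot (p' v) p0]dotC.
  by move: (dot p0 p0) (dot p0 (p' v)) (dot (p' v) (p' v)) => x y z; ring.
have b1 : `|dot p0 (p' v)| <= L2norm p0 * (k * t v).
  by apply: le_trans (dot_le _ _) _; rewrite ler_wpM2l.
have b2 : `|dot (p' v) (p' v)| <= k ^+ 2 * t v ^+ 2.
  by rewrite -exprMn expr2; apply: le_trans (dot_le _ _) _; apply: ler_pM; rewrite ?L2norm_ge0.
rewrite e1; split.
  apply: le_trans (ler_normD _ _) _; rewrite normrM (ger0_norm (_ : 0 <= 2)) //.
  apply: (@le_trans _ _ (2 * (L2norm p0 * (k * t v)) + k ^+ 2 * t v ^+ 2)).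
    by apply: lerD b2; rewrite ler_pM2l.
  have tt : t v ^+ 2 <= T * t v by rewrite expr2 ler_wpM2r.
  have h := ler_wpM2l (exprn_ge0 2 k0) tt.
  have h' : 0 <= k ^+ 2 * t v by rewrite mulr_ge0 // exprn_ge0.
  move: (L2norm p0) (t v) h h' => x y h h'; lra.
rewrite addrC addrA addNr add0r; apply: le_trans b2 _.
by rewrite ler_wpM2r ?exprn_ge0 // lerDr.
Qed.

Lemma scalar_expansion_inv2 a a0 a' e M : 0 < e -> (forall v, N v -> e <= a v <= M) -> e <= a0 <= M ->
  scalar_expansion a a0 a' ->
  scalar_expansion (fun v => (a v * a v)^-1) ((a0 * a0)^-1) (fun v => - 2 * a' v / (a0 * a0 * a0)).
Proof.
move=> e0 bnd /andP[a0e a0M] [k k0 h].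
have a0p : 0 < a0 := lt_le_trans e0 a0e.
have M0 : 0 <= M := le_trans (ltW a0p) a0M.
have ei : 0 <= e^-1 by rewrite invr_ge0 ltW.
(* In the two identities below, y + a0 <= 2 M, a0 + 2 y <= 3 M, and each inverse of y or a0 is at
   most 1 / e. *)
pose K1 := k * (2 * M * e^-1 ^+ 4); pose K2 := 3 * M * e^-1 ^+ 5 * k ^+ 2 + 2 * k * e^-1 ^+ 3.
have K10 : 0 <= K1 by rewrite !mulr_ge0 // exprn_ge0.
have K20 : 0 <= K2 by rewrite addr_ge0 // !mulr_ge0 ?exprn_ge0.
exists (K1 + K2); first exact: addr_ge0.
move=> v hv; have /andP[t0 _] := t_bound hv; have [h1 h2] := h v hv.
have /andP[ve vM] := bnd v hv.
move: (a v) (a' v) (t v) t0 h1 h2 ve vM => y d s s0 h1 h2 ve vM {h bnd}.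
have y0 : 0 < y := lt_le_trans e0 ve.
have inv_le z : e <= z -> 0 <= z^-1 <= e^-1.
  by move=> ez; have z0 := lt_le_trans e0 ez; rewrite invr_ge0 (ltW z0) lef_pV2.
have /andP[yi0 yi] := inv_le y ve; have /andP[xi0 xi] := inv_le a0 a0e.
have xn : a0 != 0 by rewrite gt_eqF.
have yn : y != 0 by rewrite gt_eqF.
have X n : a0^-1 ^+ n <= e^-1 ^+ n by rewrite lerXn2r ?nnegrE.
have Y n : y^-1 ^+ n <= e^-1 ^+ n by rewrite lerXn2r ?nnegrE.
have X0 n : 0 <= a0^-1 ^+ n by rewrite exprn_ge0.
have Y0 n : 0 <= y^-1 ^+ n by rewrite exprn_ge0.
split.
  have -> : (y * y)^-1 - (a0 * a0)^-1 = - ((y - a0) * ((y + a0) * (a0^-1 ^+ 2 * y^-1 ^+ 2))).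
    by field; rewrite xn yn.
  have g0 : 0 <= (y + a0) * (a0^-1 ^+ 2 * y^-1 ^+ 2).
    by apply: mulr_ge0; [apply: addr_ge0; exact: ltW|exact: mulr_ge0].
  rewrite normrN normrM (ger0_norm g0); apply: (@le_trans _ _ (K1 * s)); last by rewrite ler_wpM2r // lerDl.
  rewrite [leRHS](_ : _ = k * s * (2 * M * e^-1 ^+ 4)); last by rewrite /K1; ring.
  apply: ler_pM => //.
  have -> : e^-1 ^+ 4 = e^-1 ^+ 2 * e^-1 ^+ 2 by rewrite -exprD.
  apply: ler_pM; rewrite ?mulr_ge0 //; [by rewrite addr_ge0 // ltW|lra|].
  by apply: ler_pM.
(* The Taylor remainder of y^(-2) in closed form, with its factor (y - a0)^2, plus the effect of
   replacing y - a0 by its linear part d. *)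
have -> : (y * y)^-1 - (a0 * a0)^-1 - - 2 * d / (a0 * a0 * a0) =
    (y - a0) ^+ 2 * ((a0 + 2 * y) * (a0^-1 ^+ 3 * y^-1 ^+ 2)) - 2 * (y - a0 - d) * a0^-1 ^+ 3.
  by field; rewrite xn yn.
apply: (@le_trans _ _ (K2 * s ^+ 2)); last by rewrite ler_wpM2r ?exprn_ge0 // lerDr.
rewrite /K2 [leRHS]mulrDl; apply: le_trans (ler_normB _ _) _; apply: lerD.
  have g0 : 0 <= (a0 + 2 * y) * (a0^-1 ^+ 3 * y^-1 ^+ 2).
    apply: mulr_ge0; last exact: mulr_ge0.
    by apply: addr_ge0; [exact: ltW|apply: mulr_ge0 => //; exact: ltW].
  rewrite normrM (ger0_norm g0) [leRHS](_ : _ = (k * s) ^+ 2 * (3 * M * e^-1 ^+ 5)); last by ring.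
  apply: ler_pM => //.
    by rewrite normrX lerXn2r ?nnegrE // mulr_ge0.
  have -> : e^-1 ^+ 5 = e^-1 ^+ 3 * e^-1 ^+ 2 by rewrite -exprD.
  apply: ler_pM; rewrite ?mulr_ge0 //; [by rewrite addr_ge0 ?mulr_ge0 // ltW|lra|].
  by apply: ler_pM.
rewrite normrM (ger0_norm (X0 3%N)) normrM (ger0_norm (_ : 0 <= 2)) //.
rewrite [leRHS](_ : _ = 2 * (k * s ^+ 2) * e^-1 ^+ 3); last by ring.
by apply: ler_pM; rewrite ?mulr_ge0 // ler_pM2l.
Qed.

(** Product rule. The mixed term (a - a0) (p - p0) is quadratic as a product of two linear bounds,
    and t <= T makes it also linear. *)
Lemma vector_expansionZ a a0 a' p p0 p' : scalar_expansion a a0 a' -> vector_expansion p p0 p' ->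
  vector_expansion (fun v => a v *: p v) (a0 *: p0) (fun v => a' v *: p0 + a0 *: p' v).
Proof.
move=> [k k0 ha] [l l0 hp].
have [T0|T0] := lerP 0 T; last first.
  exists 0 => // v hv; have /andP[h1 h2] := t_bound hv.
  by have := lt_le_trans T0 (le_trans h1 h2); rewrite ltxx.
pose c := k * L2norm p0 + `|a0| * l.
have c0 : 0 <= c by rewrite addr_ge0 // mulr_ge0 // L2norm_ge0.
have kl := mulr_ge0 k0 l0; have klT := mulr_ge0 kl T0.
exists (k * l * T + k * l + c); first by apply: addr_ge0 => //; exact: addr_ge0.
move=> v hv; have /andP[t0 tT] := t_bound hv; have [a1 a2] := ha v hv; have [p1 p2] := hp v hv.
have tri (x y z : E) : L2norm (x + y + z) <= L2norm x + L2norm y + L2norm z.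
  apply: le_trans (L2norm_triangle _ _) _; rewrite lerD2r; exact: L2norm_triangle.
have m1 : L2norm ((a v - a0) *: (p v - p0)) <= k * l * t v ^+ 2.
  rewrite L2normZ [leRHS](_ : _ = k * t v * (l * t v)); last by rewrite expr2 mulrACA.
  by apply: ler_pM; rewrite ?L2norm_ge0.
split.
  have -> : a v *: p v - a0 *: p0 = (a v - a0) *: (p v - p0) + (a v - a0) *: p0 + a0 *: (p v - p0).
    by rewrite -scalerDr subrK scalerBl scalerBr addrA subrK.
  apply: le_trans (tri _ _ _) _; rewrite !L2normZ.
  rewrite !mulrDl -addrA. apply: lerD.
    rewrite -L2normZ; apply: le_trans m1 _; apply: (@le_trans _ _ (k * l * T * t v)).
      by rewrite -!mulrA ler_wpM2l // ler_wpM2l // expr2 ler_wpM2r.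
    by rewrite lerDl mulr_ge0.
  apply: lerD; first by rewrite mulrAC ler_wpM2r ?L2norm_ge0.
  by rewrite -mulrA ler_wpM2l.
have -> : a v *: p v - a0 *: p0 - (a' v *: p0 + a0 *: p' v) =
    (a v - a0) *: (p v - p0) + (a v - a0 - a' v) *: p0 + a0 *: (p v - p0 - p' v).
  rewrite [(a v - a0 - a' v) *: p0]scalerBl [a0 *: (p v - p0 - _)]scalerBr [_ + (_ - a' v *: _)]addrA addrACA -opprD.
  by rewrite -scalerDr subrK scalerBl scalerBr addrA subrK.
apply: le_trans (tri _ _ _) _; rewrite [L2norm (_ *: p0)]L2normZ [L2norm (a0 *: _)]L2normZ.
have -> : (k * l * T + k * l + c) * t v ^+ 2 =
    (k * l * T * t v ^+ 2 + k * l * t v ^+ 2) + k * t v ^+ 2 * L2norm p0 + `|a0| * (l * t v ^+ 2).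
  by rewrite /c; move: (L2norm p0) (t v) `|a0| => x y z; ring.
apply: lerD; last by rewrite ler_wpM2l.
apply: lerD; last by rewrite ler_wpM2r ?L2norm_ge0.
by apply: le_trans m1 _; rewrite lerDr mulr_ge0 // exprn_ge0.
Qed.

Lemma vector_expansionD p p0 p' q q0 q' : vector_expansion p p0 p' -> vector_expansion q q0 q' ->
  vector_expansion (fun v => p v + q v) (p0 + q0) (fun v => p' v + q' v).
Proof.
move=> [k k0 hp] [l l0 hq]; exists (k + l); first exact: addr_ge0.
move=> v hv; have [p1 p2] := hp v hv; have [q1 q2] := hq v hv; rewrite !mulrDl.
have e1 : p v + q v - (p0 + q0) = (p v - p0) + (q v - q0) by rewrite opprD addrACA.
split; first by rewrite e1; exact: le_trans (L2norm_triangle _ _) (lerD p1 q1).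
rewrite e1 opprD addrACA; exact: le_trans (L2norm_triangle _ _) (lerD p2 q2).
Qed.

Lemma vector_expansion_exact p p0 p' : (forall v, N v -> p v = p0 + p' v) ->
  (exists2 k, 0 <= k & forall v, N v -> L2norm (p' v) <= k * t v) -> vector_expansion p p0 p'.
Proof.
move=> pE [k k0 hk]; exists k => // v hv; rewrite pE // addrC addKr; split; first exact: hk.
have -> : L2norm (p' v - p' v) = 0 by rewrite subrr /L2norm dot0l sqrtr0.
by rewrite mulr_ge0 // exprn_ge0 //; have /andP[] := t_bound hv.
Qed.

End SecondOrder.

(** * Symmetry and Fredholm property of the explicit formula *)

Section HessianField.
Context (R : realType) (Z : set (R * R)).
Local Notation E := (loop R).
Implicit Types (u v w x y : E).

Lemma linear_on_rank1 X (p q : E) : linear_on X (fun x => dot p x *: q).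
Proof. by move=> a x y _ _; rewrite dotDr dotZr scalerDl scalerA. Qed.

Lemma linear_onD X (S T : E -> E) : linear_on X S -> linear_on X T -> linear_on X (fun x => S x + T x).
Proof. by move=> lS lT a x y hx hy; rewrite lS // lT // scalerDr addrACA. Qed.

Lemma linear_on_scale X c : linear_on X (fun x : E => c *: x).
Proof. by move=> a x y _ _; rewrite scalerDr !scalerA mulrC. Qed.

Lemma principal_linear m u : (2 <= m)%N -> linear_on (sobolev R m) (principal u).
Proof.
move=> m2 a x y hx hy; rewrite /principal (D_linear _ hx hy) // scalerDr !scalerA.
by rewrite mulrC.
Qed.

Lemma compact_part_linear X u : linear_on X (compact_part u).
Proof.
apply: (linear_onD (S := lower_order u)); last exact: linear_on_rank1.
apply: (linear_onD (S := fun x => _ *: x + dot _ x *: u)); last exact: linear_on_rank1.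
apply: (linear_onD (S := fun x => _ *: x)); last exact: linear_on_rank1.
exact: linear_on_scale.
Qed.

Lemma hessian_linear m u : (2 <= m)%N -> linear_on (sobolev R m) (hessian u).
Proof. by move=> m2; apply: linear_onD; [exact: principal_linear|exact: compact_part_linear]. Qed.

Lemma good_field_continuous m (U : set E) X Y A : (2 <= m)%N ->
  (forall v, U v -> u1 Z v /\ carrier (sobolev R m) v) -> (forall x, carrier X x -> 0 <= snorm X x) ->
  (forall u, U u -> linear_on X (A u)) ->
  (forall u, U u -> lip_field (good_ball Z m u) (fun v w => snorm (sobolev R m) (v - w)) X Y A) ->
  continuous_field (sobolev R m) U X Y A.
Proof.
move=> m2 hU X0 lin lip; apply: lip_field_continuous => //.
- by move=> u _; rewrite subrr -(scale0r 0) sobolev_normZ ?normr0 ?mul0r //; exact: sobolev0.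
- by move=> v w _ _; exact: sobolev_norm_ge0.
- move=> u hu; have [u1u mu] := hU u hu.
  exists (L2norm u / 2); first by rewrite divr_gt0 // (L2norm_gt0 u1u).
  apply: lip_field_ext (lip u hu) => // v [hv d].
  by have [] := hU v hv.
Qed.

Lemma continuous_field_ext H U X Y (A B : E -> E -> E) :
  (forall a x y, carrier X x -> carrier X y -> carrier X (a *: x + y)) ->
  (forall u x, U u -> carrier X x -> A u x = B u x) ->
  continuous_field H U X Y A -> continuous_field H U X Y B.
Proof.
move=> Xlin e [bA cA]; split=> u hu.
  have [XY lin [c hc]] := bA u hu; split.
  - by move=> x hx; rewrite -e //; exact: XY.
  - by move=> a x y hx hy; rewrite -!e ?lin //; exact: Xlin.
  - by exists c => x hx; rewrite -e //; exact: hc.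
move=> eps e0; have [d d0 hd] := cA u hu eps e0; exists d => // v hv vd.
suff <- : opnorm X Y (A v - A u) = opnorm X Y (B v - B u) by exact: hd.
congr sup; apply/seteqP; split=> _ [x [hx x1] <-]; exists x => //; rewrite !fctE;
  by rewrite !e.
Qed.

Lemma principal_symmetric u : symmetric_on (principal u).
Proof. by move=> x y hx hy; rewrite dotZl dotZr (dot_derivative2 (m := 2)). Qed.

(** The rank one terms <u'', x> u and <u, x> u'' are transposes of each other and carry the same
    coefficient -8. *)
Lemma hessian_symmetric u : symmetric_on (hessian u).
Proof.
move=> x y hx hy; rewrite !dotDl !dotDr principal_symmetric // !dotZl !dotZr [dot x (D 2 u)]dotC [dot x u]dotC.
move: (dot (D 2 u) x) (dot (D 2 u) y) (dot u x) (dot u y) (dot x y) => a b c d e.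
by ring.
Qed.

Section Elliptic.
Variables (T F : E -> E) (c a : R).
Hypotheses (c0 : c != 0) (frF : finite_rank F)
  (TE : forall x, carrier (h1 R) x -> T x = c *: D 2 x + a *: x + F x) (symT : symmetric_on T).

Lemma elliptic_fredholm : bounded_op (h1 R) (h0 R) T -> fredholm (h1 R) (h0 R) T 0.
Proof.
move=> bT; have [m [e [einj eK ker dec]]] := elliptic_decomposition c0 frF TE symT.
apply: (fredholm0 bT einj) => //.
- by move=> k; have [] := eK k.
- by move=> x k hx; have [ek Tek] := eK k; rewrite symT // Tek dot0r.
Qed.

Lemma elliptic_fredholm_regular : (forall x, carrier (h1 R) x -> carrier (h1 R) (F x)) ->
  bounded_op (h2 R) (h1 R) T -> fredholm (h2 R) (h1 R) T 0.
Proof.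
move=> Fh bT; have [m [e [einj eK ker dec]]] := elliptic_decomposition c0 frF TE symT.
have reg x : carrier (h1 R) x -> carrier (h1 R) (T x) -> carrier (h2 R) x.
  move=> hx hT; apply: (sobolev_extend (m := 2) (p := 2) (n := 2) hx (sobolevP hx _)) => //.
  have -> : D 2 x = c^-1 *: (T x - a *: x - F x).
    by rewrite TE // addrAC addrK addrK scalerA mulVf // scale1r.
  apply: sobolevZ; apply: sobolevB (Fh x hx); exact: sobolevB hT (sobolevZ _ hx).
have sub21 x : carrier (h2 R) x -> carrier (h1 R) x by exact: sobolev_le.
apply: (fredholm0 bT einj) => //.
- move=> k; have [ek Tek] := eK k; split=> //.
  by apply: reg => //; rewrite Tek; exact: sobolev0.
- by move=> x hx; apply: ker; exact: sub21.
- by move=> x k hx; have [ek Tek] := eK k; rewrite symT ?Tek ?dot0r //; exact: sub21.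
- move=> y hy; have [k [x hx Tx]] := dec y; exists k, x => //.
  by apply: reg => //; rewrite Tx; apply: sobolevB => //; have [] := eK k.
- by move=> y hy; exact: L2norm_le.
- by move=> x y; exact: sobolevB.
Qed.

End Elliptic.

Definition lower_rank u x : E :=
  dot (- 8 *: D 2 u) x *: u + (dot ((8 * (dot u u * dot u u * dot u u)^-1) *: u) x *: u
    + dot (- 8 *: u) x *: D 2 u).

Lemma finite_rank_dot (p q : E) : finite_rank (fun x => dot p x *: q).
Proof.
have l : linear (fun x => dot p x : R^o) by move=> a x y; rewrite dotDr dotZr.
exact: (finite_rank1 (linear_pack l)).
Qed.

Lemma lower_rank_finite u : finite_rank (lower_rank u).
Proof. exact: (finite_rankD (finite_rank_dot _ _) (finite_rankD (finite_rank_dot _ _) (finite_rank_dot _ _))). Qed.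

Lemma hessianE u x : hessian u x = (- 4 * dot u u) *: D 2 x +
  (4 * dot (D 1 u) (D 1 u) - 2 * (dot u u * dot u u)^-1) *: x + lower_rank u x.
Proof. by rewrite /hessian /compact_part /lower_order /principal /lower_rank !addrA. Qed.

Lemma u1_leading u : u1 Z u -> - 4 * dot u u != 0.
Proof.
move=> hu; rewrite mulf_neq0 ?oppr_eq0 ?pnatr_eq0 //.
by rewrite -L2norm_sqr expf_neq0 // gt_eqF // (L2norm_gt0 hu).
Qed.

Lemma lower_rank_regular u x : carrier (h2 R) u -> carrier (h1 R) (lower_rank u x).
Proof.
move=> hu; have u1u : carrier (h1 R) u := sobolev_le (isT : (2 <= 4)%N) hu.
apply: sobolevD; first exact: sobolevZ.
by apply: sobolevD; apply: sobolevZ => //; exact: sobolev_D.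
Qed.

End HessianField.

(** * The explicit formula is the derivative of the gradient *)

Section HessianOfAction.
Context (R : realType) (Z : set (R * R)).
Local Notation E := (loop R).
Implicit Types (u v w x y : E).

(** Used with m = 2, r = 0 for the field from h1 to h0, and with m = 4, r = 2 for the one from h2 to
    h1. *)
Lemma good_hessian m r u : (2 <= m)%N -> u1 Z u -> carrier (sobolev R m) u -> (2 + r <= m)%N ->
  lip_field (good_ball Z m u) (fun v w => snorm (sobolev R m) (v - w))
    (sobolev R (2 + r)) (sobolev R r) (@hessian R).
Proof.
move=> m2 hu mu le; have rm : (r <= m)%N by apply: leq_trans le; exact: leq_addl.
apply: lip_fieldD; [exact: sobolev_normed|exact: good_principal|].
apply: good_compact_part => //.
- exact: sobolev_normed.
- by move=> x _; exact: L2norm_le.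
- move=> x hx; split; first by apply: sobolev_le hx; exact: leq_addl.
  by apply: sobolev_norm_le; exact: leq_addl.
- exact: good_lip_id.
- exact: good_lip_D.
Qed.

Lemma lip_field_h0 (N : set E) d X (A : E -> E -> E) : lip_field N d X (sobolev R 0) A -> lip_field N d X (h0 R) A.
Proof.
move=> [k k0 h]; exists k => // v w x hv hw hx.
by have [_] := h v w x hv hw hx; rewrite !sobolev0_norm.
Qed.

Lemma hessian_continuous : continuous_field (h1 R) (u1 Z) (h1 R) (h0 R) (@hessian R).
Proof.
apply: (@good_field_continuous R Z 2 _ (h1 R)) => //.
- by move=> v hv; split=> //; case: hv.
- by move=> x _; exact: (sobolev_norm_ge0 2).
- by move=> u _; exact: hessian_linear.
- by move=> u hu; apply: lip_field_h0; apply: (good_hessian (r := 0)) => //; case: hu.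
Qed.

Lemma hessian_continuous_regular :
  continuous_field (h2 R) (u1 Z `&` carrier (h2 R)) (h2 R) (h1 R) (@hessian R).
Proof.
apply: (@good_field_continuous R Z 4 _ (h2 R)) => //.
- by move=> x _; exact: (sobolev_norm_ge0 4).
- by move=> u _; exact: hessian_linear.
- by move=> u [hu h2u]; exact: (good_hessian (r := 2)).
Qed.

Lemma frechet_derivative_expansion (f T : E -> E) u (N : set E) (d : R) : 0 < d ->
  (forall v, u1 Z v -> snorm (h1 R) (v - u) < d -> N v) -> bounded_op (h1 R) (h0 R) T ->
  vector_expansion N (fun v => snorm (h1 R) (v - u)) f (f u) (fun v => T (v - u)) ->
  frechet_derivative (h1 R) (h0 R) (u1 Z) f u T.
Proof.
move=> d0 sub bT [k k0 hk]; split=> // e e0.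
have k1 : 0 < k + 1 by rewrite ltr_wpDl.
exists (Num.min d (e / (k + 1))); first by rewrite lt_min d0 divr_gt0.
move=> v hv; rewrite lt_min => /andP[vd ve].
have [_ h] := hk v (sub v hv vd); apply: le_trans h _.
have t0 := sobolev_norm_ge0 2 (v - u).
rewrite expr2 mulrA ler_wpM2r //.
move: ve; rewrite ltr_pdivlMr // mulrDr mulr1 mulrC => /ltW; apply: le_trans.
by rewrite lerDl.
Qed.

Lemma L2norm_pow4 u : L2norm u ^+ 4 = dot u u * dot u u.
Proof. by rewrite -L2norm_sqr -exprD. Qed.

Lemma grad_actionE u : grad_action u =
  ((4 * dot (D 1 u) (D 1 u)) *: u + (- 4 * dot u u) *: D 2 u) + (- 2 * (dot u u * dot u u)^-1) *: u.
Proof. by rewrite /grad_action !L2norm_sqr L2norm_pow4 !mulNr !scaleNr. Qed.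

Section Expansion.
Variable u : E.
Hypothesis hu : u1 Z u.
Let mu : carrier (sobolev R 2) u. Proof. by case: hu. Qed.
Local Notation N := (good_ball Z 2 u).
Let t v := snorm (h1 R) (v - u).
Let T := L2norm u / 2.

Let t_bound v : N v -> 0 <= t v <= T.
Proof. by move=> [_ _ /ltW d]; rewrite sobolev_norm_ge0. Qed.

Let D_step n v : (n <= 2)%N -> N v -> D n v = D n u + D n (v - u).
Proof.
move=> n2 [_ mv _]; have := D_linear 1 mu (sobolevB mv mu) n2.
by rewrite !scale1r addrC subrK.
Qed.

Let D_bound n : (n <= 2)%N -> exists2 k, 0 <= k & forall v, N v -> L2norm (D n (v - u)) <= k * t v.
Proof. by move=> n2; exists 1 => // v _; rewrite mul1r; exact: L2norm_D_le. Qed.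

Let D_expansion n : (n <= 2)%N -> vector_expansion N t (D n) (D n u) (fun v => D n (v - u)).
Proof.
by move=> n2; apply: (vector_expansion_exact t_bound) => [v hv|]; [exact: D_step|exact: D_bound].
Qed.

Let D_sqr_expansion n : (n <= 2)%N ->
  scalar_expansion N t (fun v => dot (D n v) (D n v)) (dot (D n u) (D n u)) (fun v => 2 * dot (D n u) (D n (v - u))).
Proof.
by move=> n2; apply: (scalar_expansion_sqr t_bound) => [v hv|]; [exact: D_step|exact: D_bound].
Qed.

Let D0_id : D 0 = id :> (E -> E). Proof. by apply/funext => v; exact: D0. Qed.

Let sqr_expansion : scalar_expansion N t (fun v => dot v v) (dot u u) (fun v => 2 * dot u (v - u)).
Proof.
by have := D_sqr_expansion (n := 0) isT; rewrite D0_id.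
Qed.

Let id_expansion : vector_expansion N t id u (fun v => v - u).
Proof.
by have := D_expansion (n := 0) isT; rewrite D0_id.
Qed.

Let Nu : N u.
Proof. by split=> //; rewrite subrr -(scale0r 0) sobolev_normZ ?normr0 ?mul0r ?divr_gt0 ?(L2norm_gt0 hu) //; exact: sobolev0. Qed.

Let inv2_expansion : scalar_expansion N t (fun v => (dot v v * dot v v)^-1) (dot u u * dot u u)^-1
  (fun v => - 2 * (2 * dot u (v - u)) / (dot u u * dot u u * dot u u)).
Proof.
have [k k0 hk] := @good_lip_sqr R Z 2 u mu.
have b v : N v -> L2norm u ^+ 2 / 4 <= dot v v <= k.
  move=> hv; rewrite (good_below hu mu hv) /=; have [+ _] := hk v u hv Nu.
  exact: le_trans (ler_norm _).
apply: (scalar_expansion_inv2 t_bound _ b (b u Nu) sqr_expansion).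
by rewrite divr_gt0 // exprn_gt0 // (L2norm_gt0 hu).
Qed.

(** The product rule for the three terms of the gradient gives 4 * 2 <u', x'> u, then -4 * 2 <u, x>
    u'', and -2 * (-2) * 2 <u, x> u divided by the sixth power of the norm: hence the constants
    8. *)
Lemma grad_action_expansion : vector_expansion N t (@grad_action R) (grad_action u) (fun v => hessian u (v - u)).
Proof.
have e1 := vector_expansionZ t_bound (scalar_expansionZ 4 (D_sqr_expansion (n := 1) isT)) id_expansion.
have e2 := vector_expansionZ t_bound (scalar_expansionZ (- 4) sqr_expansion) (D_expansion (n := 2) isT).
have e3 := vector_expansionZ t_bound (scalar_expansionZ (- 2) inv2_expansion) id_expansion.
have [k k0 hk] := vector_expansionD (vector_expansionD e1 e2) e3.
exists k => // v hv; have [l1 l2] := hk v hv; rewrite !grad_actionE; split=> //.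
have h : carrier (h1 R) (v - u) by apply: sobolevB => //; case: hv.
apply: le_trans l2; rewrite le_eqVlt; apply/orP; left; apply/eqP; congr (L2norm (_ - _)).
rewrite hessianE /lower_rank; move: (v - u) h => x hx {l1}.
(* Removes x' from the formula, so that the term is bounded for x in L^2. *)
have d1 : dot (D 1 u) (D 1 x) = - dot (D 2 u) x.
  have := dot_derivative (DD (n := 1) (p := 1) mu isT) (sobolevP hx (isT : (1 <= 2)%N)).
  by move=> ->; rewrite opprK.
rewrite d1 !dotZl.
move: (D 2 x) (D 2 u) (dot (D 2 u) x) (dot u x) (dot u u) (dot (D 1 u) (D 1 u)) => X U d b n c.
have -> : 4 * (2 * - d) = - 8 * d by ring.
have -> : - 4 * (2 * b) = - 8 * b by ring.
have -> : - 2 * (- 2 * (2 * b) / (n * n * n)) = 8 / (n * n * n) * b by move: (n * n * n)^-1 => i; ring.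
have -> : - 2 / (n * n) = - (2 / (n * n)) by rewrite mulNr.
rewrite scalerBl scaleNr !addrA.
by rewrite [LHS](ACl (4*2*6*1*5*3)).
Qed.

End Expansion.

Lemma hessian_derivative : hessian_field Z (@hessian R).
Proof.
move=> u hu; have [bT _] := hessian_continuous.
have d0 : 0 < L2norm u / 2 by rewrite divr_gt0 // (L2norm_gt0 hu).
apply: (frechet_derivative_expansion d0 _ (bT u hu) (grad_action_expansion hu)).
by move=> v hv d; split=> //; case: hv.
Qed.

End HessianOfAction.

(** * The decomposition into principal part and lower order terms *)

Section AlmostExtends.
Context (R : realType) (Z : set (R * R)) (Z_open : open Z).
Local Notation E := (loop R).
Implicit Types (u v w x y : E).

Lemma good_ball_open u : u1 Z u -> open_in (h1 R) (good_ball Z 2 u).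
Proof.
move=> hu; have mu : carrier (h1 R) u by case: hu.
split=> [v [_ mv _]|v [hv mv vd]]; first exact: mv.
have [_ /(_ v hv)[e e0 he]] := u1_open Z_open.
exists (Num.min e (L2norm u / 2 - snorm (h1 R) (v - u))).
  by rewrite lt_min e0 subr_gt0.
move=> w mw; rewrite lt_min => /andP[we wd]; split; [exact: he|exact: mw|].
have := normed_triangle (sobolev_normed R 2) mw mv mu.
move/le_lt_trans; apply; by move: wd; rewrite ltrBrDr.
Qed.

Lemma L2norm_le_fractional (r : R) x : L2norm x <= snorm (fractional_sobolev r) x.
Proof.
have n0 := L2norm_ge0 x; rewrite -[leLHS](ger0_norm n0) -sqrtr_sqr ler_wsqrtr // lerDl.
apply: fine_ge0; apply: esum_ge0 => k _.
by rewrite lee_fin mulr_ge0 ?powR_ge0 // addr_ge0 // sqr_ge0.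
Qed.

Lemma principal_continuous : continuous_field (h1 R) (u1 Z) (h1 R) (h0 R) (@principal R).
Proof.
apply: (@good_field_continuous R Z 2 _ (h1 R)) => //.
- by move=> v hv; split=> //; case: hv.
- by move=> x _; exact: (sobolev_norm_ge0 2).
- by move=> u _; exact: principal_linear.
- by move=> u [mu _ _]; apply: lip_field_h0; exact: (good_principal Z mu 0).
Qed.

Lemma principal_continuous_regular : continuous_field (h1 R) (u1 Z) (h2 R) (h1 R) (@principal R).
Proof.
apply: (@good_field_continuous R Z 2 _ (h2 R)) => //.
- by move=> v hv; split=> //; case: hv.
- by move=> x _; exact: (sobolev_norm_ge0 4).
- by move=> u _; exact: principal_linear.
- by move=> u [mu _ _]; exact: (good_principal Z mu 2).
Qed.

Lemma compact_part_continuous (r : R) : continuous_field (h1 R) (u1 Z) (h r) (h0 R) (@compact_part R).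
Proof.
apply: (@good_field_continuous R Z 2 _ (h r)) => //.
- by move=> v hv; split=> //; case: hv.
- by move=> x _; exact: sqrtr_ge0.
- by move=> u _; exact: compact_part_linear.
move=> u hu; have mu : carrier (sobolev R 2) u by case: hu.
apply: good_compact_part => //.
- exact: h0_normed.
- by move=> x _; exact: L2norm_le_fractional.
- by move=> x _; split=> //; exact: L2norm_le_fractional.
- exact: good_lip_id0.
- exact: good_lip_D0.
Qed.

Lemma compact_part_continuous_regular :
  continuous_field (h2 R) (u1 Z `&` carrier (h2 R)) (h1 R) (h1 R) (@compact_part R).
Proof.
apply: (@good_field_continuous R Z 4 _ (h1 R)) => //.
- by move=> x _; exact: (sobolev_norm_ge0 2).
- by move=> u _; exact: compact_part_linear.
move=> u [hu mu]; apply: good_compact_part => //.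
- exact: sobolev_normed.
- by move=> x _; exact: L2norm_le.
- exact: (good_lip_id Z mu (r := 2)).
- exact: (good_lip_D Z mu (n := 2) (r := 2)).
Qed.

Lemma principal_fredholm u : u1 Z u -> fredholm (h2 R) (h1 R) (principal u) 0.
Proof.
move=> hu; have [bT _] := principal_continuous_regular.
(* The factor 0 presents the zero operator as one of finite rank. *)
apply: (elliptic_fredholm_regular (F := fun x => 0 *: lower_rank u x) (a := 0) (u1_leading hu)) => //.
- exact: (finite_rankZ 0 (lower_rank_finite u)).
- by move=> x _; rewrite !scale0r !addr0.
- exact: principal_symmetric.
- by move=> x _; rewrite scale0r; exact: sobolev0.
- exact: bT.
Qed.

(** The bound contains the h2 norm of w only; exchanging v and w gives the other one, and the
    smaller of the two norms is then available. The L^2 norm of v is controlled by the h1 ball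
    alone. *)
Lemma rank1_difference u v w x : carrier (h1 R) u -> good_ball Z 2 u v -> carrier (h2 R) v -> good_ball Z 2 u w ->
  carrier (h2 R) w -> carrier (h1 R) x -> 
  snorm (h1 R) (dot (- 8 *: v) x *: D 2 v - dot (- 8 *: w) x *: D 2 w) <=
  8 * ((snorm (h1 R) u + L2norm u / 2) * snorm (h2 R) (v - w)
       + snorm (h2 R) w * snorm (h1 R) (v - w)) * snorm (h1 R) x.
Proof.
move=> mu gv hv gw hw hx; have nY := sobolev_normed R 2; have [_ _ tr nZ n0] := nY.
have cD y : carrier (h2 R) y -> carrier (h1 R) (D 2 y) by move=> hy; exact: (@sobolev_D R 2 2 y hy).
have -> : dot (- 8 *: v) x *: D 2 v - dot (- 8 *: w) x *: D 2 w =
    dot (- 8 *: v) x *: (D 2 v - D 2 w) + dot (- 8 *: (v - w)) x *: D 2 w.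
  by rewrite !dotZl dotBl mulrBr scalerBr scalerBl addrA subrK.
have cB := normedB nY (cD v hv) (cD w hw).
have eD : D 2 v - D 2 w = D 2 (v - w).
  have := D_linear (-1) hw hv (isT : (2 <= 4)%N); rewrite !scaleN1r => e.
  by rewrite addrC -e addrC.
apply: le_trans (tr _ _ (normedZ _ nY cB) (normedZ _ nY (cD w hw))) _.
rewrite !nZ //; last exact: cD.
have D_le y : carrier (h2 R) y -> snorm (h1 R) (D 2 y) <= snorm (h2 R) y.
  by move=> hy; exact: (@sobolev_norm_D R 4 2 2 y hy isT).
have dot8 y c : L2norm y <= c -> `|dot (- 8 *: y) x| <= 8 * c * snorm (h1 R) x.
  move=> yc; rewrite dotZl normrM normrN (ger0_norm (_ : 0 <= 8)) // -mulrA ler_wpM2l //.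
  by apply: le_trans (dot_le _ _) _; apply: ler_pM; rewrite ?L2norm_ge0 //; exact: L2norm_le.
have b1 := dot8 v _ (le_trans (L2norm_le 2 v) (good_bound mu gv)).
have b2 := dot8 (v - w) _ (L2norm_le 2 (v - w)).
have c1 : snorm (h1 R) (D 2 v - D 2 w) <= snorm (h2 R) (v - w).
  by rewrite eD; apply: D_le; exact: sobolevB.
have n1 : 0 <= snorm (h1 R) (D 2 v - D 2 w) := n0 _.
have n2 : 0 <= snorm (h1 R) (D 2 w) := n0 _.
apply: le_trans (lerD (ler_pM (normr_ge0 _) n1 b1 c1) (ler_pM (normr_ge0 _) n2 b2 (D_le w hw))) _.
rewrite le_eqVlt; apply/orP; left; apply/eqP.
set p := _ + _ / 2; set q := snorm (h1 R) x; set r := snorm (h2 R) w; set d := snorm (h1 R) (v - w).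
move: (snorm (h2 R) (v - w)) p q r d => a p q r d {b1 b2 c1 n1 n2}.
by ring.
Qed.

Lemma compact_part_estimate u : u1 Z u -> exists kappa, forall v w,
  good_ball Z 2 u v -> carrier (h2 R) v -> good_ball Z 2 u w -> carrier (h2 R) w ->
  opnorm (h1 R) (h1 R) (compact_part v - compact_part w) <=
  kappa * (snorm (h2 R) (v - w) + Num.min (snorm (h2 R) v) (snorm (h2 R) w) * snorm (h1 R) (v - w)).
Proof.
move=> hu; have mu : carrier (sobolev R 2) u by case: hu.
have nY := sobolev_normed R 2; have [_ _ tr nZ n0] := nY.
have [k k0 hk] : lip_field (good_ball Z 2 u) (fun v w => snorm (h1 R) (v - w)) (h1 R) (h1 R) (@lower_order R).
  apply: good_lower_order => //; [by move=> x _; exact: L2norm_le|exact: (good_lip_id Z mu (r := 2))].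
pose M := snorm (h1 R) u + L2norm u / 2.
have M0 : 0 <= M by rewrite addr_ge0 ?sobolev_norm_ge0 // divr_ge0 // L2norm_ge0.
(* The summand k is for the lower order terms, where the h1 distance is at most the h2 distance. In
   [rank1_difference] the two distances have coefficients 8 M and 8, both at most 8 (M + 1). *)
exists (k + 8 * (M + 1)) => v w gv hv gw hw.
set d2 := snorm (h2 R) (v - w); set d1 := snorm (h1 R) (v - w); set mn := Num.min _ _.
have d10 : 0 <= d1 := sobolev_norm_ge0 2 _; have d20 : 0 <= d2 := sobolev_norm_ge0 4 _.
have d12 : d1 <= d2 := sobolev_norm_le (v - w) (isT : (2 <= 4)%N).
have mn0 : 0 <= mn by rewrite le_min; apply/andP; split; [exact: (sobolev_norm_ge0 4 v)|exact: (sobolev_norm_ge0 4 w)].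
have kappa0 : 0 <= k + 8 * (M + 1) by rewrite addr_ge0 // mulr_ge0 // addr_ge0.
apply: opnorm_le; first by rewrite mulr_ge0 // addr_ge0 // mulr_ge0.
  by move=> x _; exact: (sobolev_norm_ge0 2).
move=> x hx; have x0 : 0 <= snorm (h1 R) x := sobolev_norm_ge0 2 x.
have [l1 _ l3] := hk v w x gv gw hx; have [l1' _ _] := hk w v x gw gv hx.
have cD y c : carrier (h2 R) y -> carrier (h1 R) (c *: D 2 y).
  by move=> hy; apply: sobolevZ; exact: (@sobolev_D R 2 2 y hy).
have special : snorm (h1 R) (dot (- 8 *: v) x *: D 2 v - dot (- 8 *: w) x *: D 2 w) <=
    8 * (M * d2 + mn * d1) * snorm (h1 R) x.
  have s1 := rank1_difference mu gv hv gw hw hx.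
  have s2 := rank1_difference mu gw hw gv hv hx.
  have [-> | -> ] : mn = snorm (h2 R) w \/ mn = snorm (h2 R) v.
  - by rewrite /mn /Num.min; case: ifP => _; [right|left].
  - exact: s1.
  - rewrite (normed_distC nY (cD v _ hv) (cD w _ hw)) /d1 /d2.
    have e1 := normed_distC nY (good_carrier gv) (good_carrier gw).
    have e2 := normed_distC (sobolev_normed R 4) hv hw.
    by rewrite e1 e2.
have -> : (compact_part v - compact_part w) x = (lower_order v x - lower_order w x) +
    (dot (- 8 *: v) x *: D 2 v - dot (- 8 *: w) x *: D 2 w).
  by rewrite addrACA -opprD.
apply: le_trans (tr _ _ (normedB nY l1 l1') (normedB nY (cD _ _ hv) (cD _ _ hw))) _.
apply: le_trans (lerD l3 special) _; rewrite -mulrDl ler_wpM2r //.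
have p1 := mulr_ge0 k0 d20; have p2 := mulr_ge0 M0 d20; have p3 := mulr_ge0 mn0 d10.
have p4 := mulr_ge0 k0 p3; have p5 := mulr_ge0 M0 p3; have p6 := ler_wpM2l k0 d12.
rewrite -/d1; move: d1 d2 mn p1 p2 p3 p4 p5 p6 d10 d20 {x0 special l3 d12 mn0} => a b c p1 p2 p3 p4 p5 p6 q1 q2.
rewrite [leRHS](_ : _ = (k * b + 8 * (M * b + c * a)) + (k * (c * a) + 8 * (M * (c * a)) + 8 * b)); last by ring.
apply: (@le_trans _ _ (k * b + 8 * (M * b + c * a))); first by rewrite lerD2r.
by rewrite lerDl addr_ge0 ?addr_ge0 // mulr_ge0.
Qed.

End AlmostExtends.

Theorem theoremB8 (R : realType) (Z : set (R * R))
    (Z_open : open Z) (Z_0 : Z (0, 0)) :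
  (exists B0 : loop R -> loop R -> loop R, hessian_field Z B0) /\
  forall B0 : loop R -> loop R -> loop R, hessian_field Z B0 ->
    weak_hessian_field (@dot R) (h0 R) (h1 R) (h2 R) (u1 Z) B0 /\
    almost_extends (@h R) (h0 R) (h1 R) (h2 R) (u1 Z) B0.
Proof.
have hd := @hessian_derivative R Z.
split; first by exists (@hessian R).
move=> B0 hB.
(* Outside h1 the values of [B0] are arbitrary; every property is transferred through this equality
   on h1. *)
have BE u x : u1 Z u -> carrier (h1 R) x -> hessian u x = B0 u x.
  by move=> hu; exact: (frechet_unique (u1_open Z_open) hu (hd u hu) (hB u hu)).
have sub21 x : carrier (h2 R) x -> carrier (h1 R) x.
  by move=> hx; exact: (@sobolev_le R 4 2 x isT hx).
have c1 : continuous_field (h1 R) (u1 Z) (h1 R) (h0 R) B0.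
  exact: (continuous_field_ext (@sobolev_linear R 2) BE (hessian_continuous Z)).
have c2 : continuous_field (h2 R) (u1 Z `&` carrier (h2 R)) (h2 R) (h1 R) B0.
  apply: (continuous_field_ext (@sobolev_linear R 4) _ (hessian_continuous_regular Z)).
  by move=> u x [hu _] hx; exact: BE hu (sub21 x hx).
have sym u : u1 Z u -> symmetric_on (B0 u).
  by move=> hu x y hx hy; rewrite -!BE //; exact: hessian_symmetric.
have TE u x : u1 Z u -> carrier (h1 R) x -> B0 u x = (- 4 * dot u u) *: D 2 x +
    (4 * dot (D 1 u) (D 1 u) - 2 * (dot u u * dot u u)^-1) *: x + lower_rank u x.
  by move=> hu hx; rewrite -BE // hessianE.
split.
  split; [exact: u1_open|exact: c1|exact: c2|by move=> u x y hu; exact: sym|].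
  split=> u.
    move=> hu; apply: (elliptic_fredholm (u1_leading hu) (lower_rank_finite u) _ (sym u hu)).
      by move=> x; exact: TE.
    by have [b _] := c1; exact: b.
  move=> [hu h2u].
  apply: (elliptic_fredholm_regular (u1_leading hu) (lower_rank_finite u) _ (sym u hu)).
  - by move=> x; exact: TE.
  - by move=> x _; exact: lower_rank_regular.
  - by have [b _] := c2; exact: b.
exists (@principal R), (@compact_part R); split; first by move=> u x hu hx; rewrite -BE.
split.
- exact: principal_continuous.
- exact: principal_continuous_regular.
- split; last exact: compact_part_continuous_regular.
  by exists 0; split; [exact: lexx|exact: ltr01|exact: compact_part_continuous].
- exact: principal_fredholm.
move=> u hu; have [kappa hk] := compact_part_estimate hu.
exists (good_ball Z 2 u), kappa; split.
- exact: good_ball_open.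
- by move=> v [].
- split; [exact: hu|by case: hu|].
  rewrite subrr -(scale0r 0) sobolev_normZ; last exact: sobolev0.
  by rewrite normr0 mul0r divr_gt0 // (L2norm_gt0 hu).
- exact: hk.
Qed.
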